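(* Let $\Bbbk$ be an algebraically closed field of characteristic zero, $\mathfrak{g}$ a finite-dimensional simple Lie algebra over $\Bbbk$ with Serre generators $e_i,f_i$ ($i=1,\dots,n$), and $\hat{\mathfrak{g}}$ its affinization. Let $M$ be a simple completely pointed $\mathfrak{g}$-module, $\hat M=M\otimes\Bbbk[z,z^{-1}]$ the corresponding loop module, and $J=\operatorname{Ann}_{U(\hat{\mathfrak{g}})}\hat M$. There exist a TGW algebra $\mathcal{A}_\mu(R,\sigma,t)$ and a surjective homomorphism $\psi:U(\hat{\mathfrak{g}})\to\mathcal{A}_\mu(R,\sigma,t)$ with kernel $J$ such that $\psi(e_i\otimes1)=X_i$, $\psi(f_i\otimes1)=Y_i$ for $i=1,\dots,n$, and $\psi(e_0\otimes z)=X_0$, $\psi(f_0\otimes z^{-1})=Y_0$.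
   Context: Affinization: $\hat{\mathfrak{g}}=\mathfrak{g}\otimes\Bbbk[z,z^{-1}]\oplus\Bbbk c\oplus\Bbbk z\frac{\partial}{\partial z}$ with $c$ the central element (the usual untwisted affine Lie algebra with derivation). The loop module $\hat M=M\otimes\Bbbk[z,z^{-1}]$ has action $(x\otimes z^k)(m\otimes z^l)=xm\otimes z^{k+l}$, $c$ acts by zero, and $z\frac{\partial}{\partial z}$ acts by differentiation on the second factor. The Serre generators of $\hat{\mathfrak{g}}$ are $e_i\otimes1,f_i\otimes1$ ($i=1,\dots,n$), $e_0\otimes z$, $f_0\otimes z^{-1}$, where $e_0$ is the lowest and $f_0$ the highest vector in the adjoint representation of $\mathfrak{g}$. A weight $\mathfrak{g}$-module $M=\bigoplus_{\mu\in\mathfrak{h}^*}M_\mu$ (with $\mathfrak{h}$ a Cartan subalgebra of $\mathfrak{g}$) is completely pointed (multiplicity free) if $\dim_\Bbbk M_\mu\le1$ for all $\mu\in\mathfrak{h}^*$. TGW (twisted generalized Weyl) algebras. A TGW datum $(R,\sigma,t)$ with index set $I$ (here $I=\{0,1,\dots,n\}$) consists of an associative unital $\Bbbk$-algebra $R$, commuting $\Bbbk$-algebra automorphisms $\sigma=(\sigma_i)_{i\in I}$ of $R$, and nonzero central elements $t=(t_i)_{i\in I}$ of $R$. Given $\mu=(\mu_{ij})_{i\ne j}$ with $\mu_{ij}\in\Bbbk\setminus\{0\}$, $\mathcal{C}_\mu(R,\sigma,t)$ is the free $R$-ring on symbols $X_i,Y_i$ ($i\in I$) modulo the relations $X_ir=\sigma_i(r)X_i$,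 $Y_ir=\sigma_i^{-1}(r)Y_i$, $Y_iX_i=t_i$, $X_iY_i=\sigma_i(t_i)$ ($r\in R$, $i\in I$), $X_iY_j=\mu_{ij}Y_jX_i$ ($i\neq j$). It is graded by the free abelian group $\mathbb{Z}I$ via $\deg X_i=i$, $\deg Y_i=-i$, $\deg r=0$. The TGW algebra $\mathcal{A}_\mu(R,\sigma,t)$ is the quotient of $\mathcal{C}_\mu(R,\sigma,t)$ by the sum of all graded ideals having zero intersection with the degree-zero component; the images of $X_i,Y_i$ are denoted by the same symbols. *)

(* Defs.v *)
From HB Require Import structures.
From mathcomp Require Import all_boot all_order all_algebra.
From mathcomp Require Import generic_quotient.
From mathcomp Require Import finmap boolp classical_sets functions cardinality.
From mathcomp Require Import fsbigop.

Set Implicit Arguments.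
Unset Strict Implicit.
Unset Printing Implicit Defensive.

Import GRing.Theory.
Local Open Scope ring_scope.
Local Open Scope quotient_scope.

(* A presented algebra may be zero, whereas MathComp's algType requires 1 != 0
   and MathComp has no structure joining lmodType and pzRingType; hence the two
   structures are put separately on pres_alg, and the compatibility axioms are
   pres_scalerAl and pres_scalerAr. *)

Inductive alg_term (k T : Type) : Type :=
  | TGen of T
  | TZero
  | TOne
  | TOpp of alg_term k T
  | TAdd of alg_term k T & alg_term k T
  | TMul of alg_term k T & alg_term k T
  | TScale of k & alg_term k T.
Arguments TZero {k T}.
Arguments TOne {k T}.
Arguments TGen {k T} x.

HB.instance Definition _ (k T : Type) := gen_eqMixin (alg_term k T).
HB.instance Definition _ (k T : Type) := gen_choiceMixin (alg_term k T).

Inductive alg_cong (k : fieldType) (T : Type)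
    (rel : alg_term k T -> alg_term k T -> Prop) :
    alg_term k T -> alg_term k T -> Prop :=
  | cong_rel x y : rel x y -> alg_cong rel x y
  | cong_refl x : alg_cong rel x x
  | cong_sym x y : alg_cong rel x y -> alg_cong rel y x
  | cong_trans y x z : alg_cong rel x y -> alg_cong rel y z -> alg_cong rel x z
  | cong_opp x x' : alg_cong rel x x' -> alg_cong rel (TOpp x) (TOpp x')
  | cong_add x x' y y' : alg_cong rel x x' -> alg_cong rel y y' ->
      alg_cong rel (TAdd x y) (TAdd x' y')
  | cong_mul x x' y y' : alg_cong rel x x' -> alg_cong rel y y' ->
      alg_cong rel (TMul x y) (TMul x' y')
  | cong_scale a x x' : alg_cong rel x x' ->
      alg_cong rel (TScale a x) (TScale a x')
  | cong_addA x y z : alg_cong rel (TAdd x (TAdd y z)) (TAdd (TAdd x y) z)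
  | cong_addC x y : alg_cong rel (TAdd x y) (TAdd y x)
  | cong_add0 x : alg_cong rel (TAdd TZero x) x
  | cong_addN x : alg_cong rel (TAdd (TOpp x) x) TZero
  | cong_mulA x y z : alg_cong rel (TMul x (TMul y z)) (TMul (TMul x y) z)
  | cong_mul1l x : alg_cong rel (TMul TOne x) x
  | cong_mul1r x : alg_cong rel (TMul x TOne) x
  | cong_mulDl x y z :
      alg_cong rel (TMul (TAdd x y) z) (TAdd (TMul x z) (TMul y z))
  | cong_mulDr x y z :
      alg_cong rel (TMul x (TAdd y z)) (TAdd (TMul x y) (TMul x z))
  | cong_scaleA a b x :
      alg_cong rel (TScale a (TScale b x)) (TScale (a * b) x)
  | cong_scale1 x : alg_cong rel (TScale 1 x) x
  | cong_scaleDr a x y :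
      alg_cong rel (TScale a (TAdd x y)) (TAdd (TScale a x) (TScale a y))
  | cong_scaleDl x a b :
      alg_cong rel (TScale (a + b) x) (TAdd (TScale a x) (TScale b x))
  | cong_scaleAl a x y :
      alg_cong rel (TScale a (TMul x y)) (TMul (TScale a x) y)
  | cong_scaleAr a x y :
      alg_cong rel (TScale a (TMul x y)) (TMul x (TScale a y)).

Section PresentedAlgebra.
Variables (k : fieldType) (T : Type).
Variable rel : alg_term k T -> alg_term k T -> Prop.
Local Notation term := (alg_term k T).

Definition pres_equiv (x y : term) : bool := `[< alg_cong rel x y >].

Lemma pres_equiv_is_equiv : equiv_class_of pres_equiv.
Proof.
split=> [x|x y|y x z].
- exact/asboolP/cong_refl.
- by apply/asboolP/asboolP => /cong_sym.
- by move=> /asboolP xy /asboolP yz; apply/asboolP/(cong_trans xy).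
Qed.

Canonical pres_equiv_equiv := EquivRelPack pres_equiv_is_equiv.
Canonical pres_equiv_encModRel := defaultEncModRel pres_equiv.

Definition pres_alg : Type := {eq_quot pres_equiv}.
HB.instance Definition _ := Choice.on pres_alg.

Definition pres_class (x : term) : pres_alg := \pi_({eq_quot pres_equiv}) x.
Definition pres_repr (x : pres_alg) : term := repr (x : {eq_quot pres_equiv}).
Definition pres_gen (x : T) : pres_alg := pres_class (TGen x).

Lemma pres_classP x y : pres_class x = pres_class y <-> alg_cong rel x y.
Proof.
split=> [/eqquotP/asboolP //|xy]; exact/eqquotP/asboolP.
Qed.

Lemma pres_reprK x : pres_class (pres_repr x) = x.
Proof. exact: reprK. Qed.

Lemma pres_repr_class x : alg_cong rel (pres_repr (pres_class x)) x.
Proof. by apply/pres_classP; rewrite pres_reprK. Qed.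

Definition pres_add (x y : pres_alg) :=
  pres_class (TAdd (pres_repr x) (pres_repr y)).
Definition pres_opp (x : pres_alg) := pres_class (TOpp (pres_repr x)).
Definition pres_mul (x y : pres_alg) :=
  pres_class (TMul (pres_repr x) (pres_repr y)).
Definition pres_scale (a : k) (x : pres_alg) :=
  pres_class (TScale a (pres_repr x)).

Lemma pres_addE x y :
  pres_add (pres_class x) (pres_class y) = pres_class (TAdd x y).
Proof. by apply/pres_classP/cong_add; apply: pres_repr_class. Qed.
Lemma pres_oppE x : pres_opp (pres_class x) = pres_class (TOpp x).
Proof. by apply/pres_classP/cong_opp; apply: pres_repr_class. Qed.
Lemma pres_mulE x y :
  pres_mul (pres_class x) (pres_class y) = pres_class (TMul x y).
Proof. by apply/pres_classP/cong_mul; apply: pres_repr_class. Qed.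
Lemma pres_scaleE a x : pres_scale a (pres_class x) = pres_class (TScale a x).
Proof. by apply/pres_classP/cong_scale; apply: pres_repr_class. Qed.
Let presE := (pres_addE, pres_oppE, pres_mulE, pres_scaleE).

Fact pres_addA : associative pres_add.
Proof.
move=> x y z; rewrite -[x]pres_reprK -[y]pres_reprK -[z]pres_reprK !presE.
exact/pres_classP/cong_addA.
Qed.
Fact pres_addC : commutative pres_add.
Proof.
move=> x y; rewrite -[x]pres_reprK -[y]pres_reprK !presE.
exact/pres_classP/cong_addC.
Qed.
Fact pres_add0 : left_id (pres_class TZero) pres_add.
Proof.
by move=> x; rewrite -[x]pres_reprK !presE; apply/pres_classP/cong_add0.
Qed.
Fact pres_addN : left_inverse (pres_class TZero) pres_opp pres_add.
Proof.
by move=> x; rewrite -[x]pres_reprK !presE; apply/pres_classP/cong_addN.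
Qed.
HB.instance Definition _ :=
  GRing.isZmodule.Build pres_alg pres_addA pres_addC pres_add0 pres_addN.

Fact pres_mulA : associative pres_mul.
Proof.
move=> x y z; rewrite -[x]pres_reprK -[y]pres_reprK -[z]pres_reprK !presE.
exact/pres_classP/cong_mulA.
Qed.
Fact pres_mul1l : left_id (pres_class TOne) pres_mul.
Proof.
by move=> x; rewrite -[x]pres_reprK !presE; apply/pres_classP/cong_mul1l.
Qed.
Fact pres_mul1r : right_id (pres_class TOne) pres_mul.
Proof.
by move=> x; rewrite -[x]pres_reprK !presE; apply/pres_classP/cong_mul1r.
Qed.
Fact pres_mulDl : left_distributive pres_mul pres_add.
Proof.
move=> x y z; rewrite -[x]pres_reprK -[y]pres_reprK -[z]pres_reprK !presE.
exact/pres_classP/cong_mulDl.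
Qed.
Fact pres_mulDr : right_distributive pres_mul pres_add.
Proof.
move=> x y z; rewrite -[x]pres_reprK -[y]pres_reprK -[z]pres_reprK !presE.
exact/pres_classP/cong_mulDr.
Qed.
HB.instance Definition _ := GRing.Zmodule_isPzRing.Build pres_alg
  pres_mulA pres_mul1l pres_mul1r pres_mulDl pres_mulDr.

Fact pres_scaleA a b x : pres_scale a (pres_scale b x) = pres_scale (a * b) x.
Proof.
by rewrite -[x]pres_reprK !presE; apply/pres_classP/cong_scaleA.
Qed.
Fact pres_scale1 : left_id 1 pres_scale.
Proof.
by move=> x; rewrite -[x]pres_reprK !presE; apply/pres_classP/cong_scale1.
Qed.
Fact pres_scaleDr : right_distributive pres_scale pres_add.
Proof.
move=> a x y; rewrite -[x]pres_reprK -[y]pres_reprK !presE.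
exact/pres_classP/cong_scaleDr.
Qed.
Fact pres_scaleDl x a b :
  pres_scale (a + b) x = pres_add (pres_scale a x) (pres_scale b x).
Proof.
by rewrite -[x]pres_reprK !presE; apply/pres_classP/cong_scaleDl.
Qed.
HB.instance Definition _ := GRing.Zmodule_isLmodule.Build k pres_alg
  pres_scaleA pres_scale1 pres_scaleDr pres_scaleDl.

Lemma pres_scalerAl (a : k) (x y : pres_alg) : a *: (x * y) = (a *: x) * y.
Proof.
rewrite -[x]pres_reprK -[y]pres_reprK.
change (pres_scale a (pres_mul (pres_class (pres_repr x))
  (pres_class (pres_repr y))) = pres_mul (pres_scale a (pres_class (pres_repr x)))
  (pres_class (pres_repr y))).
by rewrite !presE; apply/pres_classP/cong_scaleAl.
Qed.
Lemma pres_scalerAr (a : k) (x y : pres_alg) : a *: (x * y) = x * (a *: y).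
Proof.
rewrite -[x]pres_reprK -[y]pres_reprK.
change (pres_scale a (pres_mul (pres_class (pres_repr x))
  (pres_class (pres_repr y))) = pres_mul (pres_class (pres_repr x))
  (pres_scale a (pres_class (pres_repr y)))).
by rewrite !presE; apply/pres_classP/cong_scaleAr.
Qed.
End PresentedAlgebra.

Section Ideals.
Variables (k : fieldType) (T : Type).
Variable rel : alg_term k T -> alg_term k T -> Prop.
Local Notation A := (pres_alg rel).

Record two_sided_ideal (J : A -> Prop) : Prop := TwoSidedIdeal {
  tsi0 : J 0;
  tsiD : forall x y, J x -> J y -> J (x + y);
  tsiMl : forall a x, J x -> J (a * x);
  tsiMr : forall a x, J x -> J (x * a)
}.

Lemma tsiZ J (J_ideal : two_sided_ideal J) (a : k) x : J x -> J (a *: x).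
Proof.
by move=> Jx; rewrite -[x]mul1r pres_scalerAl; apply: (tsiMl J_ideal).
Qed.

Lemma tsiN J (J_ideal : two_sided_ideal J) x : J x -> J (- x).
Proof. by move=> Jx; rewrite -scaleN1r; apply: tsiZ. Qed.

Lemma tsiB J (J_ideal : two_sided_ideal J) x y : J x -> J y -> J (x - y).
Proof. by move=> Jx Jy; apply: (tsiD J_ideal) => //; apply: tsiN. Qed.
End Ideals.

Section QuotientAlgebra.
Variables (k : fieldType) (T : Type).
Variable rel : alg_term k T -> alg_term k T -> Prop.
Local Notation A := (pres_alg rel).
Variables (J : A -> Prop) (J_ideal : two_sided_ideal J).

Definition quot_equiv of two_sided_ideal J :=
  fun x y : A => `[< J (x - y) >].
Local Notation equiv := (quot_equiv J_ideal).

Lemma quot_equiv_is_equiv : equiv_class_of equiv.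
Proof.
split=> [x|x y|y x z].
- by apply/asboolP; rewrite subrr; apply: (tsi0 J_ideal).
- by apply/asboolP/asboolP => /(tsiN J_ideal); rewrite opprB.
- move=> /asboolP xy /asboolP yz; apply/asboolP.
  by have := tsiD J_ideal xy yz; rewrite addrA subrK.
Qed.

Canonical quot_equiv_equiv := EquivRelPack quot_equiv_is_equiv.
Canonical quot_equiv_encModRel := defaultEncModRel equiv.

Definition quot_alg : Type := {eq_quot equiv}.
HB.instance Definition _ := Choice.on quot_alg.

Definition quot_class (x : A) : quot_alg := \pi_({eq_quot equiv}) x.
Definition quot_repr (x : quot_alg) : A := repr (x : {eq_quot equiv}).

Lemma quot_classP x y : quot_class x = quot_class y <-> J (x - y).
Proof. split=> [/eqquotP/asboolP //|xy]; exact/eqquotP/asboolP. Qed.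

Lemma quot_reprK x : quot_class (quot_repr x) = x.
Proof. exact: reprK. Qed.

Lemma quot_repr_class x : J (quot_repr (quot_class x) - x).
Proof. by apply/quot_classP; rewrite quot_reprK. Qed.

Definition quot_add (x y : quot_alg) := quot_class (quot_repr x + quot_repr y).
Definition quot_opp (x : quot_alg) := quot_class (- quot_repr x).
Definition quot_mul (x y : quot_alg) := quot_class (quot_repr x * quot_repr y).
Definition quot_scale (a : k) (x : quot_alg) := quot_class (a *: quot_repr x).

Lemma quot_addE x y :
  quot_add (quot_class x) (quot_class y) = quot_class (x + y).
Proof.
by apply/quot_classP; rewrite opprD addrACA; apply: (tsiD J_ideal);
  apply: quot_repr_class.
Qed.
Lemma quot_oppE x : quot_opp (quot_class x) = quot_class (- x).
Proof.
apply/quot_classP; rewrite -opprD; apply: (tsiN J_ideal).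
exact: quot_repr_class.
Qed.
Lemma quot_mulE x y :
  quot_mul (quot_class x) (quot_class y) = quot_class (x * y).
Proof.
apply/quot_classP; set x' := quot_repr _; set y' := quot_repr _.
rewrite -(subrK (x' * y) (x' * y')) -addrA -mulrBr -mulrBl.
apply: (tsiD J_ideal); first exact/(tsiMl J_ideal)/quot_repr_class.
exact/(tsiMr J_ideal)/quot_repr_class.
Qed.
Lemma quot_scaleE a x : quot_scale a (quot_class x) = quot_class (a *: x).
Proof.
by apply/quot_classP; rewrite -scalerBr; apply/(tsiZ J_ideal)/quot_repr_class.
Qed.
Let quotE := (quot_addE, quot_oppE, quot_mulE, quot_scaleE).

Fact quot_addA : associative quot_add.
Proof.
move=> x y z; rewrite -[x]quot_reprK -[y]quot_reprK -[z]quot_reprK !quotE.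
by rewrite addrA.
Qed.
Fact quot_addC : commutative quot_add.
Proof.
by move=> x y; rewrite -[x]quot_reprK -[y]quot_reprK !quotE addrC.
Qed.
Fact quot_add0 : left_id (quot_class 0) quot_add.
Proof. by move=> x; rewrite -[x]quot_reprK !quotE add0r. Qed.
Fact quot_addN : left_inverse (quot_class 0) quot_opp quot_add.
Proof. by move=> x; rewrite -[x]quot_reprK !quotE addNr. Qed.
HB.instance Definition _ :=
  GRing.isZmodule.Build quot_alg quot_addA quot_addC quot_add0 quot_addN.

Fact quot_mulA : associative quot_mul.
Proof.
move=> x y z; rewrite -[x]quot_reprK -[y]quot_reprK -[z]quot_reprK !quotE.
by rewrite mulrA.
Qed.
Fact quot_mul1l : left_id (quot_class 1) quot_mul.
Proof. by move=> x; rewrite -[x]quot_reprK !quotE mul1r. Qed.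
Fact quot_mul1r : right_id (quot_class 1) quot_mul.
Proof. by move=> x; rewrite -[x]quot_reprK !quotE mulr1. Qed.
Fact quot_mulDl : left_distributive quot_mul quot_add.
Proof.
move=> x y z; rewrite -[x]quot_reprK -[y]quot_reprK -[z]quot_reprK !quotE.
by rewrite mulrDl.
Qed.
Fact quot_mulDr : right_distributive quot_mul quot_add.
Proof.
move=> x y z; rewrite -[x]quot_reprK -[y]quot_reprK -[z]quot_reprK !quotE.
by rewrite mulrDr.
Qed.
HB.instance Definition _ := GRing.Zmodule_isPzRing.Build quot_alg
  quot_mulA quot_mul1l quot_mul1r quot_mulDl quot_mulDr.

Fact quot_scaleA a b x : quot_scale a (quot_scale b x) = quot_scale (a * b) x.
Proof. by rewrite -[x]quot_reprK !quotE scalerA. Qed.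
Fact quot_scale1 : left_id 1 quot_scale.
Proof. by move=> x; rewrite -[x]quot_reprK !quotE scale1r. Qed.
Fact quot_scaleDr : right_distributive quot_scale quot_add.
Proof.
by move=> a x y; rewrite -[x]quot_reprK -[y]quot_reprK !quotE scalerDr.
Qed.
Fact quot_scaleDl x a b :
  quot_scale (a + b) x = quot_add (quot_scale a x) (quot_scale b x).
Proof. by rewrite -[x]quot_reprK !quotE scalerDl. Qed.
HB.instance Definition _ := GRing.Zmodule_isLmodule.Build k quot_alg
  quot_scaleA quot_scale1 quot_scaleDr quot_scaleDl.

Lemma quot_scalerAl (a : k) (x y : quot_alg) : a *: (x * y) = (a *: x) * y.
Proof.
change (quot_scale a (quot_mul x y) = quot_mul (quot_scale a x) y).
by rewrite -[x]quot_reprK -[y]quot_reprK !quotE pres_scalerAl.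
Qed.
Lemma quot_scalerAr (a : k) (x y : quot_alg) : a *: (x * y) = x * (a *: y).
Proof.
change (quot_scale a (quot_mul x y) = quot_mul x (quot_scale a y)).
by rewrite -[x]quot_reprK -[y]quot_reprK !quotE pres_scalerAr.
Qed.
End QuotientAlgebra.

HB.mixin Record isLieAlgebra (k : fieldType) L of GRing.Lmodule k L := {
  lie : L -> L -> L;
  lie_linearl : forall z : L, linear (lie^~ z);
  lie_linearr : forall z : L, linear (lie z);
  liexx : forall x : L, lie x x = 0;
  lie_jacobi : forall x y z : L,
    lie x (lie y z) + lie y (lie z x) + lie z (lie x y) = 0
}.

#[short(type="lieAlgType")]
HB.structure Definition LieAlgebra (k : fieldType) :=
  {L of GRing.Lmodule k L & isLieAlgebra k L}.

#[short(type="lieVectType")]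
HB.structure Definition LieVector (k : fieldType) :=
  {L of LieAlgebra k L & Vector k L}.

Record lieModule (k : fieldType) (L : lieAlgType k) := LieModule {
  lmod_sort :> lmodType k;
  lact : L -> lmod_sort -> lmod_sort;
  lact_linearl : forall m : lmod_sort, linear (lact^~ m);
  lact_linearr : forall x : L, linear (lact x);
  lact_lie : forall (x y : L) (m : lmod_sort),
    lact (lie x y) m = lact x (lact y m) - lact y (lact x m)
}.

Inductive env_rel (k : fieldType) (L : lieAlgType k) :
    alg_term k L -> alg_term k L -> Prop :=
  | env_linear (a : k) (x y : L) :
      env_rel (TGen (a *: x + y)) (TAdd (TScale a (TGen x)) (TGen y))
  | env_lie (x y : L) :
      env_rel (TAdd (TMul (TGen x) (TGen y)) (TOpp (TMul (TGen y) (TGen x))))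
              (TGen (lie x y)).

Definition env_alg (k : fieldType) (L : lieAlgType k) : Type :=
  pres_alg (@env_rel k L).
HB.instance Definition _ (k : fieldType) (L : lieAlgType k) :=
  GRing.PzRing.on (env_alg L).
HB.instance Definition _ (k : fieldType) (L : lieAlgType k) :=
  GRing.Lmodule.on (env_alg L).

Definition env_gen (k : fieldType) (L : lieAlgType k) (x : L) : env_alg L :=
  pres_gen (@env_rel k L) x.

Fixpoint term_act (k : fieldType) (T : Type) (V : lmodType k)
    (act : T -> V -> V) (u : alg_term k T) (v : V) {struct u} : V :=
  match u with
  | TGen x => act x v
  | TZero => 0
  | TOne => v
  | TOpp x => - term_act act x v
  | TAdd x y => term_act act x v + term_act act y v
  | TMul x y => term_act act x (term_act act y v)
  | TScale a x => a *: term_act act x v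
  end.

Section EnvelopingAction.
Variables (k : fieldType) (L : lieAlgType k) (M : lieModule L).

Definition env_act (u : env_alg L) (m : M) : M :=
  term_act (@lact k L M) (pres_repr u) m.

Definition annihilator (u : env_alg L) : Prop := forall m : M, env_act u m = 0.

Lemma term_act_linear u : linear (term_act (@lact k L M) u).
Proof.
elim: u => [x|||x IHx|x IHx y IHy|x IHx y IHy|b x IHx] a v w //=.
- exact: lact_linearr.
- by rewrite scaler0 addr0.
- by rewrite IHx opprD scalerN.
- by rewrite IHx IHy scalerDr addrACA.
- by rewrite IHy IHx.
- by rewrite IHx scalerDr !scalerA mulrC.
Qed.

Lemma term_act_cong u v : alg_cong (@env_rel k L) u v ->
  forall m : M, term_act (@lact k L M) u m = term_act (@lact k L M) v m.
Proof.
have actD u' m m' : term_act (@lact k L M) u' (m + m') =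
    term_act (@lact k L M) u' m + term_act (@lact k L M) u' m'.
  by have := term_act_linear u' 1 m m'; rewrite !scale1r.
have act0 u' : term_act (@lact k L M) u' 0 = 0.
  by apply: (addrI (term_act (@lact k L M) u' 0)); rewrite -actD !addr0.
have actZ u' a m : term_act (@lact k L M) u' (a *: m) =
    a *: term_act (@lact k L M) u' m.
  by have := term_act_linear u' a m 0; rewrite !addr0 act0 addr0.
elim=> {u v} /=.
- move=> _ _ [a x y|x y] m /=; first exact: lact_linearl.
  by rewrite lact_lie.
- by [].
- by move=> x y _ IH m; rewrite IH.
- by move=> y x z _ IHx _ IHy m; rewrite IHx IHy.
- by move=> x x' _ IH m; rewrite IH.
- by move=> x x' y y' _ IHx _ IHy m; rewrite IHx IHy.
- by move=> x x' y y' _ IHx _ IHy m; rewrite IHx IHy.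
- by move=> a x x' _ IH m; rewrite IH.
- by move=> x y z m; rewrite addrA.
- by move=> x y m; rewrite addrC.
- by move=> x m; rewrite add0r.
- by move=> x m; rewrite addNr.
- by [].
- by [].
- by [].
- by [].
- by move=> x y z m; rewrite actD.
- by move=> a b x m; rewrite scalerA.
- by move=> x m; rewrite scale1r.
- by move=> a x y m; rewrite scalerDr.
- by move=> x a b m; rewrite scalerDl.
- by [].
- by move=> a x y m; rewrite actZ.
Qed.

Lemma env_act_class u m :
  env_act (pres_class (@env_rel k L) u) m = term_act (@lact k L M) u m.
Proof. exact/term_act_cong/pres_repr_class. Qed.

Lemma env_act_gen x m : env_act (env_gen x) m = lact x m.
Proof. exact: env_act_class. Qed.
Lemma env_act1 m : env_act 1 m = m.
Proof. exact: env_act_class. Qed.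
Lemma env_actD u v m : env_act (u + v) m = env_act u m + env_act v m.
Proof. exact: env_act_class. Qed.
Lemma env_actM u v m : env_act (u * v) m = env_act u (env_act v m).
Proof. exact: env_act_class. Qed.
Lemma env_actZ (a : k) u m : env_act (a *: u) m = a *: env_act u m.
Proof. exact: env_act_class. Qed.
End EnvelopingAction.

Section SimpleLie.
Variables (k : fieldType) (g : lieVectType k).

Definition simple_lie : Prop :=
  (exists x y : g, lie x y <> 0) /\
  forall I : {vspace g}, (forall x y : g, y \in I -> lie x y \in I) ->
    I = 0%VS \/ I = fullv.

Definition lie_prodv (U V : {vspace g}) : {vspace g} :=
  <<[seq lie u v | u <- vbasis U, v <- vbasis V]>>%VS.

Definition lie_lcs (H : {vspace g}) (m : nat) : {vspace g} :=
  iter m (lie_prodv H) H.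

Definition cartan_subalgebra (H : {vspace g}) : Prop :=
  [/\ (forall x y : g, x \in H -> y \in H -> lie x y \in H),
      (exists m, lie_lcs H m = 0%VS) &
      (forall x : g, (forall y : g, y \in H -> lie x y \in H) -> x \in H)].

Variable H : {vspace g}.

Local Notation weight := 'Hom(subvs_of H, k^o).

Definition weight_vector (V : lmodType k) (act : g -> V -> V) (mu : weight)
    (v : V) : Prop :=
  forall u : subvs_of H, act (vsval u) v = (mu u : k) *: v.

Definition root (alpha : weight) : Prop :=
  alpha <> 0 /\ exists2 x : g, x <> 0 & weight_vector lie alpha x.

Definition root_base (n : nat) (alpha : 'I_n -> weight) : Prop :=
  [/\ (forall i, root (alpha i)),
      free [seq alpha i | i <- enum 'I_n] &
      (forall beta, root beta -> exists c : 'I_n -> nat,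
          beta = \sum_i alpha i *+ c i \/ beta = - \sum_i alpha i *+ c i)].

(* x in g_alpha and y in g_{-alpha} with [x, y] = alpha^vee *)
Definition chevalley_pair (alpha : weight) (x y : g) : Prop :=
  [/\ weight_vector lie alpha x, weight_vector lie (- alpha) y &
      (exists2 u : subvs_of H, vsval u = lie x y & alpha u = 2%:R)].

Definition serre_generators (n : nat) (e f : 'I_n -> g) : Prop :=
  exists2 alpha : 'I_n -> weight, root_base alpha &
    forall i, chevalley_pair (alpha i) (e i) (f i).

(* e0 and f0 are a lowest and a highest vector of the adjoint representation,
   scaled so that e0 (x) z and f0 (x) z^-1 satisfy the relations
   [h_0, e_0] = 2 e_0, [h_0, f_0] = - 2 f_0 of Serre generators. *)
Definition affine_serre_pair (n : nat) (e f : 'I_n -> g) (e0 f0 : g) : Prop :=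
  exists2 theta : weight, chevalley_pair (- theta) e0 f0 &
    forall i, lie (f i) e0 = 0 /\ lie (e i) f0 = 0.

(* The sum of the weight spaces is automatically direct. *)
Definition weight_module (M : lieModule g) : Prop :=
  forall m : M, exists s : seq M, m = \sum_(v <- s) v /\
    forall v, v \in s -> exists mu : weight, weight_vector (@lact k g M) mu v.

Definition completely_pointed (M : lieModule g) : Prop :=
  forall mu : weight, exists v : M, forall m : M,
    weight_vector (@lact k g M) mu m -> exists a : k, m = a *: v.
End SimpleLie.

Definition simple_module (k : fieldType) (L : lieAlgType k) (M : lieModule L) :
    Prop :=
  (exists m : M, m <> 0) /\
  forall N : M -> Prop,
    N 0 -> (forall (a : k) (x y : M), N x -> N y -> N (a *: x + y)) ->
    (forall (x : L) (m : M), N m -> N (lact x m)) ->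
    (forall m, N m -> m = 0) \/ (forall m, N m).

Section Laurent.
Variables (k : fieldType) (V : lmodType k).

Definition finite_supp : pred (int -> V) :=
  fun x => `[< exists s : seq int, forall i, i \notin s -> x i = 0 >].

(* V (x) k[z, z^-1]: the family x stands for the sum of the x_i (x) z^i *)
Record laurent : Type := Laurent {
  lcoef :> int -> V;
  _ : lcoef \in finite_supp
}.

HB.instance Definition _ := [isSub for lcoef].
HB.instance Definition _ := [Choice of laurent by <:].

Fact finite_supp_submod_closed : submod_closed finite_supp.
Proof.
split=> [|a x y /asboolP[s xs] /asboolP[t yt]].
  by apply/asboolP; exists [::] => i _.
apply/asboolP; exists (s ++ t) => i; rewrite mem_cat negb_or => /andP[si ti].
by rewrite /GRing.add /= /GRing.scale /= xs // yt // scaler0 addr0.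
Qed.
HB.instance Definition _ :=
  GRing.isSubmodClosed.Build k (int -> V) finite_supp finite_supp_submod_closed.
HB.instance Definition _ := [SubChoice_isSubLmodule of laurent by <:].

Fact lmono_subproof (v : V) (i : int) :
  (fun j => if j == i then v else 0) \in finite_supp.
Proof.
apply/asboolP; exists [:: i] => j.
by rewrite inE => /negPf ->.
Qed.
(* v (x) z^i *)
Definition lmono (v : V) (i : int) : laurent := Laurent (lmono_subproof v i).

Fact lderiv_subproof (x : laurent) : (fun i => x i *~ i) \in finite_supp.
Proof.
case: x => x /= /asboolP[s xs]; apply/asboolP; exists s => i si.
by rewrite xs // mul0rz.
Qed.
(* z d/dz *)
Definition lderiv (x : laurent) : laurent := Laurent (lderiv_subproof x).

Lemma lcoefD (x y : laurent) i : (x + y) i = x i + y i. Proof. by []. Qed.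
Lemma lcoef0 i : (0 : laurent) i = 0. Proof. by []. Qed.
Lemma lcoefZ (a : k) (x : laurent) i : (a *: x) i = a *: x i. Proof. by []. Qed.
Lemma lcoef_mono v i j : lmono v i j = if j == i then v else 0.
Proof. by []. Qed.
Lemma lcoef_deriv (x : laurent) i : lderiv x i = x i *~ i. Proof. by []. Qed.
Lemma lcoef_sum I (r : seq I) (F : I -> laurent) i :
  (\sum_(j <- r) F j) i = \sum_(j <- r) F j i.
Proof.
by elim: r => [|j r IHr]; rewrite ?big_nil ?big_cons // lcoefD IHr.
Qed.

Lemma laurentP (x y : laurent) : (forall i, x i = y i) -> x = y.
Proof. by move=> xy; apply/val_inj/funext. Qed.

Lemma laurent_supp (x : laurent) :
  exists2 s : seq int, uniq s & forall i, i \notin s -> x i = 0.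
Proof.
case: x => x /= /asboolP[s xs]; exists (undup s); rewrite ?undup_uniq // => i.
by rewrite mem_undup; apply: xs.
Qed.

Lemma lmonoD u v i : lmono (u + v) i = lmono u i + lmono v i.
Proof.
by apply: laurentP => j; rewrite lcoefD !lcoef_mono; case: eqP; rewrite ?addr0.
Qed.
Lemma lmonoZ a v i : lmono (a *: v) i = a *: lmono v i.
Proof.
by apply: laurentP => j; rewrite lcoefZ !lcoef_mono; case: eqP; rewrite ?scaler0.
Qed.
Lemma lmono0 i : lmono 0 i = 0.
Proof. by rewrite -(scale0r 0) lmonoZ scale0r. Qed.
Lemma lmonoN v i : lmono (- v) i = - lmono v i.
Proof. by rewrite -scaleN1r lmonoZ scaleN1r. Qed.

Lemma lderiv_linear : linear lderiv.
Proof.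
move=> a x y; apply: laurentP => i.
by rewrite !(lcoefD, lcoefZ, lcoef_deriv) mulrzDl scalerMzr.
Qed.
Lemma lderiv_mono v i : lderiv (lmono v i) = lmono (v *~ i) i.
Proof.
apply: laurentP => j; rewrite lcoef_deriv !lcoef_mono.
by case: eqP => [->|] //; rewrite mul0rz.
Qed.

Lemma laurent_decomp (x : laurent) (s : seq int) : uniq s ->
  (forall i, i \notin s -> x i = 0) -> x = \sum_(i <- s) lmono (x i) i.
Proof.
move=> s_uniq xs; apply: laurentP => i; rewrite lcoef_sum.
case: (boolP (i \in s)) => [si|si].
  rewrite (bigD1_seq i) // lcoef_mono eqxx big1 => [|j /negPf ji]; first exact/esym/addr0.
  by rewrite lcoef_mono eq_sym ji.
rewrite xs // big_seq big1 // => j sj; rewrite lcoef_mono.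
by case: eqP => // ij; rewrite ij sj in si.
Qed.

Lemma laurent_ind (P : laurent -> Prop) :
  P 0 -> (forall v i x, P x -> P (lmono v i + x)) -> forall x, P x.
Proof.
move=> P0 PS x; have [s s_uniq xs] := laurent_supp x.
rewrite (laurent_decomp s_uniq xs); elim: s {s_uniq xs} => [|i s IHs].
  by rewrite big_nil.
by rewrite big_cons; apply: PS.
Qed.
End Laurent.

Section LaurentProduct.
Variables (k : fieldType) (U V W : lmodType k) (B : U -> V -> W).

(* The bilinear extension of (u (x) z^i, v (x) z^j) |-> B u v (x) z^(i + j);
   the sums are finite as soon as B u 0 = 0 and B 0 v = 0. *)
Definition lconv (x : laurent U) (y : laurent V) : laurent W :=
  \sum_(i \in [set: int]) \sum_(j \in [set: int]) lmono (B (x i) (y j)) (i + j).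

Hypothesis B_linearl : forall v, linear (B^~ v).
Hypothesis B_linearr : forall u, linear (B u).

Let B0l v : B 0 v = 0.
Proof.
by have := B_linearl v 1 0 0; rewrite !scale1r addr0 -{1}[B 0 v]addr0
  => /addrI.
Qed.
Let B0r u : B u 0 = 0.
Proof.
by have := B_linearr u 1 0 0; rewrite !scale1r addr0 -{1}[B u 0]addr0
  => /addrI.
Qed.

Lemma lconvE (x : laurent U) (y : laurent V) (s t : seq int) : uniq s -> uniq t ->
  (forall i, i \notin s -> x i = 0) -> (forall j, j \notin t -> y j = 0) ->
  lconv x y = \sum_(i <- s) \sum_(j <- t) lmono (B (x i) (y j)) (i + j).
Proof.
have fsE (F : int -> laurent W) (r : seq int) : uniq r ->
    (forall i, i \notin r -> F i = 0) ->
    \sum_(i \in [set: int]) F i = \sum_(i <- r) F i.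
  move=> r_uniq Fr; rewrite (fsbigE r) //; last by move=> i _; apply: Fr.
  by apply: eq_bigl => i; rewrite in_setT.
move=> s_uniq t_uniq xs yt; rewrite /lconv (fsE _ s) //.
  apply: eq_bigr => i _; rewrite (fsE _ t) // => j tj.
  by rewrite yt // B0r lmono0.
by move=> i si; rewrite fsbig1 // => j _; rewrite xs // B0l lmono0.
Qed.

Lemma lconv_linearl y : linear (lconv^~ y).
Proof.
move=> a x x' /=; have [s _ xs] := laurent_supp x.
have [s' _ xs'] := laurent_supp x'; have [t t_uniq yt] := laurent_supp y.
pose r := undup (s ++ s'); have r_uniq : uniq r by apply: undup_uniq.
have xr i : i \notin r -> x i = 0.
  by rewrite mem_undup mem_cat negb_or => /andP[/xs].
have xr' i : i \notin r -> x' i = 0.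
  by rewrite mem_undup mem_cat negb_or => /andP[_ /xs'].
rewrite !(@lconvE _ y r t) //; last first.
  by move=> i ri; rewrite lcoefD lcoefZ xr // xr' // scaler0 addr0.
rewrite scaler_sumr -big_split; apply: eq_bigr => i _.
rewrite scaler_sumr -big_split; apply: eq_bigr => j _ /=.
by rewrite -lmonoZ -lmonoD -B_linearl.
Qed.

Lemma lconv_linearr x : linear (lconv x).
Proof.
move=> a y y' /=; have [s _ ys] := laurent_supp y.
have [s' _ ys'] := laurent_supp y'; have [t t_uniq xt] := laurent_supp x.
pose r := undup (s ++ s'); have r_uniq : uniq r by apply: undup_uniq.
have yr i : i \notin r -> y i = 0.
  by rewrite mem_undup mem_cat negb_or => /andP[/ys].
have yr' i : i \notin r -> y' i = 0.
  by rewrite mem_undup mem_cat negb_or => /andP[_ /ys'].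
rewrite !(@lconvE x _ t r) //; last first.
  by move=> i ri; rewrite lcoefD lcoefZ yr // yr' // scaler0 addr0.
rewrite scaler_sumr -big_split; apply: eq_bigr => i _.
rewrite scaler_sumr -big_split; apply: eq_bigr => j _ /=.
by rewrite -lmonoZ -lmonoD -B_linearr.
Qed.

Lemma lconv_mono u v i j :
  lconv (lmono u i) (lmono v j) = lmono (B u v) (i + j).
Proof.
rewrite (@lconvE _ _ [:: i] [:: j]) //; last 2 first.
- by move=> l; rewrite inE lcoef_mono => /negPf ->.
- by move=> l; rewrite inE lcoef_mono => /negPf ->.
by rewrite !big_seq1 !lcoef_mono !eqxx.
Qed.
End LaurentProduct.

(* When g is simple such a form is unique up to a nonzero scalar, and rescaling
   it amounts to rescaling the central element c of the affinization. *)
Record inv_form (k : fieldType) (g : lieVectType k) := InvForm {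
  iform :> g -> g -> k;
  iform_linearl : forall (z : g) (a : k) (x y : g),
    iform (a *: x + y) z = a * iform x z + iform y z;
  iform_sym : forall x y : g, iform x y = iform y x;
  iform_inv : forall x y z : g, iform (lie x y) z = iform x (lie y z);
  iform_nondeg : forall x : g, (forall y : g, iform x y = 0) -> x = 0
}.

Section Affinization.
Variables (k : fieldType) (g : lieVectType k) (kappa : inv_form g).
Implicit Types x y z : laurent g.

(* ((x, a), b) stands for x + a c + b z d/dz. *)
Definition affine of inv_form g : Type := (laurent g * k^o * k^o)%type.
HB.instance Definition _ := GRing.Lmodule.on (affine kappa).

Definition aff_loop (x : laurent g) : affine kappa := (x, 0, 0).

(* The coefficient of c in [x (x) z^i, y (x) z^j] is i (x | y) when i + j = 0,
   and 0 otherwise. *)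
Definition aff_cocycle (x y : laurent g) : k :=
  lconv (V := g) (W := k^o) kappa (lderiv x) y 0.

Definition aff_lie (u v : affine kappa) : affine kappa :=
  (lconv lie u.1.1 v.1.1 + (u.2 : k) *: lderiv v.1.1
     - (v.2 : k) *: lderiv u.1.1,
   aff_cocycle u.1.1 v.1.1, 0).

Let L := lconv (@lie k g).
Let D := @lderiv k g.
Let w := aff_cocycle.

Let Llinl y : linear (L^~ y).
Proof. exact/lconv_linearl/lie_linearr/lie_linearl. Qed.
Let Llinr x : linear (L x).
Proof. exact/lconv_linearr/lie_linearr/lie_linearl. Qed.
Let Dlin : linear D. Proof. exact: lderiv_linear. Qed.
Let klinl (y : g) : linear ((fun u v => kappa u v : k^o)^~ y).
Proof. by move=> a x x'; rewrite iform_linearl. Qed.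
Let klinr (x : g) : linear (fun v => kappa x v : k^o).
Proof. by move=> a y y'; rewrite ![kappa x _]iform_sym iform_linearl. Qed.
Let wlinl y (a : k) x x' : w (a *: x + x') y = a * w x y + w x' y.
Proof. by rewrite /w /aff_cocycle lderiv_linear (lconv_linearl klinl klinr). Qed.
Let wlinr x (a : k) y y' : w x (a *: y + y') = a * w x y + w x y'.
Proof. by rewrite /w /aff_cocycle (lconv_linearr klinl klinr). Qed.

Let add3ACA (V : zmodType) (a a' b b' c c' : V) :
  a + a' + (b + b') + (c + c') = a + b + c + (a' + b' + c').
Proof. by rewrite (addrACA a) (addrACA (a + b)). Qed.
Let lin0 (U V : lmodType k) (F : U -> V) : linear F -> F 0 = 0.
Proof.
by move=> Flin; have := Flin (-1) 0 0; rewrite !scaleN1r oppr0 addr0 addNr.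
Qed.
Let linD (U V : lmodType k) (F : U -> V) : linear F ->
  forall u v, F (u + v) = F u + F v.
Proof. by move=> Flin u v; rewrite -{1}[u]scale1r Flin scale1r. Qed.
Let linZ (U V : lmodType k) (F : U -> V) : linear F ->
  forall a u, F (a *: u) = a *: F u.
Proof. by move=> Flin a u; rewrite -[a *: u]addr0 Flin (lin0 Flin) addr0. Qed.
Let linN (U V : lmodType k) (F : U -> V) : linear F ->
  forall u, F (- u) = - F u.
Proof. by move=> Flin u; rewrite -!scaleN1r linZ. Qed.

Let LDl x x' y : L (x + x') y = L x y + L x' y. Proof. exact: (linD (Llinl y)). Qed.
Let LDr x y y' : L x (y + y') = L x y + L x y'. Proof. exact: (linD (Llinr x)). Qed.
Let LZr (a : k) x y : L x (a *: y) = a *: L x y. Proof. exact: (linZ (Llinr x)). Qed.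
Let LNr x y : L x (- y) = - L x y. Proof. exact: (linN (Llinr x)). Qed.
Let L0l y : L 0 y = 0. Proof. exact: (lin0 (Llinl y)). Qed.
Let L0r x : L x 0 = 0. Proof. exact: (lin0 (Llinr x)). Qed.
Let DD x y : D (x + y) = D x + D y. Proof. exact: (linD Dlin). Qed.
Let DZ (a : k) x : D (a *: x) = a *: D x. Proof. exact: (linZ Dlin). Qed.
Let DN x : D (- x) = - D x. Proof. exact: (linN Dlin). Qed.
Let D0 : D 0 = 0. Proof. exact: (lin0 Dlin). Qed.
Let Lm (u v : g) i j : L (lmono u i) (lmono v j) = lmono (lie u v) (i + j).
Proof. exact/lconv_mono/lie_linearr/lie_linearl. Qed.
Let Dm (u : g) i : D (lmono u i) = lmono (u *~ i) i.
Proof. exact: lderiv_mono. Qed.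
Let w0l y : w 0 y = 0.
Proof. by have := wlinl y (-1) 0 0; rewrite scaler0 addr0 mulN1r addNr. Qed.
Let w0r x : w x 0 = 0.
Proof. by have := wlinr x (-1) 0 0; rewrite scaler0 addr0 mulN1r addNr. Qed.
Let wDl x x' y : w (x + x') y = w x y + w x' y.
Proof. by have := wlinl y 1 x x'; rewrite scale1r mul1r. Qed.
Let wDr x y y' : w x (y + y') = w x y + w x y'.
Proof. by have := wlinr x 1 y y'; rewrite scale1r mul1r. Qed.
Let wZr (a : k) x y : w x (a *: y) = a * w x y.
Proof. by have := wlinr x a y 0; rewrite w0r !addr0. Qed.
Let wZl (a : k) x y : w (a *: x) y = a * w x y.
Proof. by have := wlinl y a x 0; rewrite w0l !addr0. Qed.
Let wNr x y : w x (- y) = - w x y.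
Proof. by rewrite -scaleN1r wZr mulN1r. Qed.
Let wm (u v : g) i j : w (lmono u i) (lmono v j) =
  if i + j == 0 then kappa u v *~ i else 0.
Proof.
rewrite /w /aff_cocycle lderiv_mono (lconv_mono klinl klinr) lcoef_mono eq_sym.
case: eqP => // _; rewrite -scaler_int.
have k0 : kappa 0 v = 0.
  have := iform_linearl kappa v (-1) 0 0.
  by rewrite scaler0 addr0 mulN1r addNr.
have := iform_linearl kappa v i%:~R u 0.
by rewrite k0 !addr0 mulrzl.
Qed.

Let lieDl (a b c : g) : lie (a + b) c = lie a c + lie b c.
Proof. exact: (linD (lie_linearl c)). Qed.
Let lieDr (a b c : g) : lie a (b + c) = lie a b + lie a c.
Proof. exact: (linD (lie_linearr a)). Qed.
Let lieZl (a : k) (b c : g) : lie (a *: b) c = a *: lie b c.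
Proof. exact: (linZ (lie_linearl c)). Qed.
Let lieZr (a : k) (b c : g) : lie b (a *: c) = a *: lie b c.
Proof. exact: (linZ (lie_linearr b)). Qed.
Let lieC (a b : g) : lie a b = - lie b a.
Proof.
apply/eqP; rewrite -addr_eq0; apply/eqP.
by have := liexx (a + b); rewrite lieDl !lieDr !liexx add0r addr0.
Qed.

Let LC x y : L x y = - L y x.
Proof.
elim/laurent_ind: x => [|u i x IHx]; first by rewrite L0l L0r oppr0.
rewrite LDl LDr opprD IHx; congr (_ + _) => {x IHx}.
elim/laurent_ind: y => [|v j y IHy]; first by rewrite L0l L0r oppr0.
by rewrite LDl LDr opprD IHy; congr (_ + _); rewrite !Lm -lmonoN -lieC addrC.
Qed.
Let Lxx x : L x x = 0.
Proof.
elim/laurent_ind: x => [|u i x IHx]; first by rewrite L0l.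
rewrite LDl !LDr IHx Lm liexx lmono0 [L x _]LC.
by rewrite add0r addr0 addrN.
Qed.
Let Ljac x y z : L x (L y z) + L y (L z x) + L z (L x y) = 0.
Proof.
elim/laurent_ind: x => [|u i x IHx]; first by rewrite !(L0l, L0r) !addr0.
rewrite !(LDl, LDr) add3ACA IHx addr0 {x IHx}.
elim/laurent_ind: y => [|v j y IHy]; first by rewrite !(L0l, L0r) !addr0.
rewrite !(LDl, LDr) add3ACA IHy addr0 {y IHy}.
elim/laurent_ind: z => [|t l z IHz]; first by rewrite !(L0l, L0r) !addr0.
rewrite !(LDl, LDr) add3ACA IHz addr0 {z IHz}.
rewrite !Lm [j + (l + i)]addrA [_ + i]addrC [l + (i + j)]addrC -[i + j + l]addrA.
by rewrite -!lmonoD lie_jacobi lmono0.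
Qed.
Let DL x y : D (L x y) = L (D x) y + L x (D y).
Proof.
elim/laurent_ind: x => [|u i x IHx]; first by rewrite !(D0, L0l, addr0).
rewrite !(DD, LDl) IHx addrACA; congr (_ + _) => {x IHx}.
elim/laurent_ind: y => [|v j y IHy]; first by rewrite !(D0, L0r, addr0).
rewrite !(DD, LDr) IHy addrACA; congr (_ + _).
rewrite !(Dm, Lm) -lmonoD; congr lmono.
by rewrite -!scaler_int lieZl lieZr rmorphD scalerDl.
Qed.
Let wC x y : w x y = - w y x.
Proof.
elim/laurent_ind: x => [|u i x IHx]; first by rewrite w0l w0r oppr0.
rewrite wDl wDr opprD IHx; congr (_ + _) => {x IHx}.
elim/laurent_ind: y => [|v j y IHy]; first by rewrite w0l w0r oppr0.
rewrite wDl wDr opprD IHy; congr (_ + _); rewrite !wm [j + i]addrC.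
have [ij0|_] := eqVneq (i + j) 0; last by rewrite oppr0.
by rewrite iform_sym -mulrNz; congr (_ *~ _); apply/eqP; rewrite -addr_eq0 ij0.
Qed.
Let wxx x : w x x = 0.
Proof.
elim/laurent_ind: x => [|u i x IHx]; first by rewrite w0l.
rewrite wDl !wDr IHx wm [w x _]wC addr0 -addrA addrN addr0.
have [ii0|//] := eqVneq (i + i) 0.
suff -> : i = 0 by rewrite mulr0z.
by apply/eqP; have := Num.Theory.mulrn_eq0 i 2; rewrite mulr2n ii0 eqxx.
Qed.
Let wD x y : w (D x) y + w x (D y) = 0.
Proof.
elim/laurent_ind: x => [|u i x IHx]; first by rewrite D0 !w0l addr0.
rewrite DD !wDl addrACA IHx addr0 {x IHx}.
elim/laurent_ind: y => [|v j y IHy]; first by rewrite D0 !w0r addr0.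
rewrite DD !wDr addrACA IHy addr0 {y IHy}.
rewrite !Dm -!scaler_int !lmonoZ wZr wZl -mulrDl wm -intrD.
by case: eqP => [->|_]; rewrite ?mul0r ?mulr0.
Qed.
Let wjac x y z : w x (L y z) + w y (L z x) + w z (L x y) = 0.
Proof.
elim/laurent_ind: x => [|u i x IHx]; first by rewrite !(L0l, L0r, w0l, w0r) !addr0.
rewrite !(LDl, LDr, wDl, wDr) add3ACA IHx addr0 {x IHx}.
elim/laurent_ind: y => [|v j y IHy]; first by rewrite !(L0l, L0r, w0l, w0r) !addr0.
rewrite !(LDl, LDr, wDl, wDr) add3ACA IHy addr0 {y IHy}.
elim/laurent_ind: z => [|t l z IHz]; first by rewrite !(L0l, L0r, w0l, w0r) !addr0.
rewrite !(LDl, LDr, wDl, wDr) add3ACA IHz addr0 {z IHz}.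
rewrite !Lm !wm [j + (l + i)]addrA [_ + i]addrC [l + (i + j)]addrC -[i + j + l]addrA.
have [ijl|_] := eqVneq (i + (j + l)) 0; last by rewrite !addr0.
have -> : kappa v (lie t u) = kappa u (lie v t).
  by rewrite -iform_inv iform_sym.
have -> : kappa t (lie u v) = kappa u (lie v t).
  by rewrite iform_sym iform_inv.
by rewrite -!mulrzDr -addrA ijl mulr0z.
Qed.

Fact aff_lie_linearl v : linear (aff_lie^~ v).
Proof.
case: v => [[y b'] b] a [[x a1] a2] [[x' a1'] a2'].
congr (_, _, _) => /=; last by rewrite scaler0 addr0.
  rewrite -/L -/D Llinl Dlin.
  have -> : (a *: a2 + a2' : k) *: D y = (a * (a2 : k)) *: D y + (a2' : k) *: D y.
    by rewrite -scalerDl.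
  rewrite [(b : k) *: (_ + _)]scalerDr opprD add3ACA; congr (_ + _).
  by rewrite !scalerDr scalerN !scalerA [a * b]mulrC.
exact: wlinl.
Qed.

Let affC u v : aff_lie u v = - aff_lie v u.
Proof.
case: u v => [[x a'] a] [[y b'] b]; congr (_, _, _) => /=.
- by rewrite -/L -/D LC !opprD opprK addrAC.
- exact: wC.
- by rewrite oppr0.
Qed.

Fact aff_lie_linearr u : linear (aff_lie u).
Proof.
move=> a v v'; rewrite affC aff_lie_linearl opprD -scalerN.
by rewrite -[- aff_lie v u]affC -[- aff_lie v' u]affC.
Qed.

Fact aff_liexx u : aff_lie u u = 0.
Proof.
case: u => [[x a'] a]; congr (_, _, _) => /=; last exact: wxx.
by rewrite -/L Lxx add0r subrr.
Qed.

Let jac_zmod (V : zmodType) (j1 j2 j3 p1 p2 p3 p4 p5 p6 q1 q2 q3 : V) :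
  j1 + j2 + j3 = 0 ->
  j1 + (p1 - p2) + ((- p5 + p4) + (q1 - q2)) +
  (j2 + (p3 - p4) + ((- p1 + p6) + (q3 - q1))) +
  (j3 + (p5 - p6) + ((- p3 + p2) + (q2 - q3))) = 0.
Proof.
move=> j0; rewrite add3ACA (add3ACA j1) j0 add0r.
rewrite (add3ACA (- p5 + p4)).
have -> : q1 - q2 + (q3 - q1) + (q2 - q3) = 0.
  by rewrite (AC (2*2*2) ((1*4)*(2*5)*(3*6)))%AC /= !subrr !addNr !addr0.
rewrite addr0 (AC (2*2*2*(2*2*2)) ((1*9)*(2*12)*(3*11)*(4*8)*(5*7)*(6*10)))%AC /=.
by rewrite !subrr !addNr !addr0.
Qed.

Let jac_aux (x y z : laurent g) (a b c : k) :
  L x (L y z + b *: D z - c *: D y) + a *: D (L y z + b *: D z - c *: D y) =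
  L x (L y z) + (b *: L x (D z) - c *: L x (D y)) +
  ((- (a *: L z (D y)) + a *: L y (D z)) +
   ((a * b) *: D (D z) - (a * c) *: D (D y))).
Proof.
rewrite !(LDr, LNr, LZr) !(DD, DN, DZ) DL (LC (D y)) !scalerDr !scalerN !scalerA.
by rewrite -!addrA.
Qed.

Let jac_loop (x y z : laurent g) (a b c : k) :
  L x (L y z + b *: D z - c *: D y) + a *: D (L y z + b *: D z - c *: D y) +
  (L y (L z x + c *: D x - a *: D z) + b *: D (L z x + c *: D x - a *: D z)) +
  (L z (L x y + a *: D y - b *: D x) + c *: D (L x y + a *: D y - b *: D x))
  = 0.
Proof.
rewrite (jac_aux x) (jac_aux y) (jac_aux z) (mulrC c a) (mulrC c b) (mulrC b a).
exact/jac_zmod/Ljac.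
Qed.

Let jac_center (x y z : laurent g) (a b c : k) :
  w x (L y z + b *: D z - c *: D y) + w y (L z x + c *: D x - a *: D z) +
  w z (L x y + a *: D y - b *: D x) = 0.
Proof.
have wDC x1 x2 : w x2 (D x1) = w x1 (D x2).
  by apply/eqP; rewrite -subr_eq0 -opprB oppr_eq0 -wC addrC wD.
have zmodE (V : zmodType) (j1 j2 j3 p q r : V) : j1 + j2 + j3 = 0 ->
    j1 + p - q + (j2 + q - r) + (j3 + r - p) = 0.
  move=> j0; rewrite -[j1 + p - q]addrA -[j2 + q - r]addrA -[j3 + r - p]addrA.
  rewrite add3ACA j0 add0r (AC (2*2*2) ((1*6)*(2*3)*(4*5)))%AC /=.
  by rewrite subrr !addNr !addr0.
rewrite !wDr !wNr !wZr (wDC x y) (wDC x z) (wDC y z).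
exact/zmodE/wjac.
Qed.

Fact aff_jacobi u v t :
  aff_lie u (aff_lie v t) + aff_lie v (aff_lie t u) + aff_lie t (aff_lie u v)
  = 0.
Proof.
have lieE (x : laurent g) (a' a : k) (y : laurent g) b' :
    aff_lie (x, a', a) (y, b', 0) = (L x y + a *: D y, w x y, 0).
  by rewrite /aff_lie /= scale0r subr0.
case: u v t => [[x a'] a] [[y b'] b] [[z c'] c].
rewrite ![aff_lie _ (aff_lie _ _)]lieE.
congr (_, _, _); [exact: jac_loop | exact: jac_center |].
transitivity (0 + 0 + 0 : k); last by rewrite !addr0.
by [].
Qed.

HB.instance Definition _ := isLieAlgebra.Build k (affine kappa)
  aff_lie_linearl aff_lie_linearr aff_liexx aff_jacobi.

Variable M : lieModule g.

Definition loop_act (u : affine kappa) (m : laurent M) : laurent M :=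
  lconv (@lact k g M) u.1.1 m + (u.2 : k) *: lderiv m.

Let P := lconv (@lact k g M).
Let E := @lderiv k M.
Let Plinl m : linear (P^~ m).
Proof. exact/lconv_linearl/lact_linearr/lact_linearl. Qed.
Let Plinr x : linear (P x).
Proof. exact/lconv_linearr/lact_linearr/lact_linearl. Qed.
Let Elin : linear E. Proof. exact: lderiv_linear. Qed.
Let PDl x x' m : P (x + x') m = P x m + P x' m.
Proof. exact: (linD (Plinl m)). Qed.
Let PDr x m m' : P x (m + m') = P x m + P x m'.
Proof. exact: (linD (Plinr x)). Qed.
Let PZl (a : k) x m : P (a *: x) m = a *: P x m.
Proof. exact: (linZ (Plinl m)). Qed.
Let PZr (a : k) x m : P x (a *: m) = a *: P x m.
Proof. exact: (linZ (Plinr x)). Qed.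
Let PNl x m : P (- x) m = - P x m. Proof. exact: (linN (Plinl m)). Qed.
Let P0l m : P 0 m = 0. Proof. exact: (lin0 (Plinl m)). Qed.
Let P0r x : P x 0 = 0. Proof. exact: (lin0 (Plinr x)). Qed.
Let ED m m' : E (m + m') = E m + E m'. Proof. exact: (linD Elin). Qed.
Let EZ (a : k) m : E (a *: m) = a *: E m. Proof. exact: (linZ Elin). Qed.
Let E0 : E 0 = 0. Proof. exact: (lin0 Elin). Qed.
Let Pm (u : g) (m : M) i j :
  P (lmono u i) (lmono m j) = lmono (lact u m) (i + j).
Proof. exact/lconv_mono/lact_linearr/lact_linearl. Qed.

Let PL x y m : P (L x y) m = P x (P y m) - P y (P x m).
Proof.
elim/laurent_ind: x => [|u i x IHx].
  by rewrite !(L0l, P0l, P0r) subr0.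
rewrite !(LDl, PDl, PDr) IHx opprD addrACA; congr (_ + _) => {x IHx}.
elim/laurent_ind: y => [|v j y IHy].
  by rewrite !(L0r, P0l, P0r) subr0.
rewrite !(LDr, PDl, PDr) IHy opprD addrACA; congr (_ + _) => {y IHy}.
elim/laurent_ind: m => [|t l m IHm].
  by rewrite !P0r subr0.
rewrite !PDr IHm opprD addrACA; congr (_ + _) => {m IHm}.
by rewrite !(Lm, Pm) lact_lie lmonoD lmonoN [j + (i + l)]addrCA !addrA.
Qed.

Let EP x m : E (P x m) = P (D x) m + P x (E m).
Proof.
elim/laurent_ind: x => [|u i x IHx]; first by rewrite !(D0, P0l, E0, addr0).
rewrite !(DD, PDl, ED) IHx addrACA; congr (_ + _) => {x IHx}.
elim/laurent_ind: m => [|v j m IHm]; first by rewrite !(E0, P0r, addr0).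
rewrite !(ED, PDr) IHm addrACA; congr (_ + _) => {m IHm}.
rewrite /E lderiv_mono Dm !Pm lderiv_mono -lmonoD; congr lmono.
rewrite -!scaler_int rmorphD scalerDl.
by rewrite (linZ (lact_linearl v)) (linZ (lact_linearr u)).
Qed.

Fact loop_act_linearl m : linear (loop_act^~ m).
Proof.
move=> a [[x a1] a2] [[x' a1'] a2']; rewrite /loop_act /= -/P -/E Plinl.
have -> : (a *: a2 + a2' : k) *: E m = (a * (a2 : k)) *: E m + (a2' : k) *: E m.
  by rewrite -scalerDl.
by rewrite scalerDr scalerA addrACA.
Qed.

Fact loop_act_linearr u : linear (loop_act u).
Proof.
move=> a m m'; rewrite /loop_act -/P -/E Plinr Elin scalerDr !scalerA.
by rewrite [_ * a]mulrC [X in _ = X + _]scalerDr scalerA addrACA.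
Qed.

Let loop_lie_aux (x y : laurent g) (m : laurent M) (a b : k) :
  P (L x y + a *: D y - b *: D x) m =
  P x (P y m + b *: E m) + a *: E (P y m + b *: E m) -
  (P y (P x m + a *: E m) + b *: E (P x m + a *: E m)).
Proof.
have zmodE (V : zmodType) (p1 p2 p3 p4 p5 p6 q : V) :
    p1 - p2 + p3 - p4 =
    p1 + p5 + (p3 + p6 + q) - (p2 + p6 + (p4 + p5 + q)).
  rewrite !opprD (AC (2*(2*1)*(2*(2*1))) (1*6*3*8*(2*9)*(4*7)*(5*10)))%AC /=.
  by rewrite !subrr !addr0.
rewrite !PDl PNl !PZl !PDr !PZr !ED !EZ !EP PL !scalerDr !scalerA (mulrC b a).
exact: zmodE.
Qed.

Fact loop_act_lie u v m :
  loop_act (lie u v) m = loop_act u (loop_act v m) - loop_act v (loop_act u m).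
Proof.
case: u v => [[x a'] a] [[y b'] b].
rewrite [LHS]/loop_act /= scale0r addr0.
exact: loop_lie_aux.
Qed.

Definition loop_module : lieModule (affine kappa) :=
  LieModule loop_act_linearl loop_act_linearr loop_act_lie.
End Affinization.

Record tgw_datum (k : fieldType) (I : finType) := TGWDatum {
  tgw_R : algType k;
  tgw_sigma : I -> {lrmorphism tgw_R -> tgw_R};
  tgw_sigmaV : I -> tgw_R -> tgw_R;
  tgw_sigmaK : forall i, cancel (tgw_sigma i) (tgw_sigmaV i);
  tgw_sigmaVK : forall i, cancel (tgw_sigmaV i) (tgw_sigma i);
  tgw_sigmaC : forall i j r,
    tgw_sigma i (tgw_sigma j r) = tgw_sigma j (tgw_sigma i r);
  tgw_t : I -> tgw_R;
  tgw_t_neq0 : forall i, tgw_t i <> 0;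
  tgw_t_central : forall i r, tgw_t i * r = r * tgw_t i
}.

Section TGW.
Variables (k : fieldType) (I : finType) (D : tgw_datum k I) (mu : I -> I -> k).
Local Notation R := (tgw_R D).
Local Notation sigma := (@tgw_sigma k I D).
Local Notation sigmaV := (@tgw_sigmaV k I D).
Local Notation t := (@tgw_t k I D).

Inductive tgw_gen : Type := TgwR of R | TgwX of I | TgwY of I.

Local Notation r_ r := (@TGen k tgw_gen (TgwR r)).
Local Notation X_ i := (@TGen k tgw_gen (TgwX i)).
Local Notation Y_ i := (@TGen k tgw_gen (TgwY i)).

(* The first three families make R -> C_mu(R, sigma, t) a homomorphism of
   k-algebras. *)
Inductive tgw_rel : alg_term k tgw_gen -> alg_term k tgw_gen -> Prop :=
  | tgw_R1 : tgw_rel (r_ 1) TOne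
  | tgw_RM (r s : R) : tgw_rel (r_ (r * s)) (TMul (r_ r) (r_ s))
  | tgw_Rlinear (a : k) (r s : R) :
      tgw_rel (r_ (a *: r + s)) (TAdd (TScale a (r_ r)) (r_ s))
  | tgw_Xr i (r : R) :
      tgw_rel (TMul (X_ i) (r_ r)) (TMul (r_ (sigma i r)) (X_ i))
  | tgw_Yr i (r : R) :
      tgw_rel (TMul (Y_ i) (r_ r)) (TMul (r_ (sigmaV i r)) (Y_ i))
  | tgw_YX i : tgw_rel (TMul (Y_ i) (X_ i)) (r_ (t i))
  | tgw_XY i : tgw_rel (TMul (X_ i) (Y_ i)) (r_ (sigma i (t i)))
  | tgw_XYij i j : i <> j ->
      tgw_rel (TMul (X_ i) (Y_ j)) (TScale (mu i j) (TMul (Y_ j) (X_ i))).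

Local Notation C := (pres_alg tgw_rel).
Local Notation cgen := (pres_gen tgw_rel).

Definition tgw_deg (i : I) : {ffun I -> int} := [ffun j => (j == i)%:Z].

(* The grading by Z I determined by the degrees of the generators; the scalars
   lie in degree 0 as images of elements of R. *)
Inductive tgw_homog : {ffun I -> int} -> C -> Prop :=
  | homog_R r : tgw_homog 0 (cgen (TgwR r))
  | homog_X i : tgw_homog (tgw_deg i) (cgen (TgwX i))
  | homog_Y i : tgw_homog (- tgw_deg i) (cgen (TgwY i))
  | homog_D d x y : tgw_homog d x -> tgw_homog d y -> tgw_homog d (x + y)
  | homog_0 d : tgw_homog d 0
  | homog_M d d' x y : tgw_homog d x -> tgw_homog d' y ->
      tgw_homog (d + d') (x * y).

Definition tgw_graded (J : C -> Prop) : Prop :=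
  forall x, J x -> exists s : seq C, x = \sum_(y <- s) y /\
    forall y, y \in s -> J y /\ exists d, tgw_homog d y.

Definition tgw_negligible (J : C -> Prop) : Prop :=
  [/\ two_sided_ideal J, tgw_graded J &
      forall x, J x -> tgw_homog 0 x -> x = 0].

Definition tgw_radical (x : C) : Prop :=
  exists s : seq C, x = \sum_(y <- s) y /\
    forall y, y \in s -> exists2 J, tgw_negligible J & J y.

Fact tgw_radical_ideal : two_sided_ideal tgw_radical.
Proof.
split.
- by exists [::]; rewrite big_nil.
- move=> _ _ [s [-> sJ]] [s' [-> sJ']]; exists (s ++ s'); split.
    by rewrite big_cat.
  by move=> y; rewrite mem_cat => /orP[/sJ|/sJ'].
- move=> a _ [s [-> sJ]]; exists [seq a * y | y <- s]; split.
    by rewrite big_map mulr_sumr.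
  move=> _ /mapP[y /sJ [J nJ Jy] ->]; exists J => //.
  by case: nJ => iJ _ _; apply: (tsiMl iJ).
- move=> a _ [s [-> sJ]]; exists [seq y * a | y <- s]; split.
    by rewrite big_map mulr_suml.
  move=> _ /mapP[y /sJ [J nJ Jy] ->]; exists J => //.
  by case: nJ => iJ _ _; apply: (tsiMr iJ).
Qed.

Definition tgw_alg : Type := quot_alg tgw_radical_ideal.
HB.instance Definition _ := GRing.PzRing.on tgw_alg.
HB.instance Definition _ := GRing.Lmodule.on tgw_alg.

Definition tgw_X (i : I) : tgw_alg :=
  quot_class tgw_radical_ideal (cgen (TgwX i)).
Definition tgw_Y (i : I) : tgw_alg :=
  quot_class tgw_radical_ideal (cgen (TgwY i)).
End TGW.

(* Main.v *)
Require Import Defs.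
From HB Require Import structures.
From mathcomp Require Import all_boot all_order all_algebra.
From mathcomp Require Import boolp functions ring zify.

Set Implicit Arguments.
Unset Strict Implicit.
Unset Printing Implicit Defensive.

Import GRing.Theory.
Local Open Scope ring_scope.

(** Fix nonzero weight vectors [mv mu], one for each weight of [M].  The monomials [mv mu (x) z^l]
    form a basis of the loop module indexed by part of the lattice [L = Z^(n+1)] (the level [l] and the
    simple-root coordinates determine the lattice point), and [X_i], [Y_i] shift the index by the i-th
    unit vector up to a scalar.  Take for [R] a translation invariant algebra of functions on [L],
    for [sigma_i] the translations, and for [t_i] functions which at the weights of [M] give the
    eigenvalues of [f_i e_i]; all [mu_ij] are 1.  Then the TGW algebra acts on the loop module with the
    same image as [U], and since homogeneous elements of degree 0 lie in the image of [R], its radical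
    is the kernel of this action as soon as every function in [R] vanishing at the weights of [M] is
    already zero in [C_mu(R, sigma, t)].

    If some root vector acts injectively on [M], such vectors exist for roots spanning the dual of the
    Cartan subalgebra, the weights of [M] are Zariski dense, and the eigenvalues of products of two
    root vectors are polynomial in the weight, so polynomial functions do.  Otherwise all root vectors
    are locally nilpotent, [M] has finitely many weights, and every function of the weight is realized
    by [U].  The [t_i] may then be chosen freely away from the weights of [M]: one chooses them
    inconsistent there, in the sense that two evaluations of [Y_j X_i X_j Y_i] disagree, which forces
    the functions supported off the weights to vanish in [C_mu(R, sigma, t)]. *)

(** * Twisted generalized Weyl algebras of functions on a lattice *)

(** Little structure theory is given: the Cartan subalgebra is only nilpotent and self-normalizing,
    and the invariant form is arbitrary. Diagonalizability of the adjoint action is transferred from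
    [M], which is faithful unless trivial; sl2-triples and generation by Chevalley generators then
    follow from orthogonality for the form and from the vanishing trace of commutators.

    The obstacle to polynomial eigenvalues is that injective root vectors control a function only on
    a cone, the translates of one weight by nonnegative combinations of injective roots. Different
    cones are compared along root strings: these become arbitrarily long in a suitable direction of
    the cone, and a polynomial of bounded degree is determined by its values on a long string.

    The [t_i] must also be right where a string leaves the weights of [M]: if mu is a weight and mu
    - alpha_i is not, then [X_i Y_i] kills the vector at mu, so t_i(mu - alpha_i) must be 0. In the
    infinite case this follows by density from t_i(mu - alpha_i) = t_i(mu) + mu(h_i); in the finite
    case it is imposed. *)

Section FunctionAlgebra.
Variables (k : fieldType) (L : zmodType).

Record translation_algebra (S : (L -> k) -> Prop) : Prop := TranslationAlgebra {
  tra_const : forall c, S (fun=> c);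
  tra_add : forall F G, S F -> S G -> S (fun x => F x + G x);
  tra_mul : forall F G, S F -> S G -> S (fun x => F x * G x);
  tra_shift : forall d F, S F -> S (fun x => F (x + d))
}.

Variables (S : (L -> k) -> Prop) (hS : translation_algebra S).

(** The proof [hS] is an argument of the predicate so that the closure properties, and with them the
    algebra structure on [fun_alg hS], are inferred from the type. *)
Definition fun_pred of translation_algebra S : pred (L -> k^o) := fun F => `[< S F >].

Record fun_alg := FunAlg { fun_alg_val :> L -> k^o; _ : fun_pred hS fun_alg_val }.
HB.instance Definition _ := [isSub for fun_alg_val].
HB.instance Definition _ := [Choice of fun_alg by <:].

Fact fun_pred_submod : submod_closed (fun_pred hS).
Proof.
split=> [|a F G /asboolP SF /asboolP SG]; apply/asboolP.
  exact: (tra_const hS).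
apply: (tra_add hS) => //; apply: (tra_mul hS (F := fun=> a)) => //.
exact: (tra_const hS).
Qed.
HB.instance Definition _ :=
  GRing.isSubmodClosed.Build k (L -> k^o) (fun_pred hS) fun_pred_submod.
HB.instance Definition _ := [SubChoice_isSubLmodule of fun_alg by <:].

Lemma fun_algP (F G : fun_alg) : F =1 G -> F = G.
Proof. by move=> FG; apply/val_inj/funext. Qed.

Definition fun_mk F (SF : S F) : fun_alg :=
  @FunAlg F (introT (asboolP (S F)) SF).

Fact fun_const_subproof (c : k) : fun_pred hS (fun=> c).
Proof. exact/asboolP/(tra_const hS). Qed.
Definition fun_const c : fun_alg := FunAlg (fun_const_subproof c).
Fact fun_mul_subproof (F G : fun_alg) : fun_pred hS (fun x => F x * G x).
Proof.
case: F G => F /= /asboolP SF [G /= /asboolP SG].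
exact/asboolP/(tra_mul hS).
Qed.
Definition fun_mul F G : fun_alg := FunAlg (fun_mul_subproof F G).
Fact fun_mulA : associative fun_mul.
Proof. by move=> F G K; apply: fun_algP => x; apply: mulrA. Qed.
Fact fun_mul1l : left_id (fun_const 1) fun_mul.
Proof. by move=> F; apply: fun_algP => x; apply: mul1r. Qed.
Fact fun_mul1r : right_id (fun_const 1) fun_mul.
Proof. by move=> F; apply: fun_algP => x; apply: mulr1. Qed.
Fact fun_mulDl : left_distributive fun_mul +%R.
Proof. by move=> F G K; apply: fun_algP => x; apply: mulrDl. Qed.
Fact fun_mulDr : right_distributive fun_mul +%R.
Proof. by move=> F G K; apply: fun_algP => x; apply: mulrDr. Qed.
Fact fun_const_neq0 : fun_const 1 != 0.
Proof.
apply/eqP => /(congr1 (fun F : fun_alg => F 0)) /eqP.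
by have := oner_neq0 k => /negPf; rewrite /= => ->.
Qed.
HB.instance Definition _ := GRing.Zmodule_isNzRing.Build fun_alg
  fun_mulA fun_mul1l fun_mul1r fun_mulDl fun_mulDr fun_const_neq0.
Fact fun_alg_scaleAl (a : k) (F G : fun_alg) : a *: (F * G) = (a *: F) * G.
Proof. by apply: fun_algP => x; apply: mulrA. Qed.
HB.instance Definition _ := GRing.Lmodule_isLalgebra.Build k fun_alg fun_alg_scaleAl.
Fact fun_alg_scaleAr (a : k) (F G : fun_alg) : a *: (F * G) = F * (a *: G).
Proof. by apply: fun_algP => x; apply: mulrCA. Qed.
HB.instance Definition _ := GRing.Lalgebra_isAlgebra.Build k fun_alg fun_alg_scaleAr.

Fact fun_shift_subproof (d : L) (F : fun_alg) : fun_pred hS (fun x => F (x + d)).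
Proof. by case: F => F /= /asboolP SF; apply/asboolP/(tra_shift hS). Qed.
Definition fun_shift (d : L) (F : fun_alg) : fun_alg := FunAlg (fun_shift_subproof d F).
Fact fun_shift_linear d : linear (fun_shift d).
Proof. by move=> a F G; apply: fun_algP. Qed.
HB.instance Definition _ d := GRing.isLinear.Build k fun_alg fun_alg _ (fun_shift d) (fun_shift_linear d).
Fact fun_shift_monoid d : monoid_morphism (fun_shift d).
Proof. by split=> [|F G]; apply: fun_algP. Qed.
HB.instance Definition _ d := GRing.isMonoidMorphism.Build fun_alg fun_alg (fun_shift d) (fun_shift_monoid d).
Lemma fun_shift_add d d' F : fun_shift d (fun_shift d' F) = fun_shift (d + d') F.
Proof. by apply: fun_algP => x /=; rewrite addrA. Qed.
Lemma fun_shift0 F : fun_shift 0 F = F.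
Proof. by apply: fun_algP => x /=; rewrite addr0. Qed.
End FunctionAlgebra.

Section LinearPredicate.
Variables (k : fieldType) (U V : lmodType k) (F : U -> V).
Hypothesis F_lin : linear F.
Lemma lin_0 : F 0 = 0.
Proof. by have := F_lin (-1) 0 0; rewrite !scaleN1r oppr0 addr0 addNr. Qed.
Lemma lin_D u v : F (u + v) = F u + F v.
Proof. by rewrite -{1}[u]scale1r F_lin scale1r. Qed.
Lemma lin_Z a u : F (a *: u) = a *: F u.
Proof. by rewrite -[a *: u]addr0 F_lin lin_0 addr0. Qed.
Lemma lin_N u : F (- u) = - F u.
Proof. by rewrite -!scaleN1r lin_Z. Qed.
Lemma lin_B u v : F (u - v) = F u - F v.
Proof. by rewrite lin_D lin_N. Qed.
Lemma lin_sum I (s : seq I) (P : pred I) (f : I -> U) :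
  F (\sum_(i <- s | P i) f i) = \sum_(i <- s | P i) F (f i).
Proof. exact: (big_morph F lin_D lin_0). Qed.
End LinearPredicate.

(** * Modules over presented algebras *)

Section PresentedModule.
Variables (k : fieldType) (T : Type) (rel : alg_term k T -> alg_term k T -> Prop).
Variables (V : lmodType k) (act : T -> V -> V).
Hypothesis act_linear : forall x, linear (act x).
Hypothesis act_rel : forall x y, rel x y -> forall v, term_act act x v = term_act act y v.

Lemma gen_term_act_linear u : linear (term_act act u).
Proof.
elim: u => [x|||x IHx|x IHx y IHy|x IHx y IHy|b x IHx] a v w //=.
- exact: act_linear.
- by rewrite scaler0 addr0.
- by rewrite IHx opprD scalerN.
- by rewrite IHx IHy scalerDr addrACA.
- by rewrite IHy IHx.
- by rewrite IHx scalerDr !scalerA mulrC.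
Qed.

Lemma gen_term_act_cong u v : alg_cong rel u v ->
  forall m, term_act act u m = term_act act v m.
Proof.
elim=> {u v} /=.
- exact: act_rel.
- by [].
- by move=> x y _ IH m; rewrite IH.
- by move=> y x z _ IHx _ IHy m; rewrite IHx IHy.
- by move=> x x' _ IH m; rewrite IH.
- by move=> x x' y y' _ IHx _ IHy m; rewrite IHx IHy.
- by move=> x x' y y' _ IHx _ IHy m; rewrite IHx IHy.
- by move=> a x x' _ IH m; rewrite IH.
- by move=> x y z m; rewrite addrA.
- by move=> x y m; rewrite addrC.
- by move=> x m; rewrite add0r.
- by move=> x m; rewrite addNr.
- by [].
- by [].
- by [].
- by [].
- by move=> x y z m; rewrite (lin_D (gen_term_act_linear x)).
- by move=> a b x m; rewrite scalerA.
- by move=> x m; rewrite scale1r.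
- by move=> a x y m; rewrite scalerDr.
- by move=> x a b m; rewrite scalerDl.
- by [].
- by move=> a x y m; rewrite (lin_Z (gen_term_act_linear x)).
Qed.

Definition pres_act (u : pres_alg rel) (m : V) : V := term_act act (pres_repr u) m.

Lemma pres_act_class u m : pres_act (pres_class rel u) m = term_act act u m.
Proof. exact/gen_term_act_cong/pres_repr_class. Qed.
Lemma pres_act_linear u : linear (pres_act u).
Proof. exact: gen_term_act_linear. Qed.
Lemma pres_act_gen x m : pres_act (pres_gen rel x) m = act x m.
Proof. exact: pres_act_class. Qed.
Lemma pres_act0 m : pres_act 0 m = 0.
Proof. exact: pres_act_class. Qed.
Lemma pres_act1 m : pres_act 1 m = m.
Proof. exact: pres_act_class. Qed.
Lemma pres_actD u v m : pres_act (u + v) m = pres_act u m + pres_act v m.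
Proof. exact: pres_act_class. Qed.
Lemma pres_actN u m : pres_act (- u) m = - pres_act u m.
Proof. exact: pres_act_class. Qed.
Lemma pres_actM u v m : pres_act (u * v) m = pres_act u (pres_act v m).
Proof. exact: pres_act_class. Qed.
Lemma pres_actZ (a : k) u m : pres_act (a *: u) m = a *: pres_act u m.
Proof. exact: pres_act_class. Qed.
Lemma pres_act_sum I (s : seq I) (f : I -> pres_alg rel) m :
  pres_act (\sum_(i <- s) f i) m = \sum_(i <- s) pres_act (f i) m.
Proof.
apply: (big_morph (fun u => pres_act u m)) => [u v|]; first exact: pres_actD.
exact: pres_act0.
Qed.
End PresentedModule.

Lemma pres_ind (k : fieldType) (T : Type) (rel : alg_term k T -> alg_term k T -> Prop)
    (P : pres_alg rel -> Prop) :
  (forall x, P (pres_gen rel x)) -> P 0 -> P 1 ->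
  (forall u v, P u -> P v -> P (u + v)) -> (forall u v, P u -> P v -> P (u * v)) ->
  (forall (a : k) u, P u -> P (a *: u)) -> forall u, P u.
Proof.
move=> Pg P0 P1 PD PM PZ u; rewrite -[u]pres_reprK; elim: (pres_repr u) => {u}.
- exact: Pg.
- exact: P0.
- exact: P1.
- move=> x Px; rewrite -pres_oppE; have := PZ (-1) _ Px.
  by rewrite scaleN1r.
- by move=> x Px y Py; rewrite -pres_addE; apply: PD.
- by move=> x Px y Py; rewrite -pres_mulE; apply: PM.
- by move=> a x Px; rewrite -pres_scaleE; apply: PZ.
Qed.

(** * Normal forms and the degree zero part of C_mu(R, sigma, t) *)

Section TGWStructure.
Variables (k : fieldType) (I : finType) (D : tgw_datum k I) (mu : I -> I -> k).
Hypothesis mu_neq0 : forall i j, i <> j -> mu i j <> 0.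
Local Notation R := (tgw_R D).
Local Notation sigma := (@tgw_sigma k I D).
Local Notation sigmaV := (@tgw_sigmaV k I D).
Local Notation t := (@tgw_t k I D).
Local Notation rel := (@tgw_rel k I D mu).
Local Notation C := (pres_alg rel).
Local Notation hom := (@tgw_homog k I D mu).

Definition tgw_iota (r : R) : C := pres_gen rel (TgwR r).
Definition tgw_cX (i : I) : C := pres_gen rel (TgwX D i).
Definition tgw_cY (i : I) : C := pres_gen rel (TgwY D i).
Local Notation iota := tgw_iota.
Local Notation X := tgw_cX.
Local Notation Y := tgw_cY.

Lemma pres_relE x y : rel x y -> pres_class rel x = pres_class rel y.
Proof. by move=> xy; apply/pres_classP/cong_rel. Qed.

Lemma iota1 : iota 1 = 1. Proof. exact: (pres_relE (tgw_R1 _ _)). Qed.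
Lemma iotaM r s : iota (r * s) = iota r * iota s.
Proof. by rewrite [LHS](pres_relE (tgw_RM _ _ _)) -pres_mulE. Qed.
Lemma iota_linear : linear iota.
Proof. by move=> a r s; rewrite [LHS](pres_relE (tgw_Rlinear _ _ _ _)) -pres_addE -pres_scaleE. Qed.
Lemma cXr i r : X i * iota r = iota (sigma i r) * X i.
Proof. by have := pres_relE (@tgw_Xr k I D mu i r); rewrite -!pres_mulE. Qed.
Lemma cYr i r : Y i * iota r = iota (sigmaV i r) * Y i.
Proof. by have := pres_relE (@tgw_Yr k I D mu i r); rewrite -!pres_mulE. Qed.
Lemma cYX i : Y i * X i = iota (t i).
Proof. by have := pres_relE (@tgw_YX k I D mu i); rewrite -!pres_mulE. Qed.
Lemma cXY i : X i * Y i = iota (sigma i (t i)).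
Proof. by have := pres_relE (@tgw_XY k I D mu i); rewrite -!pres_mulE. Qed.
Lemma cXYij i j : i <> j -> X i * Y j = mu i j *: (Y j * X i).
Proof. by move=> ij; have := pres_relE (@tgw_XYij k I D mu i j ij); rewrite -pres_scaleE -!pres_mulE. Qed.
Lemma cYXij i j : i <> j -> Y j * X i = (mu i j)^-1 *: (X i * Y j).
Proof.
by move=> ij; rewrite cXYij // scalerA mulVf ?scale1r //; apply/eqP/mu_neq0.
Qed.

Lemma homog_scale d (a : k) x : hom d x -> hom d (a *: x).
Proof.
move=> hx; rewrite -[x]mul1r pres_scalerAl -iota1 -(lin_Z iota_linear).
by rewrite -[d]add0r; apply: homog_M => //; apply: homog_R.
Qed.
Lemma homog_1 : hom 0 1.
Proof. by rewrite -iota1; apply: homog_R. Qed.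

Lemma homog_decomp x : exists s : seq ({ffun I -> int} * C),
  x = \sum_(p <- s) p.2 /\ forall p, p \in s -> hom p.1 p.2.
Proof.
have single d y : hom d y -> exists s : seq ({ffun I -> int} * C),
    y = \sum_(p <- s) p.2 /\ forall p, p \in s -> hom p.1 p.2.
  move=> hy; exists [:: (d, y)]; split; first by rewrite big_seq1.
  by move=> p; rewrite inE => /eqP ->.
elim/pres_ind: x => [[r|i|i]|||u v|u v|a u].
- exact/single/homog_R.
- exact/single/homog_X.
- exact/single/homog_Y.
- exact/single/(@homog_0 _ _ _ _ 0).
- exact/single/homog_1.
- move=> [s [-> hs]] [s' [-> hs']]; exists (s ++ s'); split; first by rewrite big_cat.
  by move=> p; rewrite mem_cat => /orP[/hs|/hs'].
- move=> [s [-> hs]] [s' [-> hs']].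
  exists [seq (p.1 + p'.1, p.2 * p'.2) | p <- s, p' <- s']; split.
    rewrite mulr_suml big_allpairs_dep; apply: eq_bigr => p _.
    by rewrite mulr_sumr.
  by move=> _ /allpairsP[[p p'] [/= /hs hp /hs' hp' ->]]; apply: homog_M.
- move=> [s [-> hs]]; exists [seq (p.1, a *: p.2) | p <- s]; split.
    by rewrite big_map scaler_sumr.
  by move=> _ /mapP[p /hs hp ->]; apply: homog_scale.
Qed.

(** Only the degrees are distinct; uniqueness of the components is not asserted. Different degrees
    are separated later by the action on a graded module. *)
Lemma homog_decomp_uniq x : exists (s : seq {ffun I -> int}) (f : {ffun I -> int} -> C),
  [/\ uniq s, x = \sum_(d <- s) f d & forall d, hom d (f d)].
Proof.
have [s [-> hs]] := homog_decomp x.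
exists (undup [seq p.1 | p <- s]), (fun d => \sum_(p <- s | p.1 == d) p.2); split.
- exact: undup_uniq.
- rewrite (exchange_big_dep predT) //= [LHS]big_seq [RHS]big_seq.
  apply: eq_bigr => p ps; rewrite big_mkcond (bigD1_seq p.1) ?undup_uniq //=; last first.
    by rewrite mem_undup; apply: map_f.
  by rewrite eqxx big1 ?addr0 // => d; rewrite eq_sym => /negPf ->.
- move=> d; rewrite big_seq_cond; elim/big_rec: _ => [|p y /andP[ps /eqP <-]].
    exact: homog_0.
  by apply: homog_D; apply: hs.
Qed.

Definition wordX (s : seq I) : C := \prod_(i <- s) X i.
Definition wordY (s : seq I) : C := \prod_(i <- s) Y i.
Definition word_deg (s s' : seq I) : {ffun I -> int} :=
  [ffun i => (count_mem i s')%:Z - (count_mem i s)%:Z].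

(** Sums of terms r Y...Y X...X of a common degree, the shape to which the relations reduce every
    product. Existence is all that is needed, so nothing is said about uniqueness of the terms. *)
Inductive normal_form (d : {ffun I -> int}) : C -> Prop :=
  | NF0 : normal_form d 0
  | NFadd r s s' y : word_deg s s' = d -> normal_form d y ->
      normal_form d (iota r * wordY s * wordX s' + y).

Lemma NF_add d x y : normal_form d x -> normal_form d y -> normal_form d (x + y).
Proof.
move=> + ny; elim=> [|r s s' z dss' _ IH]; first by rewrite add0r.
by rewrite -addrA; apply: NFadd.
Qed.
Lemma NF1 r s s' : normal_form (word_deg s s') (iota r * wordY s * wordX s').
Proof. by rewrite -[X in normal_form _ X]addr0; apply: NFadd => //; apply: NF0. Qed.

Lemma NF_lin (F : C -> C) d d' : F 0 = 0 -> (forall x y, F (x + y) = F x + F y) ->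
  (forall r s s', word_deg s s' = d -> normal_form d' (F (iota r * wordY s * wordX s'))) ->
  forall x, normal_form d x -> normal_form d' (F x).
Proof.
move=> F0 FD Fw x; elim=> [|r s s' y dss' _ IH]; first by rewrite F0; apply: NF0.
by rewrite FD; apply: NF_add => //; apply: Fw.
Qed.

Lemma NF_iota d r x : normal_form d x -> normal_form d (iota r * x).
Proof.
apply: NF_lin => [|y z|r' s s' <-]; [exact: mulr0 | exact: mulrDr |].
by rewrite !mulrA -iotaM; apply: NF1.
Qed.

Lemma NF_scale d (a : k) x : normal_form d x -> normal_form d (a *: x).
Proof.
by move=> nx; rewrite -[x]mul1r pres_scalerAl -iota1 -(lin_Z iota_linear); apply: NF_iota.
Qed.

Lemma NF_Y d i x : normal_form d x -> normal_form (- tgw_deg i + d) (Y i * x).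
Proof.
apply: NF_lin => [|y z|r s s' <-]; [exact: mulr0 | exact: mulrDr |].
rewrite !mulrA cYr -[iota _ * Y i * _]mulrA.
have -> : Y i * wordY s = wordY (i :: s) by rewrite /wordY big_cons.
have -> : - tgw_deg i + word_deg s s' = word_deg (i :: s) s'; last exact: NF1.
apply/ffunP => j; rewrite !ffunE /= PoszD opprD addrCA; congr (_ + (- _ + _)).
by rewrite eq_sym.
Qed.

(** [X i] travels to the right through the [Y]s: it either reaches the word in the [X]s or meets
    [Y i], and X_i Y_i lies in [R]. *)
Lemma NF_X_word i s s' :
  normal_form (tgw_deg i + word_deg s s') (X i * wordY s * wordX s').
Proof.
elim: s => [|j s IH].
  have -> : tgw_deg i + word_deg [::] s' = word_deg [::] (i :: s').
    by apply/ffunP => j; rewrite !ffunE /= !subr0 PoszD [i == j]eq_sym.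
  have := NF1 1 [::] (i :: s'); rewrite iota1 /wordY /wordX big_nil big_cons.
  by rewrite !mul1r mulr1.
have [<-|/eqP ij] := eqVneq i j.
  rewrite /wordY big_cons mulrA cXY.
  have -> : tgw_deg i + word_deg (i :: s) s' = word_deg s s'.
    apply/ffunP => l; rewrite !ffunE /= PoszD opprD [l == i]eq_sym.
    by ring.
  exact: NF1.
rewrite /wordY big_cons mulrA cXYij // -!pres_scalerAl; apply: NF_scale.
rewrite -!mulrA; have := NF_Y j IH; rewrite !mulrA.
have -> // : - tgw_deg j + (tgw_deg i + word_deg s s') = tgw_deg i + word_deg (j :: s) s'.
apply/ffunP => l; rewrite !ffunE /= PoszD opprD [j == l]eq_sym.
by rewrite addrCA; congr (_ + _); rewrite addrCA.
Qed.

Lemma NF_X d i x : normal_form d x -> normal_form (tgw_deg i + d) (X i * x).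
Proof.
apply: NF_lin => [|y z|r s s' <-]; [exact: mulr0 | exact: mulrDr |].
by rewrite !mulrA cXr -!mulrA; apply: NF_iota; rewrite !mulrA; apply: NF_X_word.
Qed.

Lemma NF_M d d' x y : normal_form d x -> normal_form d' y -> normal_form (d + d') (x * y).
Proof.
move=> nx ny; move: x nx; apply: NF_lin => [|x z|r s s' <-].
- exact: mul0r.
- exact: mulrDl.
rewrite -!mulrA; apply: NF_iota; elim: s => [|i s IH].
  rewrite /wordY big_nil mul1r; elim: s' => [|i s' IH].
    rewrite /wordX big_nil mul1r.
    by have -> : word_deg [::] [::] + d' = d' by apply/ffunP => l; rewrite !ffunE /= add0r.
  rewrite /wordX big_cons -mulrA.
  have -> : word_deg [::] (i :: s') + d' = tgw_deg i + (word_deg [::] s' + d').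
    by apply/ffunP => l; rewrite !ffunE /= PoszD [i == l]eq_sym -!addrA.
  exact: NF_X.
rewrite /wordY big_cons -mulrA.
have -> : word_deg (i :: s) s' + d' = - tgw_deg i + (word_deg s s' + d').
  by apply/ffunP => l; rewrite !ffunE /= PoszD opprD [i == l]eq_sym !addrA; congr (_ - _ + _); rewrite addrC.
exact: NF_Y.
Qed.

Lemma homog_NF d x : hom d x -> normal_form d x.
Proof.
elim=> {d x}.
- move=> r; have := NF1 r [::] [::]; rewrite /wordY /wordX !big_nil !mulr1.
  by have -> : word_deg [::] [::] = 0 by apply/ffunP => l; rewrite !ffunE subrr.
- move=> i; have := NF1 1 [::] [:: i]; rewrite /wordY /wordX big_nil big_seq1 !iota1 !mul1r.
  by have -> : word_deg [::] [:: i] = tgw_deg i by apply/ffunP => l; rewrite !ffunE /= addn0 subr0 eq_sym.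
- move=> i; have := NF1 1 [:: i] [::]; rewrite /wordY /wordX big_nil big_seq1 !iota1 mul1r mulr1.
  by have -> : word_deg [:: i] [::] = - tgw_deg i by apply/ffunP => l; rewrite !ffunE /= addn0 sub0r eq_sym.
- by move=> d x y _ nx _ ny; apply: NF_add.
- exact: NF0.
- by move=> d d' x y _ nx _ ny; apply: NF_M.
Qed.

(** [Y i] travels to the right until it meets the first [X i]; passing another [X j] uses the
    inverse of [mu j i]. *)
Lemma Y_wordX i s : i \in s -> exists r, Y i * wordX s = iota r * wordX (rem i s).
Proof.
elim: s => // j s IH; rewrite inE /= eq_sym; case: eqP => [-> _|ji /= /IH[r e]].
  by exists (t i); rewrite /wordX big_cons mulrA cYX.
exists ((mu j i)^-1 *: sigma j r); rewrite /wordX !big_cons mulrA cYXij //.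
rewrite -pres_scalerAl -mulrA e mulrA cXr -mulrA (lin_Z iota_linear).
by rewrite -pres_scalerAl.
Qed.

Lemma wordY_iota s r : exists r', wordY s * iota r = iota r' * wordY s.
Proof.
elim: s => [|i s [r' e]]; first by exists r; rewrite /wordY big_nil mul1r mulr1.
by exists (sigmaV i r'); rewrite /wordY big_cons -mulrA e mulrA cYr mulrA.
Qed.

(** In degree 0 the two words contain every index equally often, so the last [Y] can be cancelled
    against a matching [X], leaving an element of [R]. *)
Lemma NF_deg0 x : normal_form 0 x -> exists r, x = iota r.
Proof.
elim=> [|r s s' y dss' _ [r1 ->]]; first by exists 0; rewrite (lin_0 iota_linear).
suff [r2 e] : exists r2, wordY s * wordX s' = iota r2.
  by exists (r * r2 + r1); rewrite (lin_D iota_linear) iotaM -mulrA e.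
have {dss'} cs i : count_mem i s = count_mem i s'.
  by move/ffunP/(_ i): dss'; rewrite !ffunE => /eqP; rewrite subr_eq0 => /eqP [->].
elim/last_ind: s s' cs => [|s i IH] s' cs.
  case: s' cs => [|j s'] cs; last by have := cs j; rewrite /= eqxx.
  by exists 1; rewrite /wordY /wordX !big_nil mulr1 iota1.
have is' : i \in s'.
  by rewrite -has_pred1 has_count -cs -cats1 count_cat /= eqxx addn1.
have [r1' e1] := Y_wordX is'; have [r2 e2] := wordY_iota s r1'.
have [|r3 e3] := IH (rem i s').
  move=> j; have := cs j; rewrite count_rem is' -cats1 count_cat /= addn0 => <-.
  by rewrite addnK.
exists (r2 * r3); rewrite iotaM -e3 mulrA -e2 -mulrA -e1 /wordY -cats1 big_cat big_seq1.
by rewrite mulrA.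
Qed.

Lemma homog0_iota x : hom 0 x -> exists r, x = iota r.
Proof. by move/homog_NF/NF_deg0. Qed.

(** Commuting Y_j with X_i brings together Y_j X_j = t_j in the middle of Y_j X_i X_j Y_i; commuting
    X_j with Y_i brings together X_i Y_i = sigma_i(t_i) instead. *)
Lemma iota_inconsistency i j : i <> j -> mu i j = 1 -> mu j i = 1 ->
  iota (sigma i (t j) * sigma i (t i)) = iota (sigmaV j (sigma i (t i)) * t j).
Proof.
move=> ij m1 m2; transitivity (Y j * X i * X j * Y i).
  have -> : Y j * X i = X i * Y j by rewrite cXYij // m1 scale1r.
  by rewrite -[X i * Y j * X j]mulrA cYX cXr -mulrA cXY iotaM.
rewrite -mulrA cXYij; last by move/esym.
by rewrite m2 scale1r -[Y j * X i * _]mulrA [X i * (_ * _)]mulrA cXY mulrA cYr -mulrA cYX iotaM.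
Qed.

(** Sandwiching [r] as X_i r Y_i, or as Y_i r X_i below, transports an element of the kernel of
    [iota] to a neighbouring lattice point, multiplied by a translate of [t i]. *)
Lemma iota0_X i r : iota r = 0 -> iota (sigma i r * sigma i (t i)) = 0.
Proof. by move=> r0; rewrite iotaM -cXY mulrA -cXr r0 mulr0 mul0r. Qed.
Lemma iota0_Y i r : iota r = 0 -> iota (sigmaV i r * t i) = 0.
Proof. by move=> r0; rewrite iotaM -cYX mulrA -cYr r0 mulr0 mul0r. Qed.
End TGWStructure.

Section ShiftDatum.
Variables (k : fieldType) (I : finType).
Local Notation L := {ffun I -> int}.
Variables (S : (L -> k) -> Prop) (hS : translation_algebra S).
Variables (t : I -> fun_alg hS) (t_neq0 : forall i, t i <> 0).

Fact shift_datumK i : cancel (fun_shift (- tgw_deg i)) (fun_shift (hS := hS) (tgw_deg i)).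
Proof. by move=> F; rewrite fun_shift_add subrr fun_shift0. Qed.
Fact shift_datumVK i : cancel (fun_shift (tgw_deg i)) (fun_shift (hS := hS) (- tgw_deg i)).
Proof. by move=> F; rewrite fun_shift_add addNr fun_shift0. Qed.
Fact shift_datumC i j (F : fun_alg hS) :
  fun_shift (- tgw_deg i) (fun_shift (- tgw_deg j) F) =
  fun_shift (- tgw_deg j) (fun_shift (- tgw_deg i) F).
Proof. by rewrite !fun_shift_add addrC. Qed.
Fact shift_datum_central i (F : fun_alg hS) : t i * F = F * t i.
Proof. by apply: fun_algP => a; apply: mulrC. Qed.

(** [X_i] moves the index from a to a + deg i, so X_i r = sigma_i(r) X_i forces sigma_i(F)(a) = F(a
    - deg i); hence the negative translation. *)
Definition shift_datum : tgw_datum k I :=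
  @TGWDatum k I (fun_alg hS) (fun i => fun_shift (- tgw_deg i)) (fun i => fun_shift (tgw_deg i))
    shift_datumK shift_datumVK shift_datumC t t_neq0 shift_datum_central.
End ShiftDatum.

(** * Representations on lattice-indexed vectors and the radical *)

Section ShiftRepresentation.
Variables (k : fieldType) (I : finType).
Local Notation L := {ffun I -> int}.
Variables (S : (L -> k) -> Prop) (hS : translation_algebra S).
Variables (t : I -> fun_alg hS) (t_neq0 : forall i, t i <> 0).
Local Notation D := (shift_datum t_neq0).
Local Notation mu := (fun _ _ : I => 1 : k).
Local Notation C := (pres_alg (@tgw_rel k I D mu)).
Local Notation hom := (@tgw_homog k I D mu).
Variables (g : lieAlgType k) (V : lieModule g).
Variables (e f : I -> g) (w : L -> V) (ract : fun_alg hS -> V -> V).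
Local Notation X i := (@lact k g V (e i)).
Local Notation Y i := (@lact k g V (f i)).
Hypothesis X_w : forall i a, exists c, X i (w a) = c *: w (a + tgw_deg i).
Hypothesis Y_w : forall i a, exists c, Y i (w a) = c *: w (a - tgw_deg i).
Hypothesis ract_linear : forall F, linear (ract F).
Hypothesis ract_w : forall F a, ract F (w a) = (F a : k) *: w a.
Hypothesis YX_w : forall i a, Y i (X i (w a)) = (t i a : k) *: w a.
Hypothesis XY_w : forall i a, X i (Y i (w a)) = (t i (a - tgw_deg i) : k) *: w a.
Hypothesis XYC_w : forall i j a, i <> j -> X i (Y j (w a)) = Y j (X i (w a)).
Hypothesis w_span : forall v, exists s : seq (L * k), v = \sum_(p <- s) p.2 *: w p.1.
(** Some [w a] may be zero, so independence says that the terms, not the coefficients, of a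
    vanishing combination vanish. *)
Hypothesis w_free : forall (s : seq L) (c : L -> k), uniq s ->
  \sum_(a <- s) c a *: w a = 0 -> forall a, a \in s -> c a *: w a = 0.

Definition gen_act (x : tgw_gen D) : V -> V :=
  match x with TgwR F => ract F | TgwX i => X i | TgwY i => Y i end.

Lemma gen_act_linear x : linear (gen_act x).
Proof. by case: x => [F|i|i]; [apply: ract_linear | apply: lact_linearr | apply: lact_linearr]. Qed.

Lemma ext_w (F G : V -> V) : linear F -> linear G -> (forall a, F (w a) = G (w a)) -> F =1 G.
Proof.
move=> Fl Gl FG v; have [s ->] := w_span v.
rewrite (lin_sum Fl) (lin_sum Gl); apply: eq_bigr => p _.
by rewrite (lin_Z Fl) (lin_Z Gl) FG.
Qed.

Lemma gen_act_rel x y : tgw_rel mu x y -> forall v, term_act gen_act x v = term_act gen_act y v.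
Proof.
move=> xy; apply: ext_w; try exact/gen_term_act_linear/gen_act_linear.
case: xy => [|F G|c F G|i F|i F|i|i|i j ij] a /=.
- by rewrite ract_w scale1r.
- by rewrite !ract_w (lin_Z (ract_linear F)) ract_w scalerA mulrC.
- by rewrite !ract_w scalerDl scalerA.
- have [c e1] := X_w i a; rewrite ract_w (lin_Z (lact_linearr _)) e1.
  by rewrite (lin_Z (ract_linear _)) ract_w /= addrK scalerA scalerA mulrC.
- have [c e1] := Y_w i a; rewrite ract_w (lin_Z (lact_linearr _)) e1.
  by rewrite (lin_Z (ract_linear _)) ract_w /= subrK scalerA scalerA mulrC.
- by rewrite ract_w YX_w.
- by rewrite ract_w XY_w.
- by rewrite scale1r XYC_w.
Qed.

Definition tgw_act : C -> V -> V := pres_act gen_act.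
Local Notation phi := tgw_act.

Lemma tgw_act_linear c : linear (phi c).
Proof. exact/pres_act_linear/gen_act_linear. Qed.

Lemma tgw_act_gen x v : phi (pres_gen _ x) v = gen_act x v.
Proof. exact: (pres_act_gen gen_act_linear gen_act_rel). Qed.
Lemma tgw_act1 v : phi 1 v = v.
Proof. exact: (pres_act1 gen_act_linear gen_act_rel). Qed.
Lemma tgw_actD c c' v : phi (c + c') v = phi c v + phi c' v.
Proof. exact: (pres_actD gen_act_linear gen_act_rel). Qed.
Lemma tgw_actN c v : phi (- c) v = - phi c v.
Proof. exact: (pres_actN gen_act_linear gen_act_rel). Qed.
Lemma tgw_actM c c' v : phi (c * c') v = phi c (phi c' v).
Proof. exact: (pres_actM gen_act_linear gen_act_rel). Qed.
Lemma tgw_actZ a c v : phi (a *: c) v = a *: phi c v.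
Proof. exact: (pres_actZ gen_act_linear gen_act_rel). Qed.
Lemma tgw_act_sum J (s : seq J) (F : J -> C) v :
  phi (\sum_(j <- s) F j) v = \sum_(j <- s) phi (F j) v.
Proof. exact: (pres_act_sum gen_act_linear gen_act_rel). Qed.
Lemma tgw_act0 v : phi 0 v = 0.
Proof. exact: (pres_act0 gen_act_linear gen_act_rel). Qed.

Lemma tgw_act_homog d c : hom d c -> forall a, exists b, phi c (w a) = b *: w (a + d).
Proof.
elim=> {d c}.
- by move=> F a; rewrite tgw_act_gen /= addr0 ract_w; exists (F a).
- by move=> i a; rewrite tgw_act_gen; apply: X_w.
- by move=> i a; rewrite tgw_act_gen; apply: Y_w.
- move=> d x y _ IHx _ IHy a; have [[b e1] [b' e2]] := (IHx a, IHy a).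
  by exists (b + b'); rewrite tgw_actD e1 e2 scalerDl.
- by move=> d a; exists 0; rewrite tgw_act0 scale0r.
- move=> d d' x y _ IHx _ IHy a; have [b' e2] := IHy a.
  have [b e1] := IHx (a + d').
  exists (b' * b); rewrite tgw_actM e2 (lin_Z (tgw_act_linear x)) e1 scalerA.
  by rewrite -addrA [d' + d]addrC.
Qed.

Lemma tgw_act_component (s : seq L) (F : L -> C) a : uniq s -> (forall d, hom d (F d)) ->
  \sum_(d <- s) phi (F d) (w a) = 0 -> forall d, d \in s -> phi (F d) (w a) = 0.
Proof.
move=> s_uniq hF s0 d ds.
have /boolp.choice [b hb] : forall d, exists b, phi (F d) (w a) = b *: w (a + d).
  by move=> d'; apply: tgw_act_homog.
have := @w_free [seq a + d | d <- s] (fun x => b (x - a)).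
rewrite map_inj_uniq; last exact: addrI.
move=> /(_ s_uniq); rewrite big_map => hfree; rewrite hb.
have <- : a + d - a = d by rewrite addrAC subrr add0r.
rewrite -{1}[d](_ : a + d - a = d); last by rewrite addrAC subrr add0r.
rewrite [a + (_ - a)](_ : _ = a + d); last by rewrite addrAC subrr add0r.
apply: hfree; last by apply: map_f.
rewrite -[RHS]s0; apply: eq_bigr => d' _.
by rewrite hb addrAC subrr add0r.
Qed.

(** Only the component of degree b - a can contribute to [w b]. The degree b - a is not assumed to
    occur in [s]; this is part of what is proved. *)
Lemma tgw_act_hit (s : seq L) (F : L -> C) a b : uniq s -> (forall d, hom d (F d)) ->
  \sum_(d <- s) phi (F d) (w a) = w b -> w b <> 0 -> phi (F (b - a)) (w a) <> 0.
Proof.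
move=> s_uniq hF sE wb0 F0; apply: wb0.
have /boolp.choice [q hq] : forall x, exists q, phi (F x) (w a) = q *: w (a + x).
  by move=> x; apply: tgw_act_homog.
pose s' := [seq d <- s | d != b - a].
have b_notin : b \notin [seq a + x | x <- s'].
  apply/mapP => -[x]; rewrite mem_filter => /andP[/eqP xd _] bE; apply: xd.
  by rewrite bE addrAC subrr add0r.
(* [w b] joins the relation with coefficient -1 and is then isolated by independence. *)
have := @w_free (b :: [seq a + x | x <- s'])
  (fun y => if y == b then -1 else q (y - a)).
rewrite /= b_notin map_inj_uniq; last exact: addrI.
move=> /(_ (filter_uniq _ s_uniq)) H; have := H _ b; rewrite inE eqxx /= scaleN1r => H'.
apply/eqP; rewrite -oppr_eq0; apply/eqP/H' => //.
rewrite big_cons eqxx scaleN1r big_map big_seq.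
rewrite (eq_bigr (fun x => phi (F x) (w a))); last first.
  move=> x xs; case: eqP => [ax|_]; last by rewrite hq addrAC subrr add0r.
  by case/negP: b_notin; apply/mapP; exists x.
rewrite -big_seq big_filter; suff -> : \sum_(d <- s | d != b - a) phi (F d) (w a) = w b.
  by rewrite addNr.
rewrite -[RHS]sE big_mkcond; apply: eq_bigr => d _.
by case: eqP => [->|].
Qed.

Hypothesis kernel_R : forall F : fun_alg hS, (forall a, w a <> 0 -> F a = 0) ->
  tgw_iota (D := D) mu F = 0.
Hypothesis w_conn : forall c a b, w b <> 0 -> phi c (w a) = w b ->
  exists c', phi c' (w b) = w a.

Lemma tgw_ker_ideal : two_sided_ideal (fun c : C => forall v, phi c v = 0).
Proof.
split=> [v|x y x0 y0 v|c x x0 v|c x x0 v]; first exact: tgw_act0.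
- by rewrite tgw_actD x0 y0 addr0.
- by rewrite tgw_actM x0 (lin_0 (tgw_act_linear c)).
- by rewrite tgw_actM x0.
Qed.

Lemma tgw_ker_negligible : tgw_negligible (fun c : C => forall v, phi c v = 0).
Proof.
split; first exact: tgw_ker_ideal.
- move=> x x0; have [s [F [s_uniq xE hF]]] := homog_decomp_uniq x.
  exists [seq F d | d <- s]; split; first by rewrite big_map.
  move=> _ /mapP[d ds ->]; split; last by exists d.
  apply: ext_w => [||a]; first exact: tgw_act_linear.
    by move=> b u v; rewrite scaler0 addr0.
  apply: (tgw_act_component s_uniq) => //.
  by rewrite -tgw_act_sum -xE.
- move=> x x0 hx; have [|F xE] := homog0_iota _ hx.
    by move=> i j _; apply/eqP/oner_neq0.
  rewrite xE; apply: kernel_R => a wa0.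
  have := x0 (w a); rewrite xE /tgw_iota tgw_act_gen /= ract_w => /eqP.
  by rewrite scaler_eq0 => /orP[/eqP //|/eqP].
Qed.

(** If a homogeneous [z] of degree d in a negligible ideal did not kill [w a], connectedness would
    give an element leading back to [w a]. Its component of degree -d times [z] has degree 0 and
    lies in the ideal, hence is 0, although it does not kill [w a]. *)
Lemma tgw_radicalE c : tgw_radical c <-> forall v, phi c v = 0.
Proof.
split=> [[s [-> sJ]] v|c0]; last first.
  exists [:: c]; split=> [|y]; first by rewrite big_seq1.
  rewrite inE => /eqP ->.
  by exists (fun c : C => forall v, phi c v = 0) => //; apply: tgw_ker_negligible.
rewrite tgw_act_sum big_seq big1 // => y /sJ [J [J_ideal J_graded J0] /J_graded].
case=> s' [-> s'J]; rewrite tgw_act_sum big_seq big1 // => z /s'J [Jz [d hz]].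
move: v; apply: ext_w => [||a]; first exact: tgw_act_linear.
  by move=> b u v; rewrite scaler0 addr0.
have [b zw] := tgw_act_homog hz a.
have [//|/eqP zw0] := eqVneq (phi z (w a)) 0.
have wd0 : w (a + d) <> 0 by move=> wd0; rewrite zw wd0 scaler0 in zw0.
have b0 : b != 0 by apply/eqP => b0; rewrite zw b0 scale0r in zw0.
have [|c' c'w] := @w_conn (b^-1 *: z) a (a + d) wd0.
  by rewrite tgw_actZ zw scalerA mulVf // scale1r.
have [s1 [F [s1_uniq c'E hF]]] := homog_decomp_uniq c'.
have := c'w; rewrite c'E tgw_act_sum => c'w'.
have wa0 : w a <> 0 by move=> wa0; rewrite wa0 (lin_0 (tgw_act_linear z)) in zw0.
have Fw := tgw_act_hit s1_uniq hF c'w' wa0.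
rewrite opprD addrA subrr add0r in Fw.
case: Fw; apply/eqP.
have Fz0 : F (- d) * z = 0.
  apply: J0; first exact: (tsiMl J_ideal).
  by rewrite -(addNr d); apply: homog_M.
have : phi (F (- d) * z) (w a) = 0 by rewrite Fz0 tgw_act0.
rewrite tgw_actM zw (lin_Z (tgw_act_linear _)) => /eqP.
by rewrite scaler_eq0 (negPf b0).
Qed.

Hypothesis lie_realized : forall x : g, exists c, forall v, phi c v = lact x v.
Hypothesis R_realized : forall F, exists u : env_alg g, forall v : V, env_act u v = ract F v.

Lemma env_act_linear (u : env_alg g) : linear (@env_act k g V u).
Proof. exact: term_act_linear. Qed.
Lemma env_act0 (v : V) : env_act (0 : env_alg g) v = 0.
Proof. exact: env_act_class. Qed.

Lemma env_realized (u : env_alg g) : exists c, forall v : V, phi c v = env_act u v.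
Proof.
elim/pres_ind: u => [x|||u v [c e1] [c' e2]|u v [c e1] [c' e2]|a u [c e1]].
- have [c e1] := lie_realized x; exists c => v.
  by rewrite e1 -[pres_gen _ _]/(env_gen x) env_act_gen.
- by exists 0 => v; rewrite tgw_act0 env_act0.
- by exists 1 => v; rewrite tgw_act1 env_act1.
- by exists (c + c') => m; rewrite tgw_actD e1 e2 env_actD.
- by exists (c * c') => m; rewrite tgw_actM e2 e1 env_actM.
- by exists (a *: c) => m; rewrite tgw_actZ e1 env_actZ.
Qed.

Lemma tgw_realized c : exists u : env_alg g, forall v : V, env_act u v = phi c v.
Proof.
elim/pres_ind: c => [[F|i|i]|||u v [c e1] [c' e2]|u v [c e1] [c' e2]|a u [c e1]].
- by have [u e1] := R_realized F; exists u => v; rewrite e1 tgw_act_gen.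
- by exists (env_gen (e i)) => v; rewrite env_act_gen tgw_act_gen.
- by exists (env_gen (f i)) => v; rewrite env_act_gen tgw_act_gen.
- by exists 0 => v; rewrite tgw_act0 env_act0.
- by exists 1 => v; rewrite tgw_act1 env_act1.
- by exists (c + c') => m; rewrite tgw_actD env_actD e1 e2.
- by exists (c * c') => m; rewrite tgw_actM env_actM e2 e1.
- by exists (a *: c) => m; rewrite tgw_actZ env_actZ e1.
Qed.

Local Notation rad := (@tgw_radical_ideal k I D mu).

(** [psi u] is the class of any element of C acting as [u]. The radical being the kernel of the
    action, this class does not depend on the choice, whence all the compatibilities. *)
Theorem tgw_quotient : exists psi : {rmorphism env_alg g -> tgw_alg D mu},
  [/\ scalable psi,
      (forall a : tgw_alg D mu, exists u, psi u = a),
      (forall u, psi u = 0 <-> annihilator V u) &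
      forall i, psi (env_gen (e i)) = tgw_X D mu i /\ psi (env_gen (f i)) = tgw_Y D mu i].
Proof.
have /boolp.choice [F hF] := env_realized.
have clE c c' : (forall v, phi c v = phi c' v) -> quot_class rad c = quot_class rad c'.
  by move=> cc'; apply/quot_classP/tgw_radicalE => v; rewrite tgw_actD tgw_actN cc' subrr.
pose psi (u : env_alg g) : tgw_alg D mu := quot_class rad (F u).
have psiE u c : (forall v, phi c v = env_act u v) -> psi u = quot_class rad c.
  by move=> cu; apply: clE => v; rewrite hF cu.
have psiB : {morph psi : u v / u - v}.
  move=> u v; rewrite (@psiE (u - v) (F u - F v)).
    by rewrite -quot_addE -quot_oppE.
  move=> m; rewrite tgw_actD tgw_actN !hF env_actD.
  by rewrite -scaleN1r -[- v]scaleN1r env_actZ.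
have psiM : monoid_morphism psi.
  split; first by rewrite (@psiE 1 1) // => v; rewrite tgw_act1 env_act1.
  move=> u v; rewrite (@psiE (u * v) (F u * F v)); first by rewrite -quot_mulE.
  by move=> m; rewrite tgw_actM !hF env_actM.
have psiZ : scalable psi.
  move=> a u; rewrite (@psiE (a *: u) (a *: F u)); first by rewrite -quot_scaleE.
  by move=> m; rewrite tgw_actZ hF env_actZ.
pose a1 := GRing.isZmodMorphism.Build _ _ psi psiB.
pose a2 := GRing.isMonoidMorphism.Build _ _ psi psiM.
pose psi' : {rmorphism env_alg g -> tgw_alg D mu} := HB.pack psi a1 a2.
exists psi'; split=> //= [a|u|i].
- rewrite -[a]quot_reprK; have [u hu] := tgw_realized (quot_repr a).
  by exists u; apply: psiE => v; rewrite hu.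
- split=> [u0 v|u0].
    rewrite -hF; move: v; apply/tgw_radicalE.
    by rewrite -[F u]subr0; apply/(quot_classP rad); rewrite -/(psi u) u0.
  have -> : 0 = quot_class rad 0 by [].
  by apply: psiE => v; rewrite u0 tgw_act0.
- by split; apply: psiE => v; rewrite tgw_act_gen env_act_gen.
Qed.
End ShiftRepresentation.

(** * Linear algebra *)

Section LinearAlgebra.
Variables (K : fieldType) (vT : vectType K).

(** A subspace contained in [P] of maximal dimension already contains every vector satisfying [P],
    since otherwise it could be enlarged by a line. *)
Lemma vspace_of_pred (P : vT -> Prop) : P 0 ->
  (forall a x y, P x -> P y -> P (a *: x + y)) ->
  exists U : {vspace vT}, forall x, x \in U <-> P x.
Proof.
move=> P0 PL.
pose Q m := `[< exists2 U : {vspace vT}, \dim U = m & forall x, x \in U -> P x >].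
have Q0 : exists m, Q m.
  by exists 0; apply/asboolP; exists 0%VS => [|x]; rewrite ?dimv0 // memv0 => /eqP ->.
have Qmax m : Q m -> (m <= \dim {:vT})%N.
  by case/asboolP => U <- _; apply/dimvS/subvf.
case: (ex_maxnP Q0 Qmax) => m /asboolP[U dU UP] mmax.
exists U => x; split=> [/UP //|Px].
apply: contraT => xU.
have : (\dim (U + <[x]>) <= m)%N.
  apply: mmax; apply/asboolP; exists (U + <[x]>)%VS => // y.
  case/memv_addP => u uU [_ /vlineP[a ->] ->].
  by rewrite addrC; apply: PL => //; apply: UP.
rewrite -dU => le; have [_ ] := dimv_leqif_sup (addvSl U <[x]>%VS).
rewrite eqn_leq le dimvS ?addvSl //= subv_add subvv /= => /esym.
by rewrite -memvE (negPf xU).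
Qed.

Lemma free_enumP n (X : 'I_n -> vT) : free [seq X i | i <- enum 'I_n] ->
  forall c : 'I_n -> K, \sum_i c i *: X i = 0 -> forall i, c i = 0.
Proof.
move=> fX c c0; have fX' : free (map_tuple X (ord_tuple n)) by [].
move/freeP: fX' => /(_ c) H; apply: H.
rewrite -[RHS]c0; apply: eq_bigr => i _; congr (_ *: _).
by rewrite -tnth_nth tnth_map tnth_ord_tuple.
Qed.

(** The matrix of values of the [X i] on a basis has independent rows, hence a right inverse; its
    columns are the coordinates of the dual vectors. *)
Lemma dual_family n (X : 'I_n -> 'Hom(vT, K^o)) :
  (forall c : 'I_n -> K, \sum_i c i *: X i = 0 -> forall i, c i = 0) ->
  exists u : 'I_n -> vT, forall i j, X i (u j) = (i == j)%:R.
Proof.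
move=> fX; pose b := vbasis {:vT}.
pose A := \matrix_(i < n, j < \dim {:vT}) (X i b`_j : K).
have /row_freeP[B AB] : row_free A.
  apply: inj_row_free => v vA0; apply/rowP => i; rewrite mxE.
  apply: (fX (fun i => v 0 i)); apply/lfunP => x.
  rewrite (coord_vbasis (memvf x)) sum_lfunE zero_lfunE.
  under eq_bigr => j _ do rewrite scale_lfunE linear_sum scaler_sumr.
  rewrite exchange_big big1 // => l _; have := congr1 (fun M : 'rV_ _ => M 0 l) vA0.
  rewrite !mxE => e; transitivity (coord (vbasis {:vT}) l x * \sum_j v 0 j * A j l).
    rewrite mulr_sumr; apply: eq_bigr => j _; rewrite linearZ /= mxE.
    by rewrite /GRing.scale /= mulrCA.
  by rewrite e mulr0.
exists (fun j => \sum_l B l j *: b`_l) => i j.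
have := congr1 (fun M : 'M_n => M i j) AB; rewrite !mxE => <-.
rewrite linear_sum; apply: eq_bigr => l _; rewrite linearZ /= mxE.
by rewrite /GRing.scale /= mulrC.
Qed.

(* The pairing embeds [U] into the dual of [P], so that the dimensions agree. *)
Lemma perp_trivial (B : vT -> vT -> K) (P U : {vspace vT}) :
  (forall z, linear (B^~ z : vT -> K^o)) -> (forall x, linear (B x : vT -> K^o)) ->
  (P <= U)%VS -> (forall x, x \in U -> (forall p, p \in P -> B x p = 0) -> x = 0) ->
  P = U.
Proof.
move=> Bl Br PU nd; apply/eqP; rewrite eqEdim PU /=.
pose A := \matrix_(i < \dim U, j < \dim P) B (vbasis U)`_i (vbasis P)`_j.
have : row_free A.
  apply: inj_row_free => v vA0.
  have x0 : \sum_i v 0 i *: (vbasis U)`_i = 0.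
    apply: nd => [|p pP].
      by apply: memv_suml => i _; apply/memvZ/vbasis_mem/mem_nth; rewrite size_tuple.
    rewrite (coord_vbasis pP) (lin_sum (Br _)) big1 // => j _.
    rewrite (lin_Z (Br _)) (lin_sum (Bl _)).
    have := congr1 (fun M : 'rV_ _ => M 0 j) vA0; rewrite !mxE => e.
    transitivity (coord (vbasis P) j p * \sum_i v 0 i * A i j).
      by congr (_ * _); apply: eq_bigr => i _; rewrite (lin_Z (Bl _)) mxE.
    by rewrite e mulr0.
  apply/rowP => i; rewrite mxE.
  have /freeP/(_ (fun i => v 0 i)) := basis_free (vbasisP U).
  by move=> /(_ x0 i).
by rewrite /row_free => /eqP <-; apply: rank_leq_col.
Qed.

Lemma span_free_subseq (s : seq vT) : exists s', [/\ free s', {subset s' <= s} & <<s'>>%VS = <<s>>%VS].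
Proof.
elim: s => [|x s [s' [fs' ss' e]]]; first by exists [::]; rewrite nil_free.
have [xs|xs] := boolP (x \in <<s'>>%VS).
  exists s'; split=> // [y /ss'|]; first by rewrite inE => ->; rewrite orbT.
  by rewrite span_cons -e; apply/esym/addv_idPr.
exists (x :: s'); split; first by rewrite free_cons xs.
  by move=> y; rewrite !inE => /orP[->//|/ss' ->]; rewrite orbT.
by rewrite !span_cons e.
Qed.

(** A basis is extracted from the decompositions of the vectors of an arbitrary basis. The second
    alternative concerns indices beyond the tuple, where [nth] returns its default. *)
Lemma special_basis (U : {vspace vT}) (Q : vT -> Prop) :
  (forall x, x \in U -> exists s : seq vT, x = \sum_(y <- s) y /\
     forall y, y \in s -> y \in U /\ Q y) ->
  exists X : (\dim U).-tuple vT, basis_of U X /\ forall i, Q X`_i \/ (\dim U <= i)%N.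
Proof.
move=> Qdec.
have /boolp.choice [S hS] : forall x, exists s : seq vT, x \in U ->
    x = \sum_(y <- s) y /\ forall y, y \in s -> y \in U /\ Q y.
  move=> x; have [xU|xU] := boolP (x \in U); last by exists [::].
  by have [s hs] := Qdec x xU; exists s.
pose s := flatten [seq S x | x <- vbasis U].
have sU y : y \in s -> y \in U /\ Q y.
  by case/flattenP => _ /mapP[x /vbasis_mem xU ->] ys; apply: (hS x xU).2.
have [s' [fs' ss' e]] := span_free_subseq s.
have e' : <<s'>>%VS = U.
  rewrite e; apply/eqP; rewrite eqEsubv; apply/andP; split.
    by apply/span_subvP => y /sU[].
  rewrite -{1}(span_basis (vbasisP U)); apply/span_subvP => x xb.
  have xU := vbasis_mem xb; rewrite (hS x xU).1 big_seq; apply: memv_suml => y ys.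
  by apply: memv_span; apply/flattenP; exists (S x) => //; apply: map_f.
have sz : size s' == \dim U by rewrite -e' eq_sym -/(free s').
exists (Tuple sz); split; first by rewrite basisEfree /= fs' e' subvv /= (eqP sz).
move=> i; have [le|lt] := leqP (\dim U) i; [by right | left].
by apply: (sU _ _).2; apply/ss'/mem_nth; rewrite (eqP sz).
Qed.

(** The trace on the span of [X] of a plain function [T]; it is the usual one when [X] is free and
    [T] is linear and preserves the span. *)
Definition tuple_trace N (X : N.-tuple vT) (T : vT -> vT) : K := \sum_(i < N) coord X i (T X`_i).

Lemma tuple_trace_comm N (X : N.-tuple vT) (E F : vT -> vT) : free X ->
  linear E -> linear F ->
  (forall x, x \in <<X>>%VS -> E x \in <<X>>%VS) -> (forall x, x \in <<X>>%VS -> F x \in <<X>>%VS) ->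
  tuple_trace X (fun x => E (F x) - F (E x)) = 0.
Proof.
move=> fX El Fl Es Fs.
have XX (i : 'I_N) : X`_i \in <<X>>%VS by apply/memv_span/mem_nth; rewrite size_tuple.
pose A := \matrix_(i, j) coord X j (E X`_i); pose B := \matrix_(i, j) coord X j (F X`_i).
have comp (G H : vT -> vT) : linear G -> linear H ->
    (forall x, x \in <<X>>%VS -> G x \in <<X>>%VS) ->
    \sum_(i < N) coord X i (H (G X`_i)) =
    \tr ((\matrix_(i, j) coord X j (G X`_i)) *m (\matrix_(i, j) coord X j (H X`_i))).
  move=> Gl Hl Gs; rewrite /mxtrace; apply: eq_bigr => i _; rewrite mxE.
  rewrite {1}(coord_span (Gs _ (XX i))) (lin_sum Hl) linear_sum.
  by apply: eq_bigr => j _; rewrite (lin_Z Hl) linearZ !mxE.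
rewrite /tuple_trace; under eq_bigr => i _ do rewrite linearB.
by rewrite sumrB (comp F E) // (comp E F) // mxtrace_mulC subrr.
Qed.

Lemma tuple_trace_lin N (X : N.-tuple vT) J (s : seq J) (c : J -> K) (T : J -> vT -> vT) :
  tuple_trace X (fun x => \sum_(j <- s) c j *: T j x) = \sum_(j <- s) c j * tuple_trace X (T j).
Proof.
rewrite /tuple_trace; under eq_bigr => i _ do rewrite linear_sum.
rewrite exchange_big; apply: eq_bigr => j _; rewrite mulr_sumr.
by apply: eq_bigr => i _; rewrite linearZ.
Qed.

Lemma tuple_trace_diag N (X : N.-tuple vT) (T : vT -> vT) (c : 'I_N -> K) : free X ->
  (forall i : 'I_N, T X`_i = c i *: X`_i) -> tuple_trace X T = \sum_i c i.
Proof.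
move=> fX Tc; apply: eq_bigr => i _; rewrite Tc linearZ /= coord_free // eqxx.
exact: mulr1.
Qed.
End LinearAlgebra.

Section CharZero.
Variables (k : fieldType) (k_char0 : [pchar k] =i pred0).
Lemma natr_eq0_char0 (n : nat) : (n%:R == 0 :> k) = (n == 0)%N.
Proof. by have /pcharf0P -> := k_char0. Qed.
Lemma intr_eq0_char0 (z : int) : (z%:~R == 0 :> k) = (z == 0).
Proof. by case: z => n; rewrite ?NegzE ?mulrNz ?oppr_eq0 natr_eq0_char0. Qed.
Lemma natr_inj_char0 (m n : nat) : m%:R = n%:R :> k -> m = n.
Proof.
move=> e; apply/eqP; have : (m%:Z - n%:Z)%:~R == 0 :> k by rewrite rmorphB /= -!pmulrn e subrr.
by rewrite intr_eq0_char0 subr_eq0.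
Qed.
Lemma intr_inj_char0 (m n : int) : m%:~R = n%:~R :> k -> m = n.
Proof. by move=> e; apply/eqP; rewrite -subr_eq0 -intr_eq0_char0 rmorphB /= e subrr. Qed.
End CharZero.

(** * Weights and roots *)

Section LieRules.
Variables (k : fieldType) (L : lieAlgType k).
Implicit Types x y z : L.
Lemma lieDl x y z : lie (x + y) z = lie x z + lie y z.
Proof. exact: (lin_D (lie_linearl z)). Qed.
Lemma lieDr x y z : lie x (y + z) = lie x y + lie x z.
Proof. exact: (lin_D (lie_linearr x)). Qed.
Lemma lieZl (a : k) x y : lie (a *: x) y = a *: lie x y.
Proof. exact: (lin_Z (lie_linearl y)). Qed.
Lemma lieZr (a : k) x y : lie x (a *: y) = a *: lie x y.
Proof. exact: (lin_Z (lie_linearr x)). Qed.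
Lemma lieNl x y : lie (- x) y = - lie x y.
Proof. exact: (lin_N (lie_linearl y)). Qed.
Lemma lieNr x y : lie x (- y) = - lie x y.
Proof. exact: (lin_N (lie_linearr x)). Qed.
Lemma lie0l x : lie 0 x = 0. Proof. exact: (lin_0 (lie_linearl x)). Qed.
Lemma lie0r x : lie x 0 = 0. Proof. exact: (lin_0 (lie_linearr x)). Qed.
Lemma lieC x y : lie x y = - lie y x.
Proof.
apply/eqP; rewrite -addr_eq0; apply/eqP.
by have := liexx (x + y); rewrite lieDl !lieDr !liexx add0r addr0.
Qed.
Lemma lie_derivation x y z : lie x (lie y z) = lie (lie x y) z + lie y (lie x z).
Proof.
apply/eqP; rewrite -subr_eq0 opprD; apply/eqP; rewrite -[RHS](lie_jacobi x y z).
by rewrite [lie (lie x y) z]lieC [lie z x]lieC lieNr opprK addrA addrAC.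
Qed.

Variable M : lieModule L.
Implicit Types m n : M.
Lemma lactDl x y m : lact (x + y) m = lact x m + lact y m.
Proof. exact: (lin_D (lact_linearl m)). Qed.
Lemma lactDr x m n : lact x (m + n) = lact x m + lact x n.
Proof. exact: (lin_D (lact_linearr x)). Qed.
Lemma lactZl (a : k) x m : lact (a *: x) m = a *: lact x m.
Proof. exact: (lin_Z (lact_linearl m)). Qed.
Lemma lactZr (a : k) x m : lact x (a *: m) = a *: lact x m.
Proof. exact: (lin_Z (lact_linearr x)). Qed.
Lemma lactNl x m : lact (- x) m = - lact x m.
Proof. exact: (lin_N (lact_linearl m)). Qed.
Lemma lactNr x m : lact x (- m) = - lact x m.
Proof. exact: (lin_N (lact_linearr x)). Qed.
Lemma lact0l m : lact (0 : L) m = 0. Proof. exact: (lin_0 (lact_linearl m)). Qed.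
Lemma lact0r x : lact x (0 : M) = 0. Proof. exact: (lin_0 (lact_linearr x)). Qed.
Lemma lact_sumr J (s : seq J) (P : pred J) (F : J -> M) x :
  lact x (\sum_(j <- s | P j) F j) = \sum_(j <- s | P j) lact x (F j).
Proof. exact: (lin_sum (lact_linearr x)). Qed.
Lemma lact_suml J (s : seq J) (P : pred J) (F : J -> L) m :
  lact (\sum_(j <- s | P j) F j) m = \sum_(j <- s | P j) lact (F j) m.
Proof. exact: (lin_sum (lact_linearl m)). Qed.
Lemma lactC x y m : lact x (lact y m) = lact (lie x y) m + lact y (lact x m).
Proof. by rewrite lact_lie subrK. Qed.
End LieRules.

Section Adjoint.
Variables (k : fieldType) (L : lieAlgType k).
Fact adjoint_subproof (x y z : L) : lie (lie x y) z = lie x (lie y z) - lie y (lie x z).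
Proof. by rewrite lie_derivation addrK. Qed.
Definition adjoint : lieModule L := LieModule (@lie_linearl k L) (@lie_linearr k L) adjoint_subproof.
End Adjoint.

Lemma lfun_of_linear (K : fieldType) (uT vT : vectType K) (F : uT -> vT) :
  linear F -> exists G : 'Hom(uT, vT), G =1 F.
Proof.
move=> Fl; pose mF := GRing.isLinear.Build K uT vT _ F Fl.
pose F' : {linear uT -> vT} := HB.pack F mF.
by exists (linfun F') => x; rewrite lfunE.
Qed.

Section Weights.
Variables (k : fieldType) (g : lieVectType k) (H : {vspace g}) (M : lieModule g).
Local Notation W := 'Hom(subvs_of H, k^o).
Local Notation wv := (weight_vector (H := H) (@lact k g M)).
Local Notation gwv := (weight_vector (H := H) (@lie k g)).
Implicit Types (mu nu : W) (m v : M).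

Lemma wvP mu m x (xH : x \in H) : wv mu m -> lact x m = (mu (Subvs xH) : k) *: m.
Proof. by move=> /(_ (Subvs xH)). Qed.

Lemma wv_lin mu (a : k) m v : wv mu m -> wv mu v -> wv mu (a *: m + v).
Proof. by move=> hm hv u; rewrite lactDr lactZr hm hv scalerDr !scalerA mulrC. Qed.
Lemma wv_0 mu : wv mu 0.
Proof. by move=> u; rewrite lact0r scaler0. Qed.
Lemma wv_Z mu (a : k) m : wv mu m -> wv mu (a *: m).
Proof. by move=> hm; rewrite -[a *: m]addr0; apply: wv_lin => //; apply: wv_0. Qed.
Lemma wv_D mu m v : wv mu m -> wv mu v -> wv mu (m + v).
Proof. by move=> hm hv; rewrite -[m]scale1r; apply: wv_lin. Qed.

Lemma wv_act mu (gamma : W) x m : gwv gamma x -> wv mu m -> wv (mu + gamma) (lact x m).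
Proof.
move=> hx hm u; rewrite lactC hx hm lactZl lactZr -scalerDl add_lfunE.
by rewrite [in RHS]addrC.
Qed.

(** For [u] in H with nu(u) different from mu(u), the operator nu(u) - u kills the component of
    weight nu and multiplies the one of weight mu by a nonzero scalar; induction on the number of
    weights follows. *)
Lemma weight_component (N : M -> Prop) (s : seq W) (v : W -> M) :
  (forall a x y, N x -> N y -> N (a *: x + y)) ->
  (forall u : subvs_of H, forall x, N x -> N (lact (vsval u) x)) ->
  uniq s -> (forall mu, wv mu (v mu)) -> N (\sum_(mu <- s) v mu) ->
  forall mu, mu \in s -> N (v mu).
Proof.
move=> NL NH; elim: s v => // nu s IH v /= /andP[nus s_uniq] hv Ns.
have N0 : N 0 by have := NL (-1) _ _ Ns Ns; rewrite scaleN1r addNr.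
have vs mu : mu \in s -> N (v mu).
  move=> mus; have [u nu_mu] : exists u, (nu u : k) - (mu u : k) != 0.
    apply: contrapT => no; case/negP: nus; suff -> : nu = mu by [].
    apply/lfunP => u; apply/eqP; rewrite -subr_eq0; apply: contraT => ne.
    by case: no; exists u.
  have h' mu' : wv mu' (((nu u : k) - (mu' u : k)) *: v mu') by apply: wv_Z.
  have := IH _ s_uniq h' _ mu mus.
  have -> : \sum_(mu' <- s) ((nu u : k) - (mu' u : k)) *: v mu' =
      (nu u : k) *: (\sum_(mu' <- nu :: s) v mu') - lact (vsval u) (\sum_(mu' <- nu :: s) v mu').
    rewrite lact_sumr scaler_sumr -sumrB big_cons hv subrr add0r.
    by apply: eq_bigr => mu' _; rewrite scalerBl hv.
  move=> /(_ _) Nv; have /= Nv' := NL (((nu u : k) - (mu u : k))^-1) _ _ (Nv _) N0.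
  move: Nv'; rewrite addr0 scalerA mulVf // scale1r; apply.
  rewrite -scaleN1r addrC; apply: (NL); first exact: NH.
  by rewrite -[_ *: _]addr0; apply: NL.
move=> mu; rewrite inE => /orP[/eqP ->|/vs //].
have -> : v nu = (-1) *: (\sum_(mu <- s) v mu) + \sum_(mu <- nu :: s) v mu.
  by rewrite scaleN1r big_cons addrC addrK.
apply: (NL) => //; rewrite big_seq; elim/big_rec: _ => // mu' y /vs Nv Ny.
by rewrite -[v mu']scale1r; apply: NL.
Qed.

Lemma weight_free (s : seq W) (v : W -> M) : uniq s -> (forall mu, wv mu (v mu)) ->
  \sum_(mu <- s) v mu = 0 -> forall mu, mu \in s -> v mu = 0.
Proof.
apply: (weight_component (N := fun x => x = 0)) => [a x y -> ->|u x ->].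
  by rewrite scaler0 addr0.
exact: lact0r.
Qed.

Lemma weight_decomp : weight_module H M -> forall m, exists (s : seq W) (v : W -> M),
  [/\ uniq s, forall mu, wv mu (v mu) & m = \sum_(mu <- s) v mu].
Proof.
move=> hM m; have [s [-> hs]] := hM m.
have /boolp.choice [wt hwt] : forall v, exists mu : W, v \in s -> wv mu v.
  move=> v; have [vs|vs] := boolP (v \in s); last by exists 0.
  by have [mu hmu] := hs v vs; exists mu.
exists (undup [seq wt v | v <- s]), (fun mu => \sum_(v <- s | wt v == mu) v); split.
- exact: undup_uniq.
- move=> mu; rewrite big_seq_cond; elim/big_rec: _ => [|v y /andP[vs /eqP <-] hy].
    exact: wv_0.
  by apply: wv_D => //; apply: hwt.
- rewrite (exchange_big_dep predT) //= [LHS]big_seq [RHS]big_seq.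
  apply: eq_bigr => v vs; rewrite big_mkcond (bigD1_seq (wt v)) ?undup_uniq //=; last first.
    by rewrite mem_undup; apply: map_f.
  by rewrite eqxx big1 ?addr0 // => d; rewrite eq_sym => /negPf ->.
Qed.

Lemma weight_ext (F G : M -> M) : weight_module H M -> linear F -> linear G ->
  (forall mu m, wv mu m -> F m = G m) -> F =1 G.
Proof.
move=> hM Fl Gl FG m; have [s [-> hs]] := hM m.
rewrite (lin_sum Fl) (lin_sum Gl) big_seq [RHS]big_seq; apply: eq_bigr => v /hs[mu].
exact: FG.
Qed.

(** The generator provided by [completely_pointed] need not be a weight vector. It is replaced by a
    nonzero weight vector, or by 0 if there is none, so that the weights of [M] are exactly the mu
    with [mv mu <> 0]. *)
Lemma pointed_family : completely_pointed H M -> exists mv : W -> M,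
  (forall mu, wv mu (mv mu)) /\ forall mu m, wv mu m -> exists a : k, m = a *: mv mu.
Proof.
move=> hM; suff /boolp.choice [mv hmv] : forall mu, exists v, wv mu v /\
    forall m, wv mu m -> exists a : k, m = a *: v.
  by exists mv; split=> mu; have [] := hmv mu.
move=> mu; have [v hv] := hM mu.
have [[m [m0 hm]]|no] := pselect (exists m, m <> 0 /\ wv mu m); last first.
  exists 0; split=> [|m hm]; first exact: wv_0.
  exists 0; rewrite scaler0; have [//|/eqP m0] := eqVneq m 0.
  by case: no; exists m.
exists m; split=> // m' hm'; have [[a e] [a' e']] := (hv m hm, hv m' hm').
have a0 : a != 0 by apply/eqP => a0; apply: m0; rewrite e a0 scale0r.
by exists (a' / a); rewrite e scalerA divfK.
Qed.
End Weights.

Lemma simple_lie_ideal (k : fieldType) (g : lieVectType k) (P : g -> Prop) :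
  simple_lie g -> P 0 -> (forall a x y, P x -> P y -> P (a *: x + y)) ->
  (forall x y, P y -> P (lie x y)) -> (forall x, P x -> x = 0) \/ (forall x, P x).
Proof.
move=> [_ g_simple] P0 PL PI; have [U hU] := vspace_of_pred P0 PL.
have [|U0|U1] := g_simple U.
- by move=> x y /hU Py; apply/hU/PI.
- by left=> x /hU; rewrite U0 memv0 => /eqP.
- by right=> x; apply/hU; rewrite U1 memvf.
Qed.

Lemma simple_faithful (k : fieldType) (g : lieVectType k) (M : lieModule g) : simple_lie g ->
  (exists (x : g) (m : M), lact x m <> 0) ->
  forall x : g, (forall m : M, lact x m = 0) -> x = 0.
Proof.
move=> g_simple [x0 [m0 xm0]].
have [|||//|all0] := @simple_lie_ideal k g (fun x => forall m : M, lact x m = 0) g_simple.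
- by move=> m; rewrite lact0l.
- by move=> a x y hx hy m; rewrite lactDl lactZl hx hy scaler0 addr0.
- by move=> x y hy m; rewrite lact_lie !hy lact0r subrr.
- by case: xm0; apply: all0.
Qed.

(** * Eigenvector decompositions over an algebraically closed field *)

Section EigenDecomposition.
Variables (k : closedFieldType) (vT : vectType k) (T : vT -> vT).
Hypothesis T_lin : linear T.
Hypothesis T_ss : forall a x, T (T x - a *: x) = a *: (T x - a *: x) -> T x = a *: x.

Definition poly_at (p : {poly k}) (x : vT) : vT := \sum_(i < size p) p`_i *: iter i T x.

Lemma poly_at_wide N (p : {poly k}) x : (size p <= N)%N -> poly_at p x = \sum_(i < N) p`_i *: iter i T x.
Proof.
move=> le; rewrite /poly_at (big_ord_widen N (fun i => p`_i *: iter i T x)) //.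
rewrite big_mkcond; apply: eq_bigr => i _; case: ltnP => // le'.
by rewrite nth_default // scale0r.
Qed.

Lemma poly_at_XsubC (p : {poly k}) z x : poly_at (('X - z%:P) * p) x = T (poly_at p x) - z *: poly_at p x.
Proof.
have le : (size (('X - z%:P) * p)%R <= (size p).+1)%N.
  by apply: leq_trans (size_polyMleq _ _) _; rewrite size_XsubC.
rewrite (poly_at_wide x le) mulrBl.
under eq_bigr => i _ do rewrite coefB coefXM mul_polyC coefZ scalerBl.
rewrite sumrB big_ord_recl /= scale0r add0r; congr (_ - _).
  rewrite /poly_at (lin_sum T_lin); apply: eq_bigr => i _.
  by rewrite (lin_Z T_lin).
rewrite (@poly_at_wide (size p).+1) // scaler_sumr.
by apply: eq_bigr => i _; rewrite scalerA.
Qed.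

Definition factor_at (rs : seq k) (x : vT) : vT := foldr (fun z y => T y - z *: y) x rs.

Lemma poly_at_factor rs x : poly_at (\prod_(z <- rs) ('X - z%:P)) x = factor_at rs x.
Proof.
elim: rs => [|z rs IH]; last by rewrite big_cons poly_at_XsubC IH.
by rewrite big_nil /poly_at size_poly1 big_ord1 coef1 scale1r.
Qed.

(** The iterates of [T] on [x] are linearly dependent, and the resulting polynomial splits. *)
Lemma annihilating_factors x : exists rs, factor_at rs x = 0.
Proof.
pose N := (\dim {:vT}).+1; pose X := [tuple iter i T x | i < N].
have nfX : ~~ free X.
  apply/negP => fX; have := dimvS (subvf <<X>>%VS).
  by rewrite (eqP fX) size_tuple ltnn.
have [c c0 [j cj]] : exists2 c : 'I_N -> k, \sum_i c i *: iter i T x = 0 & exists j, c j != 0.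
  apply: contrapT => no; case/negP: nfX; apply/freeP => c c0 j.
  have [//|cj] := eqVneq (c j) 0; case: no; exists c; last by exists j.
  rewrite -[RHS]c0; apply: eq_bigr => i _.
  by rewrite -tnth_nth tnth_mktuple.
pose p := \poly_(i < N) (if insub i is Some j then c j else 0).
have pE (i : 'I_N) : p`_i = c i by rewrite coef_poly ltn_ord valK.
have p0 : p != 0 by apply/eqP => p0; rewrite -pE p0 coef0 eqxx in cj.
have [rs rsE] := closed_field_poly_normal p.
exists rs; rewrite -poly_at_factor; apply/eqP.
have : poly_at p x = 0.
  rewrite (@poly_at_wide N) ?size_poly //= -[RHS]c0.
  by apply: eq_bigr => i _; rewrite pE.
rewrite rsE -mul_polyC; set q := \prod_(z <- rs) _.
have lp : lead_coef p != 0 by rewrite lead_coef_eq0.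
rewrite mul_polyC /poly_at size_scale //.
under eq_bigr => i _ do rewrite coefZ -scalerA.
by rewrite -scaler_sumr => /eqP; rewrite scaler_eq0 (negPf lp).
Qed.

(** Let (T - a) x be a sum of eigenvectors y with eigenvalues b(y). Subtracting from x the vectors y
    / (b(y) - a) with b(y) different from a leaves some x' killed by (T - a)^2, which [T_ss] makes
    an eigenvector. [Q] records properties that the summands inherit. *)
Lemma eigen_decomp (Q : vT -> Prop) : (forall a x y, Q x -> Q y -> Q (a *: x + y)) ->
  (forall x, Q x -> Q (T x)) -> forall x, Q x ->
  exists s : seq vT, x = \sum_(y <- s) y /\
    forall y, y \in s -> Q y /\ exists a, T y = a *: y.
Proof.
move=> QL QT x; have [rs] := annihilating_factors x.
have QN x' y a : Q x' -> Q y -> Q (y - a *: x').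
  by move=> Qx Qy; rewrite addrC -scaleNr; apply: QL.
have Q0 y : Q y -> Q 0 by move=> Qy; have := QN y y 1 Qy Qy; rewrite scale1r subrr.
rewrite /factor_at; elim/last_ind: rs x => [|rs a IH] x /=.
  by move=> -> _; exists [::]; rewrite big_nil.
rewrite foldr_rcons => h Qx; have [|s [sE hs]] := IH _ h; first by apply: QN => //; apply: QT.
have /boolp.choice [b hb] : forall y, exists b, y \in s -> T y = b *: y.
  move=> y; have [ys|ys] := boolP (y \in s); last by exists 0.
  by have [_ [b hb]] := hs y ys; exists b.
pose s1 := [seq (b y - a)^-1 *: y | y <- s & b y != a].
pose x' := x - \sum_(y <- s1) y.
have Qs y : y \in s1 -> Q y.
  case/mapP => z; rewrite mem_filter => /andP[_ /hs[Qz _]] ->.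
  by rewrite -[_ *: z]addr0; apply: QL => //; apply: Q0 Qz.
have Qsum : Q (\sum_(y <- s1) y).
  rewrite big_seq; elim/big_rec: _ => [|y z ys Qz]; first exact: Q0 Qx.
  by rewrite -[y]scale1r; apply: QL => //; apply: Qs.
have Qx' : Q x' by rewrite /x' -[\sum_(y <- s1) y]scale1r; apply: QN.
exists (x' :: s1); split; first by rewrite big_cons subrK.
move=> y; rewrite inE => /orP[/eqP ->|ys1]; last first.
  split; first exact: Qs.
  case/mapP: ys1 => z; rewrite mem_filter => /andP[_ zs] ->.
  by exists (b z); rewrite (lin_Z T_lin) hb // !scalerA mulrC.
split=> //; exists a; apply: T_ss.
have e : T x' - a *: x' = \sum_(y <- s | b y == a) y.
  pose z := \sum_(y <- s1) y.
  have -> : T x' - a *: x' = (T x - a *: x) + (a *: z - T z).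
    rewrite /x' (lin_B T_lin) scalerBr opprB addrACA [RHS]addrACA.
    by congr (_ + _); rewrite addrC.
  rewrite sE (bigID (fun y => b y == a)) /= -addrA [X in _ + X](_ : _ = 0) ?addr0 // addrC.
  rewrite /z big_map big_filter (lin_sum T_lin) scaler_sumr -sumrB -big_split /=.
  rewrite big_seq_cond big1 // => {}y /andP[ys ba].
  rewrite (lin_Z T_lin) hb // !scalerA -scalerBl -[X in _ + X]scale1r -scalerDl.
  have ba' : b y - a != 0 by rewrite subr_eq0.
  have -> : a / (b y - a) - (b y - a)^-1 * b y + 1 = 0 by field.
  by rewrite scale0r.
rewrite e (lin_sum T_lin) scaler_sumr big_seq_cond [RHS]big_seq_cond.
by apply: eq_bigr => {}y /andP[ys /eqP <-]; apply: hb.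
Qed.
End EigenDecomposition.

(** * The adjoint representation seen through a faithful weight module *)

Section AdjointWeights.
Variables (k : closedFieldType) (g : lieVectType k) (H : {vspace g}) (M : lieModule g).
Local Notation W := 'Hom(subvs_of H, k^o).
Local Notation wv := (weight_vector (H := H) (@lact k g M)).
Hypothesis M_weight : weight_module H M.
Hypothesis M_faithful : forall x : g, (forall m : M, lact x m = 0) -> x = 0.
Hypothesis H_cartan : cartan_subalgebra H.

Lemma cartan_abelian u v : u \in H -> v \in H -> lie u v = 0.
Proof.
move=> uH vH; apply: M_faithful => m; rewrite lact_lie; apply/eqP; rewrite subr_eq0; apply/eqP.
move: m; apply: (weight_ext M_weight).
- by move=> a x y; rewrite !lact_linearr.
- by move=> a x y; rewrite !lact_linearr.
by move=> mu m hm; rewrite !(wvP uH hm, wvP vH hm, lactZr) !scalerA mulrC.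
Qed.

(** On a vector of weight nu the element (ad u - a) y acts as (u - nu(u) - a) y. A second-order zero
    of ad u - a at [x] becomes one of u - c on [M], where [u] is diagonalizable. *)
Lemma ad_semisimple u : u \in H -> forall a x,
  lie u (lie u x - a *: x) = a *: (lie u x - a *: x) -> lie u x = a *: x.
Proof.
move=> uH a x h2; apply/eqP; rewrite -subr_eq0; apply/eqP/M_faithful.
have adE nu m y : wv nu m ->
    lact (lie u y - a *: y) m = lact u (lact y m) - ((nu (Subvs uH) : k) + a) *: lact y m.
  move=> hm; rewrite lactDl lactNl lactZl lact_lie (wvP uH hm) lactZr scalerDl opprD addrA.
  by [].
move=> m; move: m; apply: (weight_ext M_weight); first exact: lact_linearr.
  by move=> b v v'; rewrite scaler0 addr0.
move=> nu m hm; rewrite (adE nu) //; set c := _ + a.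
have [s [v [s_uniq hv vE]]] := weight_decomp M_weight (lact x m).
have h3 : lact u (lact u (lact x m) - c *: lact x m) - c *: (lact u (lact x m) - c *: lact x m) = 0.
  rewrite -(adE nu m x hm) -(adE nu m _ hm).
  by rewrite h2 subrr lact0l.
have sumE b (F : W -> k) : lact u (\sum_(mu <- s) F mu *: v mu) - b *: (\sum_(mu <- s) F mu *: v mu)
    = \sum_(mu <- s) (F mu * ((mu (Subvs uH) : k) - b)) *: v mu.
  rewrite lact_sumr scaler_sumr -sumrB; apply: eq_bigr => mu _.
  by rewrite lactZr (wvP uH (hv mu)) !scalerA -scalerBl mulrBr [b * _]mulrC.
have vE1 : lact x m = \sum_(mu <- s) 1 *: v mu.
  by rewrite vE; apply: eq_bigr => mu _; rewrite scale1r.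
rewrite vE1 !sumE in h3 *.
have z mu : mu \in s -> (1 * ((mu (Subvs uH) : k) - c) * ((mu (Subvs uH) : k) - c)) *: v mu = 0.
  apply: (weight_free s_uniq _ h3) => mu'.
  exact/wv_Z/hv.
rewrite big_seq big1 // => mu /z /eqP; rewrite !mul1r scaler_eq0 mulf_eq0 orbb.
by case/orP => /eqP ->; rewrite ?scale0r ?scaler0.
Qed.

(** Splitting under the next ad u preserves the eigenvalue equations already obtained, because the
    elements of H commute; [Q] carries these equations along. *)
Lemma ad_joint_decomp (us : seq g) : {subset us <= H} -> forall x, exists s : seq g,
  x = \sum_(y <- s) y /\ forall y, y \in s -> forall u, u \in us -> exists a : k, lie u y = a *: y.
Proof.
elim: us => [|u us IH] usH x; first by exists [:: x]; rewrite big_seq1.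
have [|s [-> hs]] := IH _ x; first by move=> v vs; apply: usH; rewrite inE vs orbT.
have uH : u \in H by apply: usH; rewrite inE eqxx.
have /boolp.choice [F hF] : forall y, exists s' : seq g, y \in s -> y = \sum_(z <- s') z /\
    forall z, z \in s' -> forall v, v \in u :: us -> exists a : k, lie v z = a *: z.
  move=> y; have [ys|ys] := boolP (y \in s); last by exists [::].
  pose Q z := forall v, v \in us -> forall a, lie v y = a *: y -> lie v z = a *: z.
  have [|||s' [yE hs']] := @eigen_decomp k g (lie u) (lie_linearr u) (ad_semisimple uH) Q _ _ y _.
  - move=> a z1 z2 h1 h2 v vus b e.
    by rewrite lieDr lieZr (h1 v vus b e) (h2 v vus b e) scalerDr !scalerA mulrC.
  - move=> z hz v vus b e; have vH : v \in H by apply: usH; rewrite inE vus orbT.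
    by rewrite lie_derivation (cartan_abelian vH uH) lie0l add0r (hz v vus b e) lieZr.
  - by [].
  exists s' => _; split=> // z zs v; rewrite inE => /orP[/eqP ->|vus].
    by have [_] := hs' z zs.
  have [Qz _] := hs' z zs; have [a e] := hs y ys v vus.
  by exists a; apply: Qz.
exists (flatten [seq F y | y <- s]); split.
  rewrite big_flatten big_map [LHS]big_seq [RHS]big_seq.
  by apply: eq_bigr => y ys; have [] := hF y ys.
by move=> z /flattenP[_ /mapP[y ys ->] zs]; have [_] := hF y ys; apply.
Qed.

Lemma adjoint_weight_module : weight_module H (adjoint g).
Proof.
move=> x; have [|s [-> hs]] := @ad_joint_decomp (vbasis H) _ x.
  by move=> y; apply: vbasis_mem.
exists s; split=> // y ys.
have /boolp.choice [c hc] : forall i : 'I_(\dim H), exists c : k, lie (vbasis H)`_i y = c *: y.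
  by move=> i; apply: hs => //; apply: mem_nth; rewrite size_tuple.
have [|mu hmu] := @lfun_of_linear k (subvs_of H) k^o
    (fun u => \sum_i coord (vbasis H) i (vsval u) * c i).
  move=> a u v; rewrite scaler_sumr -big_split; apply: eq_bigr => i _ /=.
  by rewrite !linearP /= mulrDl /GRing.scale /= mulrA.
exists mu => u; rewrite hmu {1}(coord_vbasis (subvsP u)) scaler_suml.
rewrite [LHS](lin_sum (lie_linearl y)); apply: eq_bigr => i _.
by rewrite (lin_Z (lie_linearl y)) hc scalerA.
Qed.

Lemma weight0_cartan (x : g) : weight_vector (H := H) lie 0 x <-> x \in H.
Proof.
split=> [hx|xH u]; last by rewrite cartan_abelian ?subvsP // lfunE scale0r.
have [_ _ norm] := H_cartan; apply: norm => y yH.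
rewrite lieC; have := hx (Subvs yH); rewrite lfunE /= scale0r => ->.
by rewrite oppr0 mem0v.
Qed.
End AdjointWeights.

Section FunctionalMultiples.
Variables (k : fieldType) (vT : vectType k).
Lemma lfun_mulrn (gamma : 'Hom(vT, k^o)) m u : (gamma *+ m) u = (gamma u : k) *+ m.
Proof.
by elim: m => [|m IH]; rewrite ?mulr0n ?zero_lfunE // !mulrS add_lfunE IH.
Qed.
Lemma lfun_mulrz (gamma : 'Hom(vT, k^o)) j u : (gamma *~ j) u = (gamma u : k) *~ j.
Proof. by case: j => j; rewrite ?NegzE ?mulrNz ?opp_lfunE -!pmulrn lfun_mulrn. Qed.
End FunctionalMultiples.

Section InvariantForm.
Variables (k : fieldType) (g : lieVectType k) (kappa : inv_form g).
Lemma iform_linl z : linear (kappa^~ z : g -> k^o).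
Proof. by move=> a x y; rewrite iform_linearl. Qed.
Lemma iform_linr x : linear (kappa x : g -> k^o).
Proof. by move=> a y z; rewrite ![kappa x _]iform_sym iform_linearl. Qed.
Lemma iformZl (a : k) x y : kappa (a *: x) y = a * kappa x y.
Proof. exact: (lin_Z (iform_linl y)). Qed.
Lemma iformZr (a : k) x y : kappa x (a *: y) = a * kappa x y.
Proof. exact: (lin_Z (iform_linr x)). Qed.
Lemma iformNl x y : kappa (- x) y = - kappa x y.
Proof. exact: (lin_N (iform_linl y)). Qed.
Lemma iform0l x : kappa 0 x = 0.
Proof. exact: (lin_0 (iform_linl x)). Qed.
Lemma iform_sumr J (s : seq J) (F : J -> g) x : kappa x (\sum_(j <- s) F j) = \sum_(j <- s) kappa x (F j).
Proof. exact: (lin_sum (iform_linr x)). Qed.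
End InvariantForm.

Section Roots.
Variables (k : fieldType) (k_char0 : [pchar k] =i pred0).
Variables (g : lieVectType k) (g_simple : simple_lie g) (H : {vspace g}) (kappa : inv_form g).
Local Notation W := 'Hom(subvs_of H, k^o).
Local Notation gwv := (weight_vector (H := H) (@lie k g)).
Hypothesis g_weight : weight_module H (adjoint g).
Hypothesis H_weight0 : forall x : g, gwv 0 x <-> x \in H.


Lemma center_trivial (x : g) : (forall y, lie x y = 0) -> x = 0.
Proof.
have [||| |all0] := @simple_lie_ideal k g (fun x => forall y, lie x y = 0) g_simple.
- by move=> y; rewrite lie0l.
- by move=> a u v hu hv y; rewrite lieDl lieZl hu hv scaler0 addr0.
- by move=> u v hv y; rewrite adjoint_subproof !hv lie0r subrr.
- by apply.
- by have [[u [v uv]] _] := g_simple; case: uv; apply: all0.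
Qed.

Lemma gwv_lie (gamma delta : W) x y : gwv gamma x -> gwv delta y -> gwv (gamma + delta) (lie x y).
Proof. by move=> hx hy; rewrite addrC; apply: (@wv_act _ _ _ (adjoint g)). Qed.

Lemma root_of (gamma : W) x : gwv gamma x -> x <> 0 -> gamma <> 0 -> Defs.root gamma.
Proof. by move=> hx x0 g0; split=> //; exists x. Qed.

Lemma iform_orth (gamma delta : W) x y : gwv gamma x -> gwv delta y -> gamma + delta <> 0 ->
  kappa x y = 0.
Proof.
move=> hx hy gd; apply/eqP; apply: contrapT => xy0; apply: gd; apply/lfunP => u.
rewrite add_lfunE zero_lfunE; apply/eqP.
have : kappa (lie x (vsval u)) y = kappa x (lie (vsval u) y) by rewrite iform_inv.
rewrite lieC hx hy iformNl iformZl iformZr => /eqP.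
rewrite eq_sym -addr_eq0 -mulrDl mulf_eq0 addrC => /orP[//|e].
by case: xy0.
Qed.

Lemma iform_pair (gamma : W) x : gwv gamma x -> x <> 0 ->
  exists2 y, gwv (- gamma) y & kappa x y <> 0.
Proof.
move=> hx x0; apply: contrapT => no; apply: x0; apply: (iform_nondeg (i := kappa)) => y.
have [s [v [_ hv ->]]] := weight_decomp g_weight y.
rewrite iform_sumr big1 // => mu _.
have [e|/eqP ne] := eqVneq (gamma + mu) 0; last exact: (iform_orth hx (hv mu)).
apply: contrapT => xv; apply: no; exists (v mu) => //.
by have -> : - gamma = mu by apply/eqP; rewrite eq_sym -addr_eq0 addrC e.
Qed.

Lemma iform_cartan u : u \in H -> (forall v, v \in H -> kappa u v = 0) -> u = 0.
Proof.
move=> /H_weight0 hu u0; apply: contrapT => une.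
have [y] := iform_pair hu une; rewrite oppr0 => /H_weight0 yH; case.
exact: u0.
Qed.

(** Such an element acts by zero on every weight space of g, hence is central. *)
Lemma roots_separate (u : subvs_of H) : (forall gamma, Defs.root gamma -> gamma u = 0) -> u = 0.
Proof.
move=> hu; apply/val_inj/center_trivial => y.
have [s [v [_ hv ->]]] := weight_decomp g_weight y.
rewrite (lin_sum (lie_linearr _)) big1 // => mu _; rewrite [LHS](hv mu).
have [->|/eqP v0] := eqVneq (v mu) 0; first by rewrite scaler0.
have [->|/eqP mu0] := eqVneq mu 0; first by rewrite zero_lfunE scale0r.
by rewrite hu ?scale0r //; apply: root_of (hv mu) v0 mu0.
Qed.

Lemma bracket_cartan (gamma : W) x y : gwv gamma x -> gwv (- gamma) y ->
  exists2 t : subvs_of H, vsval t = lie x y &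
    forall u : subvs_of H, kappa (vsval t) (vsval u) = (gamma u : k) * kappa x y.
Proof.
move=> hx hy; have := gwv_lie hx hy; rewrite subrr => /H_weight0 tH.
exists (Subvs tH) => //= u; rewrite iform_inv lieC hy opp_lfunE scaleNr opprK.
by rewrite iformZr.
Qed.

(* Otherwise [t := [x, y]] is central in [<x, y>], and the vanishing of its trace on a [gamma]-string of the adjoint representation forces every root to vanish at [t]. *)
Lemma root_triple (gamma : W) x : gwv gamma x -> x <> 0 -> gamma <> 0 ->
  exists y, chevalley_pair gamma x y.
Proof.
move=> hx x0 g0; have [y hy xy] := iform_pair hx x0.
have [t tE tk] := bracket_cartan hx hy.
suff gt : gamma t != 0.
  exists ((2%:R / (gamma t : k)) *: y); split=> //; first exact: (@wv_Z _ _ _ (adjoint g)).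
  exists ((2%:R / (gamma t : k)) *: t); first by rewrite linearZ /= tE lieZr.
  by rewrite linearZ /= /GRing.scale /= divfK.
apply/eqP => gt0; apply: g0; apply/lfunP => u; rewrite zero_lfunE.
have t0 : t = 0.
  apply: roots_separate => beta [_ [z z0 hz]].
  pose P v := exists s : seq g, v = \sum_(y <- s) y /\
    forall y, y \in s -> exists j : int, gwv (beta + gamma *~ j) y.
  have PL a v w : P v -> P w -> P (a *: v + w).
    move=> [s [-> hs]] [s' [-> hs']]; exists ([seq a *: y | y <- s] ++ s'); split.
      by rewrite big_cat big_map scaler_sumr.
    move=> y'; rewrite mem_cat => /orP[/mapP[y1 /hs [j hj] ->]|/hs' //].
    by exists j; apply: (@wv_Z _ _ _ (adjoint g)).
  have Pz : P z by exists [:: z]; rewrite big_seq1; split=> // y'; rewrite inE => /eqP ->;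
    exists 0; rewrite mulr0z addr0.
  have P0 : P 0 by exists [::]; rewrite big_nil.
  have [U hU] := vspace_of_pred P0 PL.
  have stab (i : int) x' : gwv (gamma *~ i) x' -> forall v, v \in U -> lie x' v \in U.
    move=> hx' v /hU[s [-> hs]]; apply/hU; exists [seq lie x' y | y <- s]; split.
      by rewrite big_map (lin_sum (lie_linearr x')).
    move=> _ /mapP[y1 /hs [j hj] ->]; exists (j + i); rewrite mulrzDr addrA.
    exact: (@wv_act _ _ _ (adjoint g)).
  have act v : v \in U -> lie (vsval t) v = (beta t : k) *: v.
    move=> /hU[s [-> hs]]; rewrite (lin_sum (lie_linearr _)) scaler_sumr big_seq [RHS]big_seq.
    apply: eq_bigr => y1 /hs[j hj]; rewrite hj add_lfunE; congr (_ *: _).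
    by rewrite lfun_mulrz gt0 mul0rz addr0.
  have bU := vbasisP U.
  have : tuple_trace (vbasis U) (fun v => lie x (lie y v) - lie y (lie x v)) = 0.
    apply: tuple_trace_comm; [exact: basis_free bU | exact: lie_linearr | exact: lie_linearr | |].
    - by rewrite (span_basis bU); apply: (stab 1); rewrite mulr1z.
    - by rewrite (span_basis bU); apply: (stab (-1)); rewrite mulrN1z.
  rewrite (@tuple_trace_diag _ _ _ _ _ (fun=> beta t : k)); last 2 first.
  - exact: basis_free bU.
  - move=> i; rewrite -adjoint_subproof -tE act //.
    by apply/vbasis_mem/mem_nth; rewrite size_tuple.
  rewrite sumr_const card_ord -mulr_natl => /eqP; rewrite mulf_eq0 natr_eq0_char0 //.
  case/orP => [dU|/eqP //]; case: z0; apply/eqP; rewrite -memv0.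
  by move: dU; rewrite dimv_eq0 => /eqP <-; apply/hU.
have := tk u; rewrite t0 linear0 iform0l => /esym/eqP.
by rewrite mulf_eq0 => /orP[/eqP //|/eqP].
Qed.

(** The scalar is c = kappa x y: were it zero, [t] would be orthogonal to H and therefore zero. *)
Lemma coroot_form (gamma : W) x y (t : subvs_of H) : gwv gamma x -> gwv (- gamma) y ->
  vsval t = lie x y -> gamma t <> 0 ->
  exists2 c : k, c <> 0 & forall u : subvs_of H, kappa (vsval t) (vsval u) = (gamma u : k) * c.
Proof.
move=> hx hy tE gt; have [t' t'E tk] := bracket_cartan hx hy.
have tt' : t' = t by apply: val_inj; rewrite /= -[val t']/(vsval t') t'E tE.
rewrite tt' in tk; exists (kappa x y) => // c0; apply: gt.
suff -> : t = 0 by rewrite linear0.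
apply/val_inj/iform_cartan; first exact: subvsP.
by move=> v vH; rewrite (tk (Subvs vH)) c0 mulr0.
Qed.
End Roots.

Section NegativePart.
Variables (k : fieldType) (k_char0 : [pchar k] =i pred0) (g : lieVectType k).
Variables (n : nat) (e f : 'I_n -> g) (rho : g) (a : 'I_n -> k).
Hypothesis rho_e : forall i, lie rho (e i) = e i.
Hypothesis rho_f : forall i, lie rho (f i) = - f i.
Hypothesis rhoE : rho = \sum_i a i *: lie (e i) (f i).
Variable N : g -> Prop.
Hypothesis N_lin : forall c x y, N x -> N y -> N (c *: x + y).
Hypothesis N_e : forall i x, N x -> N (lie (e i) x).
Hypothesis N_f : forall i x, N x -> N (lie (f i) x).
Hypothesis N_0 : forall x, N x -> lie rho x = 0 -> x = 0.

(* [rho] is a combination of commutators, hence has trace zero on this part, whereas all its eigenvalues there are negative integers. *)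
Lemma negative_part_trivial m x : N x -> lie rho x = - (m.+1%:R *: x) -> x = 0.
Proof.
pose Q y := N y /\ exists m, lie rho y = - (m.+1%:R *: y).
pose P v := exists s : seq g, v = \sum_(y <- s) y /\ forall y, y \in s -> Q y.
have QZ c y : Q y -> Q (c *: y).
  move=> [Ny [m' e']]; split; last by exists m'; rewrite lieZr e' scalerN !scalerA mulrC.
  have := N_lin (c - 1) Ny Ny; rewrite scalerBl scale1r subrK.
  by [].
have PL c v w : P v -> P w -> P (c *: v + w).
  move=> [s [-> hs]] [s' [-> hs']]; exists ([seq c *: y | y <- s] ++ s'); split.
    by rewrite big_cat big_map scaler_sumr.
  by move=> y'; rewrite mem_cat => /orP[/mapP[y1 /hs Qy ->]|/hs' //]; apply: QZ.
have P0 : P 0 by exists [::]; rewrite big_nil.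
have [U hU] := vspace_of_pred P0 PL.
have QU y : Q y -> y \in U.
  by move=> Qy; apply/hU; exists [:: y]; rewrite big_seq1; split=> // z; rewrite inE => /eqP ->.
have N0 y : N y -> N 0 by move=> Ny; have := N_lin (-1) Ny Ny; rewrite scaleN1r addNr.
have stab x' : (forall y, Q y -> lie x' y \in U) -> forall v, v \in U -> lie x' v \in U.
  move=> hx' v /hU[s [-> hs]]; rewrite (lin_sum (lie_linearr x')) big_seq.
  by apply: memv_suml => y /hs /hx'.
(* [e i] raises the eigenvalue of rho by one, so it can leave the negative part only from eigenvalue
   -1, and then it lands in the zero eigenspace, which meets [N] trivially. *)
have eU i v : v \in U -> lie (e i) v \in U.
  apply: stab => y [Ny [[|m'] e']].
    suff -> : lie (e i) y = 0 by rewrite mem0v.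
    apply: N_0; first exact: N_e.
    by rewrite lie_derivation rho_e e' lieNr lieZr scale1r subrr.
  apply: QU; split; first exact: N_e.
  exists m'; rewrite lie_derivation rho_e e' lieNr lieZr -[m'.+2]addn1 natrD scalerDl scale1r.
  by rewrite opprD addrC subrK.
have fU i v : v \in U -> lie (f i) v \in U.
  apply: stab => y [Ny [m' e']]; apply: QU; split; first exact: N_f.
  exists m'.+1; rewrite lie_derivation rho_f e' lieNr lieNl lieZr.
  by rewrite -[m'.+2]addn1 natrD scalerDl scale1r opprD addrC.
have [|X [bX hX]] := @special_basis k g U Q.
  move=> v /hU[s [-> hs]]; exists s; split=> // y ys.
  by split; [apply/QU/hs | apply: hs].
have /boolp.choice [ms hms] : forall i : 'I_(\dim U), exists m', lie rho X`_i = - (m'.+1%:R *: X`_i).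
  by move=> i; have [[_ //]|] := hX i; rewrite leqNgt ltn_ord.
have : tuple_trace X (lie rho) = 0.
  have -> : lie rho = (fun v => \sum_i a i *: (lie (e i) (lie (f i) v) - lie (f i) (lie (e i) v))).
    apply/funext => v; rewrite rhoE (lin_sum (lie_linearl v)); apply: eq_bigr => i _.
    by rewrite lieZl adjoint_subproof.
  rewrite tuple_trace_lin big1 // => i _; rewrite tuple_trace_comm ?mulr0 //.
  - exact: basis_free bX.
  - exact: lie_linearr.
  - exact: lie_linearr.
  - by rewrite (span_basis bX); apply: eU.
  - by rewrite (span_basis bX); apply: fU.
rewrite (@tuple_trace_diag _ _ _ _ _ (fun i => - (ms i).+1%:R)); last 2 first.
- exact: basis_free bX.
- by move=> i; rewrite hms scaleNr.
rewrite sumrN => /eqP; rewrite oppr_eq0 -natr_sum natr_eq0_char0 // => sum0 Nx ex.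
suff : x \in U.
  suff : (\dim U == 0)%N by rewrite dimv_eq0 => /eqP ->; rewrite memv0 => /eqP.
  apply: contraT; rewrite -lt0n => dU; move: sum0.
  by rewrite (bigD1 (Ordinal dU)).
by apply: QU; split=> //; exists m.
Qed.
End NegativePart.

(** * Generation of g by H and the Chevalley generators *)

Section Generation.
Variables (k : fieldType) (k_char0 : [pchar k] =i pred0).
Variables (g : lieVectType k) (g_simple : simple_lie g) (H : {vspace g}) (kappa : inv_form g).
Local Notation W := 'Hom(subvs_of H, k^o).
Local Notation gwv := (weight_vector (H := H) (@lie k g)).
Hypothesis g_weight : weight_module H (adjoint g).
Hypothesis H_weight0 : forall x : g, gwv 0 x <-> x \in H.
Variables (n : nat) (e f : 'I_n -> g) (alpha : 'I_n -> W).
Hypothesis alpha_base : root_base alpha.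
Hypothesis ef_pair : forall i, chevalley_pair (alpha i) (e i) (f i).

(** [rho] is the sum of the fundamental coweights, so its value on a root is the height of that
    root. *)
Lemma rho_exists : exists rho : subvs_of H, forall i, alpha i rho = 1.
Proof.
have [_ /free_enumP fr _] := alpha_base; have [u hu] := dual_family fr.
exists (\sum_j u j) => i; rewrite linear_sum (bigD1 i) //= hu eqxx big1 ?addr0 // => j ji.
by rewrite hu eq_sym (negPf ji).
Qed.

Lemma root_rho (rho : subvs_of H) (gamma : W) : (forall i, alpha i rho = 1) -> Defs.root gamma ->
  exists m : nat, gamma rho = m.+1%:R \/ gamma rho = - m.+1%:R.
Proof.
move=> hrho hg; have [_ _ /(_ gamma hg) [c hc]] := alpha_base.
have sumE : (\sum_i alpha i *+ c i) rho = (\sum_i c i)%:R.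
  rewrite sum_lfunE natr_sum; apply: eq_bigr => i _.
  by rewrite lfun_mulrn hrho.
case m : (\sum_i c i)%N sumE => [|m'] sumE.
  case: hg => g0 _; case: g0.
  have z0 : \sum_i alpha i *+ c i = 0.
    apply: big1 => i _; move/eqP: m; rewrite sum_nat_eq0 => /forallP/(_ i)/eqP ->.
    by rewrite mulr0n.
  by case: hc => ->; rewrite z0 ?oppr0.
by exists m'; case: hc => ->; [left | right]; rewrite ?opp_lfunE sumE.
Qed.

Lemma roots_vanish (u : subvs_of H) : (forall i, alpha i u = 0) -> u = 0.
Proof.
move=> hu; apply: (roots_separate g_simple g_weight) => gamma hg.
have [_ _ /(_ gamma hg) [c hc]] := alpha_base.
have sumE : (\sum_i alpha i *+ c i) u = 0.
  by rewrite sum_lfunE big1 // => i _; rewrite lfun_mulrn hu mul0rn.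
by case: hc => ->; rewrite ?opp_lfunE sumE ?oppr0.
Qed.

(** By [coroot_form], an element of H orthogonal to all simple coroots is killed by all simple
    roots, hence is zero. *)
Lemma coroots_span : exists s : 'I_n -> g,
  (forall i, s i = lie (e i) (f i)) /\ <<[seq s i | i <- enum 'I_n]>>%VS = H.
Proof.
exists (fun i => lie (e i) (f i)); split=> //.
apply: (perp_trivial (B := kappa)); [exact: iform_linl | exact: iform_linr | |].
  by apply/span_subvP => _ /mapP[i _ ->]; have [_ _ [u <- _]] := ef_pair i; apply: subvsP.
move=> x xH hx; suff : Subvs xH = 0 by move/(congr1 vsval); rewrite linear0.
apply: roots_vanish => i; have [he hf [t tE at2]] := ef_pair i.
have [|c c0 hc] := coroot_form kappa g_weight H_weight0 he hf tE.
  by rewrite at2; apply/eqP; rewrite natr_eq0_char0.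
have := hc (Subvs xH); rewrite /= tE iform_sym hx; last first.
  by apply/memv_span/map_f; rewrite mem_enum.
by move/esym/eqP; rewrite mulf_eq0 => /orP[/eqP //|/eqP].
Qed.

(** The orthogonal complement [N] of the subalgebra is stable under it and meets H trivially, kappa
    being nondegenerate on H. Its components of positive and negative height vanish by the trace
    argument, so [N] is 0. *)
Lemma chevalley_generated (P : g -> Prop) : (forall a x y, P x -> P y -> P (a *: x + y)) ->
  (forall x y, P x -> P y -> P (lie x y)) -> (forall u, u \in H -> P u) ->
  (forall i, P (e i)) -> (forall i, P (f i)) -> forall x, P x.
Proof.
move=> PL PM PH Pe Pf; have [U hU] := vspace_of_pred (PH 0 (mem0v H)) PL.
suff Uf : U = fullv by move=> x; apply/hU; rewrite Uf memvf.
apply: (perp_trivial (B := kappa)); [exact: iform_linl | exact: iform_linr | exact: subvf |].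
move=> x _ hx; pose N y := forall p, P p -> kappa y p = 0.
have {hx} Nx : N x by move=> p Pp; apply: hx; apply/hU.
have NL a y z : N y -> N z -> N (a *: y + z).
  by move=> hy hz p Pp; rewrite iform_linearl hy // hz // mulr0 addr0.
have NP p y : P p -> N y -> N (lie p y).
  move=> Pp Ny q Pq; rewrite lieC iformNl iform_inv Ny ?oppr0 //.
  exact: PM.
have NH y : N y -> y \in H -> y = 0.
  by move=> Ny yH; apply: (iform_cartan g_weight H_weight0 (kappa := kappa)) => // v vH; apply/Ny/PH.
have [rho hrho] := rho_exists.
have N0 y : N y -> lie (vsval rho) y = 0 -> y = 0.
  move=> Ny; have [s [v [s_uniq hv vE]]] := weight_decomp g_weight y.
  rewrite vE in Ny *; rewrite (lin_sum (lie_linearr _)) => sum0.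
  have Nv := @weight_component _ _ _ (adjoint g) N s v NL _ s_uniq hv Ny.
  rewrite big_seq big1 // => mu mus.
  have [//|/eqP v0] := eqVneq (v mu) 0.
  have H1 : (mu rho : k) *: v mu = 0.
    apply: (@weight_free _ _ _ (adjoint g) s (fun mu => (mu rho : k) *: v mu) s_uniq) => // [mu'|].
      exact/wv_Z/hv.
    by rewrite -[RHS]sum0; apply: eq_bigr => mu' _; rewrite [RHS](hv mu').
  have mu0 : mu = 0.
    apply: contrapT => mu0; have hr := root_of (hv mu) v0 mu0.
    have [m hm] := root_rho hrho hr; move/eqP: H1; rewrite scaler_eq0.
    case/orP => [|/eqP //]; case: hm => ->; rewrite ?oppr_eq0 natr_eq0_char0 //.
  apply: NH; first by apply: Nv => // u z; apply: NP; apply/PH/subvsP.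
  by apply/H_weight0; rewrite -mu0; apply: hv.
have [s [sE span_s]] := coroots_span.
have [a rhoE] : exists a : 'I_n -> k, vsval rho = \sum_i a i *: lie (e i) (f i).
  have := subvsP rho; rewrite -{2}span_s.
  have -> : [seq s i | i <- enum 'I_n] = map_tuple s (ord_tuple n) by [].
  move/coord_span => ->; eexists; apply: eq_bigr => i _; congr (_ *: _).
  by rewrite -tnth_nth tnth_map tnth_ord_tuple sE.
have re i : lie (vsval rho) (e i) = e i.
  by have [he _ _] := ef_pair i; rewrite he hrho scale1r.
have rf i : lie (vsval rho) (f i) = - f i.
  by have [_ hf _] := ef_pair i; rewrite hf opp_lfunE hrho scaleN1r.
have [s' [v [s_uniq hv vE]]] := weight_decomp g_weight x.
rewrite vE in Nx *; have Nv := @weight_component _ _ _ (adjoint g) N s' v NL _ s_uniq hv Nx.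
rewrite big_seq big1 // => mu mus.
have {}Nv : N (v mu) by apply: Nv => // u z; apply: NP; apply/PH/subvsP.
have [//|/eqP v0] := eqVneq (v mu) 0.
have [mu0|/eqP mu0] := eqVneq mu 0.
  by apply: NH => //; apply/H_weight0; rewrite -mu0; apply: hv.
have [m [hm|hm]] := root_rho hrho (root_of (hv mu) v0 mu0).
  (* For positive height the roles of [e] and [f] are exchanged and rho is replaced by its
     opposite. *)
  have := @negative_part_trivial k k_char0 g n f e (- vsval rho) a _ _ _ N NL _ _ _ m (v mu) Nv.
  apply.
  - by move=> i; rewrite lieNl rf opprK.
  - by move=> i; rewrite lieNl re.
  - by rewrite rhoE -sumrN; apply: eq_bigr => i _; rewrite -scalerN [in RHS]lieC.
  - by move=> i y; apply: NP.
  - by move=> i y; apply: NP.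
  - by move=> y Ny; rewrite lieNl => /eqP; rewrite oppr_eq0 => /eqP; apply: N0.
  - by rewrite lieNl [lie _ _](hv mu) hm.
apply: (@negative_part_trivial k k_char0 g n e f (vsval rho) a _ _ _ N NL _ _ _ m (v mu) Nv) => //.
- by move=> i y; apply: NP.
- by move=> i y; apply: NP.
- by rewrite [lie _ _](hv mu) hm scaleNr.
Qed.
End Generation.

(** * Representations of sl2 *)

Section SlTwo.
Variables (k : fieldType) (k_char0 : [pchar k] =i pred0).
Variables (g : lieAlgType k) (M : lieModule g) (e f h : g).
Hypothesis ef : lie e f = h.
Hypothesis he : lie h e = 2%:R *: e.
Hypothesis hf : lie h f = - (2%:R *: f).
Local Notation E := (@lact k g M e).
Local Notation F := (@lact k g M f).
Local Notation Hh := (@lact k g M h).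

Lemma sl2_h_e c v : Hh v = c *: v -> Hh (E v) = (c + 2%:R) *: E v.
Proof. by move=> hv; rewrite lactC he lactZl hv lactZr -scalerDl addrC. Qed.
Lemma sl2_h_f c v : Hh v = c *: v -> Hh (F v) = (c - 2%:R) *: F v.
Proof. by move=> hv; rewrite lactC hf lactNl lactZl hv lactZr addrC -scalerBl. Qed.
Lemma sl2_h_e_iter c v q : Hh v = c *: v -> Hh (iter q E v) = (c + q%:R * 2%:R) *: iter q E v.
Proof.
move=> hv; elim: q => [|q IH]; first by rewrite mul0r addr0.
by rewrite iterS (sl2_h_e IH) -natr1; congr (_ *: _); ring.
Qed.
Lemma sl2_h_f_iter c v q : Hh v = c *: v -> Hh (iter q F v) = (c - q%:R * 2%:R) *: iter q F v.
Proof.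
move=> hv; elim: q => [|q IH]; first by rewrite mul0r subr0.
by rewrite iterS (sl2_h_f IH) -natr1; congr (_ *: _); ring.
Qed.

Lemma sl2_top v : v <> 0 -> (exists p, iter p E v = 0) ->
  exists q, iter q E v <> 0 /\ E (iter q E v) = 0.
Proof.
move=> v0 [p]; elim: p => [//|p IH] /=.
have [/IH //|/eqP pv] := eqVneq (iter p E v) 0.
by exists p.
Qed.

Lemma sl2_lower c w j : E w = 0 -> Hh w = c *: w ->
  E (iter j.+1 F w) = (j.+1%:R * (c - j%:R)) *: iter j F w.
Proof.
move=> Ew hw; elim: j => [|j IH].
  by rewrite /= lactC ef hw Ew lact0r addr0 subr0 mul1r.
rewrite iterS lactC ef IH (sl2_h_f_iter j.+1 hw) lactZr -iterS -scalerDl; congr (_ *: _).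
by rewrite -[j.+2]addn1 -[j.+1]addn1 !natrD; ring.
Qed.

(** If F^(P+1) w is the first power to vanish, applying E gives (P + 1)(c - P) F^P w = 0, which
    determines c. *)
Lemma sl2_finite c w : w <> 0 -> E w = 0 -> Hh w = c *: w -> (exists p, iter p F w = 0) ->
  exists P : nat, c = P%:R /\ forall j, (j <= P)%N -> iter j F w <> 0.
Proof.
move=> w0 Ew hw [p pw].
have ex : exists p, iter p F w == 0 by exists p; apply/eqP.
case: (ex_minnP ex) => -[|P] /eqP; first by rewrite /= => /w0.
move=> Pw Pmin; exists P.
have below j : (j <= P)%N -> iter j F w <> 0.
  by move=> jP /eqP /Pmin; rewrite leqNgt ltnS jP.
split=> //; have := sl2_lower P Ew hw; rewrite Pw lact0r => /esym/eqP.
rewrite scaler_eq0 mulf_eq0 natr_eq0_char0 //= => /orP[|/eqP /below //].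
  by rewrite subr_eq0 => /eqP.
by move=> /(_ (leqnn P)).
Qed.

(** [v] is an eigenvector of h and of the Casimir element 4 f e + h (h + 2), the latter with
    eigenvalue [C]. *)
Definition casimir_eq (C c : k) (v : M) : Prop :=
  Hh v = c *: v /\ exists2 t, F (E v) = t *: v & C = 4%:R * t + c * (c + 2%:R).

Lemma casimir_f C c v : casimir_eq C c v -> casimir_eq C (c - 2%:R) (F v).
Proof.
move=> [hv [t tv ->]]; split; first exact: sl2_h_f.
exists (t + c); last by ring.
by rewrite [E (F v)]lactC ef hv lactDr tv !lactZr scalerDl addrC.
Qed.
Lemma casimir_e C c v : casimir_eq C c v -> casimir_eq C (c + 2%:R) (E v).
Proof.
move=> [hv [t tv ->]]; split; first exact: sl2_h_e.
exists (t - (c + 2%:R)); last by ring.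
rewrite scalerBl -(sl2_h_e hv) -lactZr -tv.
by rewrite [E (F (E v))]lactC ef addrAC subrr add0r.
Qed.
Lemma casimir_f_iter C c v j : casimir_eq C c v -> casimir_eq C (c - j%:R * 2%:R) (iter j F v).
Proof.
move=> hv; elim: j => [|j IH]; first by rewrite mul0r subr0.
have -> : c - j.+1%:R * 2%:R = c - j%:R * 2%:R - 2%:R by rewrite -natr1; ring.
exact: casimir_f.
Qed.
Lemma casimir_e_iter C c v j : casimir_eq C c v -> casimir_eq C (c + j%:R * 2%:R) (iter j E v).
Proof.
move=> hv; elim: j => [|j IH]; first by rewrite mul0r addr0.
have -> : c + j.+1%:R * 2%:R = c + j%:R * 2%:R + 2%:R by rewrite -natr1; ring.
exact: casimir_e.
Qed.
Lemma casimir_top C c v : v <> 0 -> E v = 0 -> casimir_eq C c v -> C = c * (c + 2%:R).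
Proof.
move=> v0 Ev [_ [t tv ->]]; move: tv; rewrite Ev lact0r => /esym/eqP.
by rewrite scaler_eq0 => /orP[/eqP ->|/eqP //]; rewrite mulr0 add0r.
Qed.
Lemma casimir_uniq C C' c c' a v : v <> 0 -> a != 0 -> casimir_eq C c v ->
  casimir_eq C' c' (a *: v) -> C = C'.
Proof.
move=> v0 a0 [hv [t tv ->]] [hv' [t' tv' ->]].
have inj b b' : b *: v = b' *: v -> b = b'.
  by move/eqP; rewrite -subr_eq0 -scalerBl scaler_eq0 subr_eq0 => /orP[/eqP //|/eqP].
have -> : c = c'.
  by apply: inj; apply: (scalerI a0); rewrite [in RHS]scalerA [a * _]mulrC -scalerA -hv' lactZr hv.
have -> // : t = t'.
by apply: inj; apply: (scalerI a0); rewrite [in RHS]scalerA [a * _]mulrC -scalerA -tv' !lactZr tv.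
Qed.
End SlTwo.

(** * Polynomial functions on weights *)

Section Newton.
Variables (k : fieldType) (k_char0 : [pchar k] =i pred0).

Definition bin_poly (a : nat) : {poly k} := (a`!%:R)^-1 *: \prod_(i < a) ('X - i%:R%:P).

Lemma size_bin_poly a : (size (bin_poly a) <= a.+1)%N.
Proof.
apply: leq_trans (size_scale_leq _ _) _.
by rewrite -(big_mkord xpredT (fun i => 'X - i%:R%:P)) size_prod_XsubC size_iota subn0.
Qed.

Lemma bin_polyE a y : (bin_poly a).[y%:R] = 'C(y, a)%:R.
Proof.
have fa : a`!%:R != 0 :> k by rewrite natr_eq0_char0 // -lt0n fact_gt0.
apply: (mulfI fa); rewrite hornerZ mulrA mulfV // mul1r -natrM mulnC bin_ffact.
rewrite horner_prod ffact_prod natr_prod.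
have [le|lt] := leqP a y.
  by apply: eq_bigr => i _; rewrite hornerXsubC natrB // ltnW // (leq_trans (ltn_ord i)).
rewrite (bigD1 (Ordinal lt)) //= hornerXsubC subrr mul0r.
by rewrite (bigD1 (Ordinal lt)) //= subnn mul0r.
Qed.

Variable W : zmodType.
(** The opposite of the usual forward difference: this is the sign produced by the commutator of a
    vector of weight gamma with an operator acting on weight vectors by the scalars [r]. *)
Definition fdiff (gamma : W) (r : W -> k) : W -> k := fun mu => r mu - r (mu + gamma).

Lemma fdiff_iter_shift gamma r a mu :
  iter a (fdiff gamma) r (mu + gamma) = iter a (fdiff gamma) r mu - iter a.+1 (fdiff gamma) r mu.
Proof. by rewrite iterS /fdiff subKr. Qed.

Lemma newton gamma r mu y B : (y < B)%N ->
  r (mu + gamma *+ y) = \sum_(a < B) (-1) ^+ a * 'C(y, a)%:R * iter a (fdiff gamma) r mu.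
Proof.
elim: y mu B => [|y IH] mu [//|B] yB.
  rewrite big_ord_recl /= expr0 bin0 !mul1r addr0 big1 ?addr0 // => i _.
  by rewrite bin0n mulr0 mul0r.
rewrite mulrS addrA (IH _ B.+1) ?(ltnW yB) //.
under eq_bigr => a _ do rewrite fdiff_iter_shift mulrBr.
rewrite sumrB big_ord_recl big_ord_recr /= (bin_small (m := B)) // mulr0 mul0r addr0.
rewrite !bin0 [in RHS]big_ord_recl /= !bin0 -addrA; congr (_ + _).
rewrite -sumrB; apply: eq_bigr => a _; rewrite /bump /= !add1n binS natrD exprS.
by ring.
Qed.

Lemma fdiff_iter_local gamma (F : W -> k) b mu :
  (forall i, (i <= b)%N -> F (mu + gamma *+ i) = 0) -> iter b (fdiff gamma) F mu = 0.
Proof.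
elim: b mu => [|b IH] mu h; first by have := h 0%N isT; rewrite addr0.
rewrite iterS /fdiff !IH ?subrr // => i ib.
  by rewrite -addrA -mulrS; apply: h.
by apply: h; rewrite leqW.
Qed.

(** The difference of order N vanishes wherever its N + 1 points lie in the segment 0..T, so the
    Newton expansion at nu stops before degree N. The expansion in the proof has length
    [maxn j.+1 N] to cover both the point j and the N terms. *)
Lemma newton_poly gamma r nu N T :
  (forall j, (j + N <= T)%N -> iter N (fdiff gamma) r (nu + gamma *+ j) = 0) ->
  exists2 q : {poly k}, (size q <= N)%N & forall j, (j <= T)%N -> r (nu + gamma *+ j) = q.[j%:R].
Proof.
move=> h; exists (\sum_(a < N) ((-1) ^+ a * iter a (fdiff gamma) r nu) *: bin_poly a).
  apply: (leq_trans (size_sum _ _ _)); apply/bigmax_leqP => a _.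
  apply: leq_trans (size_scale_leq _ _) _; apply: leq_trans (size_bin_poly _) _.
  exact: ltn_ord.
move=> j jT; rewrite horner_sum.
have term (a : nat) : (N <= a)%N -> (-1) ^+ a * 'C(j, a)%:R * iter a (fdiff gamma) r nu = 0.
  move=> Na; have [ja|aj] := ltnP j a; first by rewrite bin_small // mulr0 mul0r.
  rewrite -(subnK Na) iterD [iter (a - N) _ _ _]fdiff_iter_local ?mulr0 // => i ia.
  by apply: h; lia.
rewrite (@newton gamma r nu j (maxn j.+1 N)); last by rewrite leq_maxl.
rewrite (big_ord_widen (maxn j.+1 N) (fun a => (((-1) ^+ a * iter a (fdiff gamma) r nu) *: bin_poly a).[j%:R])); last by rewrite leq_maxr.
rewrite [RHS]big_mkcond; apply: eq_bigr => a _; case: ltnP => [_|/term //].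
by rewrite hornerZ bin_polyE mulrAC.
Qed.

Lemma poly_nat_eq (p q : {poly k}) (N : nat) (s : nat -> nat) : injective s ->
  (size p <= N)%N -> (size q <= N)%N -> (forall i, (i < N)%N -> p.[(s i)%:R] = q.[(s i)%:R]) -> p = q.
Proof.
move=> s_inj pN qN pq; apply/eqP; rewrite -subr_eq0; apply: contraT => nz.
have le : (size (p - q)%R <= N)%N.
  by apply: leq_trans (size_polyD _ _) _; rewrite size_polyN geq_max pN.
suff : (N < size (p - q)%R)%N by rewrite ltnNge le.
rewrite -{1}(size_iota 0 N) -(size_map (fun i => (s i)%:R : k)); apply: max_poly_roots => //.
  apply/allP => x /mapP[i]; rewrite mem_iota add0n /= => iN ->.
  by rewrite /root hornerD hornerN pq // subrr.
rewrite map_inj_uniq ?iota_uniq // => i j /(natr_inj_char0 k_char0).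
exact: s_inj.
Qed.
End Newton.

Section PolynomialFunctions.
Variables (k : fieldType) (k_char0 : [pchar k] =i pred0) (vT : vectType k).
Local Notation W := 'Hom(vT, k^o).
Implicit Types (mu nu lam gamma : W) (P Q : W -> k).

Inductive polyf : (W -> k) -> Prop :=
  | polyf_const c : polyf (fun=> c)
  | polyf_ev u : polyf (fun mu => mu u)
  | polyf_add P Q : polyf P -> polyf Q -> polyf (fun mu => P mu + Q mu)
  | polyf_mul P Q : polyf P -> polyf Q -> polyf (fun mu => P mu * Q mu).

Lemma polyf_sub P Q : polyf P -> polyf Q -> polyf (fun mu => P mu - Q mu).
Proof.
move=> hP hQ; have -> : (fun mu => P mu - Q mu) = (fun mu => P mu + (-1) * Q mu).
  by apply/funext => mu; rewrite mulN1r.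
by apply: polyf_add => //; apply: polyf_mul => //; apply: polyf_const.
Qed.

Lemma polyf_sum J (s : seq J) (F : J -> W -> k) : (forall j, polyf (F j)) ->
  polyf (fun mu => \sum_(j <- s) F j mu).
Proof.
move=> hF; elim: s => [|j s IH].
  have -> : (fun mu => \sum_(j <- [::]) F j mu) = (fun=> 0) by apply/funext => mu; rewrite big_nil.
  exact: polyf_const.
have -> : (fun mu => \sum_(j <- j :: s) F j mu) = (fun mu => F j mu + \sum_(j <- s) F j mu).
  by apply/funext => mu; rewrite big_cons.
exact: polyf_add.
Qed.

Lemma polyf_horner (p : {poly k}) P : polyf P -> polyf (fun mu => p.[P mu]).
Proof.
move=> hP; elim/poly_ind: p => [|p c IH].
  have -> : (fun mu => 0.[P mu]) = (fun=> 0 : k) by apply/funext => mu; rewrite horner0.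
  exact: polyf_const.
have -> : (fun mu => (p * 'X + c%:P).[P mu]) = (fun mu => p.[P mu] * P mu + c).
  by apply/funext => mu; rewrite !hornerE.
by apply: polyf_add; [apply: polyf_mul | apply: polyf_const].
Qed.

Lemma polyf_comp P (phi : W -> W) : (forall u, polyf (fun mu => phi mu u)) -> polyf P ->
  polyf (fun mu => P (phi mu)).
Proof.
move=> hphi; elim=> {P} [c|u|P Q _ IHP _ IHQ|P Q _ IHP _ IHQ] //.
- exact: polyf_const.
- exact: polyf_add.
- exact: polyf_mul.
Qed.

Lemma polyf_shift P nu : polyf P -> polyf (fun mu => P (mu + nu)).
Proof.
apply: polyf_comp => u; have -> : (fun mu => (mu + nu)%R u : k) = (fun mu => (mu u : k) + (nu u : k)).
  by apply/funext => mu; rewrite add_lfunE.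
by apply: polyf_add; [apply: polyf_ev | apply: polyf_const].
Qed.

(** The degree bound is the same for all lines, so the number of values needed to determine a
    restriction is fixed in advance. *)
Lemma polyf_line P : polyf P -> exists D, forall mu gamma, exists2 q : {poly k},
  (size q <= D)%N & forall x, P (mu + x *: gamma) = q.[x].
Proof.
elim=> {P} [c|u|P Q _ [D hP] _ [D' hQ]|P Q _ [D hP] _ [D' hQ]].
- exists 1%N => mu gamma; exists c%:P; first by rewrite size_polyC leq_b1.
  by move=> x; rewrite hornerC.
- exists 2%N => mu gamma; exists ((gamma u : k) *: 'X + (mu u : k)%:P).
    apply: leq_trans (size_polyD _ _) _; rewrite geq_max.
    rewrite (leq_trans (size_scale_leq _ _)) ?size_polyX //=.
    by rewrite (leq_trans (size_polyC_leq1 _)).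
  by move=> x; rewrite !hornerE add_lfunE scale_lfunE addrC mulrC.
- exists (maxn D D') => mu gamma; have [[p pD pE] [q qD qE]] := (hP mu gamma, hQ mu gamma).
  exists (p + q); last by move=> x; rewrite hornerD pE qE.
  by apply: leq_trans (size_polyD _ _) _; rewrite geq_max !leq_max pD qD orbT.
- exists (D + D')%N => mu gamma; have [[p pD pE] [q qD qE]] := (hP mu gamma, hQ mu gamma).
  exists (p * q); last by move=> x; rewrite hornerM pE qE.
  by apply: leq_trans (size_polyMleq _ _) _; lia.
Qed.

(** Lagrange interpolation: the basis polynomials are products of evaluations separating one weight
    from each of the others. *)
Lemma polyf_interp (s : seq W) (psi : W -> k) : exists2 P, polyf P & forall mu, mu \in s -> P mu = psi mu.
Proof.
have sep (s' : seq W) mu : mu \notin s' ->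
    exists Q, [/\ polyf Q, Q mu = 1 & forall nu, nu \in s' -> Q nu = 0].
  elim: s' => [|nu s' IH].
    by exists (fun=> 1); split=> //; apply: polyf_const.
  rewrite inE negb_or => /andP[mn /IH[Q [hQ Q1 Q0]]].
  have [u hu] : exists u, (mu u : k) - (nu u : k) != 0.
    apply: contrapT => no; case/eqP: mn; apply/lfunP => u; apply/eqP; rewrite -subr_eq0.
    by apply: contraT => ne; case: no; exists u.
  exists (fun la : W => ((la u : k) - (nu u : k)) / ((mu u : k) - (nu u : k)) * Q la); split.
  - apply: polyf_mul => //; apply: polyf_mul; last exact: polyf_const.
    by apply: polyf_sub; [apply: polyf_ev | apply: polyf_const].
  - by rewrite mulfV // mul1r.
  - move=> la; rewrite inE => /orP[/eqP ->|/Q0 ->]; last by rewrite mulr0.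
    by rewrite subrr !mul0r.
elim: s => [|mu s [P hP PE]]; first by exists (fun=> 0) => //; apply: polyf_const.
have [mus|/sep[Q [hQ Q1 Q0]]] := boolP (mu \in s).
  by exists P => // nu; rewrite inE => /orP[/eqP ->|]; apply: PE.
exists (fun la : W => P la + (psi mu - P mu) * Q la).
  by apply: polyf_add => //; apply: polyf_mul => //; apply: polyf_const.
move=> nu; rewrite inE => /orP[/eqP ->|nus]; first by rewrite Q1 mulr1 addrC subrK.
by rewrite Q0 // mulr0 addr0 PE.
Qed.

Variables (d : nat) (beta : 'I_d -> W).
Hypothesis beta_sep : forall u, (forall j, beta j u = 0) -> u = 0.

Definition cone (lam : W) (y : 'I_d -> nat) : W := lam + \sum_j beta j *+ y j.

Variable dual : 'I_d -> vT.
Hypothesis dualE : forall i j, beta i (dual j) = (i == j)%:R.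

Lemma beta_span (phi : W) : (forall j, phi (dual j) = 0) -> phi = 0.
Proof.
move=> h; apply/lfunP => u; rewrite zero_lfunE.
have -> : u = \sum_j (beta j u : k) *: dual j.
  apply/eqP; rewrite -subr_eq0; apply/eqP/beta_sep => i.
  rewrite linearB linear_sum (bigD1 i) //= linearZ /= dualE eqxx big1.
    by rewrite addr0 /GRing.scale /= mulr1 subrr.
  by move=> j ji; rewrite linearZ /= dualE eq_sym (negPf ji) scaler0.
by rewrite linear_sum big1 // => j _; rewrite linearZ /= h scaler0.
Qed.

Lemma beta_coord (phi : W) : phi = \sum_j (phi (dual j) : k) *: beta j.
Proof.
apply/eqP; rewrite -subr_eq0; apply/eqP/beta_span => i.
rewrite add_lfunE opp_lfunE sum_lfunE (bigD1 i) //= scale_lfunE dualE eqxx big1.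
  by rewrite addr0 /GRing.scale /= mulr1 subrr.
by move=> j ji; rewrite scale_lfunE dualE (negPf ji) scaler0.
Qed.

(** The natural coordinates are replaced by arbitrary scalars one at a time: a polynomial in one
    variable vanishing at all natural numbers is zero. *)
Lemma cone_dense P lam : polyf P -> (forall y, P (cone lam y) = 0) -> forall mu, P mu = 0.
Proof.
move=> hP P0; have [D hD] := polyf_line hP.
(* Coordinates with index below [m] are arbitrary, the remaining ones are natural numbers. *)
have claim m : forall t : 'I_d -> k, (forall j : 'I_d, (m <= j)%N -> exists y : nat, t j = y%:R) ->
    P (lam + \sum_j t j *: beta j) = 0.
  elim: m => [|m IH] t ht.
    have /boolp.choice [y hy] : forall j, exists y : nat, t j = y%:R by move=> j; apply: ht.
    rewrite -[RHS](P0 y) /cone; congr (P (_ + _)); apply: eq_bigr => j _.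
    by rewrite hy scaler_nat.
  have [md|dm] := ltnP m d; last first.
    by apply: IH => j mj; apply: ht; have := ltn_ord j; lia.
  pose jm := Ordinal md; pose mu := lam + \sum_(j | j != jm) t j *: beta j.
  have [q qD qE] := hD mu (beta jm).
  have muE x : lam + \sum_j (if j == jm then x else t j) *: beta j = mu + x *: beta jm.
    rewrite (bigD1 jm) //= eqxx [x *: _ + _]addrC addrA /mu; congr (_ + _ + _).
    by apply: eq_bigr => j /negPf ->.
  have q0 : q = 0.
    apply: (@poly_nat_eq k k_char0 q 0 D id) => // [|i _]; first by rewrite size_poly0.
    rewrite horner0 -qE -muE; apply: IH => j mj; case: eqP => [_|jj]; first by exists i.
    apply: ht; rewrite ltn_neqAle mj andbT; apply/eqP => e; apply: jj; exact/val_inj.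
  have -> : lam + \sum_j t j *: beta j = mu + t jm *: beta jm.
    by rewrite -muE; congr (_ + _); apply: eq_bigr => j _; case: eqP => [->|].
  by rewrite qE q0 horner0.
move=> mu; have -> : mu = lam + \sum_j ((mu - lam)%R (dual j) : k) *: beta j.
  by rewrite -beta_coord addrC subrK.
by apply: (claim d) => j; rewrite leqNgt ltn_ord.
Qed.

Variables (supp : W -> Prop) (N : nat).
Hypothesis beta_supp : forall j mu, supp mu -> supp (mu + beta j).

Lemma fdiffC gamma delta r : fdiff (k := k) gamma (fdiff delta r) = fdiff delta (fdiff gamma r) :> (W -> k).
Proof.
apply/funext => mu; rewrite /fdiff [mu + gamma + delta]addrAC; ring.
Qed.
Lemma fdiff_iterC gamma delta a b (r : W -> k) :
  iter a (fdiff gamma) (iter b (fdiff delta) r) = iter b (fdiff delta) (iter a (fdiff gamma) r).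
Proof.
have one c (s : W -> k) : fdiff gamma (iter c (fdiff delta) s) = iter c (fdiff delta) (fdiff gamma s).
  by elim: c => //= c IH; rewrite fdiffC IH.
by elim: a => //= a ->; rewrite one.
Qed.

(** Newton expansion in one coordinate at a time. It has at most N terms in each direction, and its
    coefficients are iterated differences of [r], which satisfy the same hypothesis and are
    polynomial in the preceding coordinates by induction. *)
Lemma cone_poly (r : W -> k) lam : (forall j mu, supp mu -> iter N (fdiff (beta j)) r mu = 0) ->
  supp lam -> exists2 P, polyf P & forall y, P (cone lam y) = r (cone lam y).
Proof.
move=> hr slam.
have claim m : (m <= d)%N -> forall r : W -> k,
    (forall j mu, supp mu -> iter N (fdiff (beta j)) r mu = 0) ->
    exists2 P, polyf P & forall y : 'I_d -> nat, (forall j : 'I_d, (m <= j)%N -> y j = 0%N) ->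
      P (cone lam y) = r (cone lam y); last first.
  have [P hP PE] := claim d (leqnn d) r hr.
  by exists P => // y; apply: PE => j; rewrite leqNgt ltn_ord.
elim: m {r hr} => [|m IH] md r hr.
  exists (fun=> r lam) => [|y hy]; first exact: polyf_const.
  by rewrite /cone big1 ?addr0 // => j _; rewrite hy.
pose jm := Ordinal md.
have vanish a F : (forall mu, supp mu -> F mu = 0) -> forall mu, supp mu -> iter a (fdiff (beta jm)) F mu = 0.
  move=> hF; elim: a => //= a IHa mu smu; rewrite /fdiff !IHa ?subrr //.
  exact: beta_supp.
have /boolp.choice [P hP] : forall a, exists P, polyf P /\ forall y : 'I_d -> nat,
    (forall j : 'I_d, (m <= j)%N -> y j = 0%N) ->
    P (cone lam y) = iter a (fdiff (beta jm)) r (cone lam y).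
  move=> a; have [|P hP PE] := IH (ltnW md) (iter a (fdiff (beta jm)) r); last by exists P.
  by move=> j mu smu; rewrite fdiff_iterC; apply: vanish => // nu; apply: hr.
(* The coordinate along [beta jm] relative to [lam], equal to [y jm] on the cone; subtracting
   [L mu *: beta jm] sets that coordinate to zero. *)
pose L mu := (mu (dual jm) : k) - (lam (dual jm) : k).
have hL : polyf L.
  by apply: polyf_sub; [apply: polyf_ev | apply: polyf_const].
exists (fun mu => \sum_(a < N) ((-1) ^+ a * (bin_poly k a).[L mu] * P a (mu - L mu *: beta jm))).
  apply: polyf_sum => a; apply: polyf_mul.
    by apply: polyf_mul; [apply: polyf_const | apply: polyf_horner].
  apply: polyf_comp; last by have [] := hP a.
  move=> u; have -> : (fun mu => (mu - L mu *: beta jm)%R u : k) = (fun mu => (mu u : k) - L mu * (beta jm u : k)).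
    by apply/funext => mu; rewrite add_lfunE opp_lfunE scale_lfunE.
  apply: polyf_sub; first exact: polyf_ev.
  by apply: polyf_mul => //; apply: polyf_const.
move=> y hy; pose y0 j := if j == jm then 0%N else y j.
have coneE : cone lam y = cone lam y0 + beta jm *+ y jm.
  rewrite /cone (bigD1 jm) //= [in RHS](bigD1 jm) //= /y0 eqxx mulr0n add0r.
  rewrite [_ *+ y jm + _]addrC addrA; congr (_ + _ + _).
  by apply: eq_bigr => j /negPf ->.
have Ly : L (cone lam y) = (y jm)%:R.
  rewrite /L /cone add_lfunE addrAC subrr add0r sum_lfunE (bigD1 jm) //= lfun_mulrn dualE eqxx.
  rewrite big1 ?addr0 // => j jj; rewrite lfun_mulrn dualE (negPf jj).
  exact: mul0rn.
have scone z : supp (cone lam z).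
  have add j mu a : supp mu -> supp (mu + beta j *+ a).
    by move=> smu; elim: a => [|a IHa]; rewrite ?addr0 // mulrSr addrA; apply: beta_supp.
  rewrite /cone; elim/big_rec: _ => [|j x _ sx]; first by rewrite addr0.
  by rewrite addrCA addrC; apply: add.
rewrite [in RHS]coneE (@newton k W (beta jm) r _ (y jm) (maxn (y jm).+1 N)); last by rewrite leq_maxl.
have term (a : nat) : (N <= a)%N -> (-1) ^+ a * 'C(y jm, a)%:R * iter a (fdiff (beta jm)) r (cone lam y0) = 0.
  move=> Na; rewrite -(subnK Na) iterD vanish ?mulr0 // => mu; exact: hr.
rewrite (big_ord_widen (maxn (y jm).+1 N) (fun a => (-1) ^+ a * (bin_poly k a).[L (cone lam y)] * P a (cone lam y - L (cone lam y) *: beta jm))); last by rewrite leq_maxr.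
rewrite big_mkcond; apply: eq_bigr => a _; case: ltnP => [_|/term -> //].
rewrite Ly bin_polyE // scaler_nat coneE addrK.
have [_ ->] // := hP a; move=> j mj; rewrite /y0; case: eqP => // jj.
by apply: hy; rewrite ltn_neqAle mj andbT; apply/eqP => e; apply: jj; exact/val_inj.
Qed.
End PolynomialFunctions.

(** * Completely pointed modules *)

Lemma weight_free_family (k : fieldType) (g : lieVectType k) (H : {vspace g}) (M : lieModule g)
    (J : eqType) (s : seq J) (wt : J -> 'Hom(subvs_of H, k^o)) (v : J -> M) :
  uniq s -> {in s &, injective wt} -> (forall j, weight_vector (@lact k g M) (wt j) (v j)) ->
  \sum_(j <- s) v j = 0 -> forall j, j \in s -> v j = 0.
Proof.
move=> s_uniq wt_inj hv s0 j js.
pose v' mu := \sum_(i <- s | wt i == mu) v i.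
have v'E i : i \in s -> v' (wt i) = v i.
  move=> is_; rewrite /v' big_mkcond (bigD1_seq i) //= eqxx big_seq_cond big1 ?addr0 // => i' /andP[i's i'i].
  by case: eqP => // /wt_inj e; rewrite e ?eqxx in i'i.
rewrite -v'E //; apply: (weight_free (s := [seq wt i | i <- s])).
- by rewrite map_inj_in_uniq.
- move=> mu; rewrite /v'; elim/big_rec: _ => [|i y /eqP <- hy]; first exact: wv_0.
  by apply: wv_D => //; apply: hv.
- by rewrite big_map big_seq -[RHS]s0 [RHS]big_seq; apply: eq_bigr => i /v'E.
- exact: map_f.
Qed.

Lemma weight_occurs (k : fieldType) (g : lieVectType k) (H : {vspace g}) (M : lieModule g)
    (J : eqType) (s : seq J) (wt : J -> 'Hom(subvs_of H, k^o)) (v : J -> M) mu m :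
  (forall j, weight_vector (@lact k g M) (wt j) (v j)) -> weight_vector (@lact k g M) mu m ->
  m <> 0 -> m = \sum_(j <- s) v j -> exists j, [/\ j \in s, wt j = mu & v j <> 0].
Proof.
move=> hv hm m0 mE.
have [s' [s'u mus ws]] : exists s', [/\ uniq s', mu \in s' & forall j, j \in s -> wt j \in s'].
  exists (undup (mu :: [seq wt j | j <- s])); rewrite undup_uniq !mem_undup mem_head.
  by split=> // j js; rewrite mem_undup inE map_f ?orbT.
pose v' nu := \sum_(j <- s | wt j == nu) v j - (if nu == mu then m else 0).
have hv' nu : weight_vector (@lact k g M) nu (v' nu).
  rewrite /v' addrC -scaleN1r; apply: wv_lin; first by case: eqP => [->//|_]; apply: wv_0.
  by elim/big_rec: _ => [|j y /eqP <- hy]; [apply: wv_0 | apply: wv_D].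
have : v' mu = 0.
  apply: (weight_free s'u hv' _ mus).
  rewrite sumrB (exchange_big_dep predT) //=; apply/eqP; rewrite subr_eq0; apply/eqP.
  rewrite [RHS](bigD1_seq mu) //= eqxx [X in _ = _ + X]big1 ?addr0; last by move=> nu /negPf ->.
  rewrite mE [LHS]big_seq [RHS]big_seq; apply: eq_bigr => j js.
  rewrite big_mkcond (bigD1_seq (wt j)) ?ws //=.
  by rewrite eqxx big1 ?addr0 // => d; rewrite eq_sym => /negPf ->.
rewrite /v' eqxx => /eqP; rewrite subr_eq0 => /eqP e; apply: contrapT => no; apply: m0.
rewrite -e big_seq_cond big1 // => j /andP[js /eqP jmu].
by apply: contrapT => vj; apply: no; exists j.
Qed.

Lemma chevalley_swap (k : fieldType) (g : lieVectType k) (H : {vspace g})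
    (gamma : 'Hom(subvs_of H, k^o)) x y : chevalley_pair gamma x y -> chevalley_pair (- gamma) y x.
Proof.
move=> [hx hy [u uE u2]]; split; rewrite ?opprK //.
by exists (- u); rewrite ?linearN /= ?uE -?lieC // opp_lfunE linearN opprK.
Qed.

Lemma chevalley_sl2 (k : fieldType) (g : lieVectType k) (H : {vspace g})
    (gamma : 'Hom(subvs_of H, k^o)) x y (u : subvs_of H) : chevalley_pair gamma x y ->
  vsval u = lie x y -> [/\ gamma u = 2%:R, lie x y = vsval u,
    lie (vsval u) x = 2%:R *: x & lie (vsval u) y = - (2%:R *: y)].
Proof.
move=> [hx hy [u' u'E u2]] uE; have uu' : u' = u by apply: val_inj; rewrite /= -[val u']/(vsval u') u'E uE.
rewrite uu' in u2; split=> //; first by rewrite hx u2.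
by rewrite hy opp_lfunE u2 scaleNr.
Qed.

(** * Local nilpotency of root vectors *)

Section Nilpotency.
Variables (k : fieldType) (k_char0 : [pchar k] =i pred0).
Variables (g : lieVectType k) (H : {vspace g}).
Local Notation W := 'Hom(subvs_of H, k^o).
Local Notation gwv := (weight_vector (H := H) (@lie k g)).
Hypothesis g_weight : weight_module H (adjoint g).

Lemma mulrn_inj_char0 (gamma : W) : gamma <> 0 -> injective (fun j : nat => gamma *+ j).
Proof.
move=> g0 i j /eqP; rewrite -!scaler_nat -subr_eq0 -scalerBl scaler_eq0.
by case/orP => [|/eqP //]; rewrite subr_eq0 => /eqP /(natr_inj_char0 k_char0).
Qed.

Lemma wv_iter (M : lieModule g) (gamma mu : W) x (m : M) j :
  gwv gamma x -> weight_vector (@lact k g M) mu m ->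
  weight_vector (@lact k g M) (mu + gamma *+ j) (iter j (lact x) m).
Proof.
move=> hx hm; elim: j => [|j IH]; first by rewrite addr0.
by rewrite iterS mulrSr addrA; apply: wv_act.
Qed.

(** The iterates on a weight vector have distinct weights, so dim g + 1 of them cannot all be
    nonzero. *)
Lemma ad_nilpotent (gamma : W) x : gwv gamma x -> gamma <> 0 ->
  forall y, iter (\dim {:g}) (lie x) y = 0.
Proof.
move=> hx g0 y; have [s [v [_ hv ->]]] := weight_decomp g_weight y.
have itL N : linear (iter N (lie x)).
  by elim: N => [|N IH] a u w //=; rewrite IH lieDr lieZr.
rewrite (lin_sum (itL _)) big1 // => mu _; apply: contrapT => ne.
pose N := \dim {:g}; pose X := [tuple iter (i : 'I_N.+1) (lie x) (v mu) | i < N.+1].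
have ne' j : (j <= N)%N -> iter j (lie x) (v mu) <> 0.
  move=> jN e; apply: ne; rewrite -/N -(subnK jN) iterD e.
  exact: (lin_0 (itL _)).
have : free X.
  apply/freeP => c c0 i.
  have := @weight_free_family k g H (adjoint g) _ (index_enum 'I_N.+1)
    (fun j => mu + gamma *+ j) (fun j => c j *: iter j (lie x) (v mu)).
  move=> /(_ (index_enum_uniq _)) W1.
  have /eqP : c i *: iter i (lie x) (v mu) = 0.
    apply: W1; last by rewrite mem_index_enum.
    - by move=> j j' _ _ /addrI /(mulrn_inj_char0 g0) /val_inj.
    - by move=> j; apply/wv_Z/(@wv_iter (adjoint g)).
    - by rewrite -[RHS]c0; apply: eq_bigr => j _; rewrite -tnth_nth tnth_mktuple.
  by rewrite scaler_eq0 => /orP[/eqP //|/eqP /ne']; case; rewrite -ltnS.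
move=> fX; have := dimvS (subvf <<X>>%VS); rewrite (eqP fX) size_tuple.
by rewrite ltnn.
Qed.

Variable (M : lieModule g) (M_simple : simple_module M).

(** As ad x is nilpotent, the vectors killed by some power of [x] form a submodule of the simple
    module [M]. *)
Lemma injective_or_nilpotent (gamma : W) x : gwv gamma x -> gamma <> 0 ->
  (forall m : M, lact x m = 0 -> m = 0) \/ (forall m : M, exists p, iter p (lact x) m = 0).
Proof.
move=> hx g0; pose N (m : M) := exists p, iter p (lact x) m = 0.
have itL p : linear (iter p (@lact k g M x)).
  by elim: p => [|p IH] a u w //=; rewrite IH lactDr lactZr.
have mono p q (m : M) : (p <= q)%N -> iter p (lact x) m = 0 -> iter q (lact x) m = 0.
  by move=> pq e; rewrite -(subnK pq) iterD e (lin_0 (itL _)).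
have NL a (m n : M) : N m -> N n -> N (a *: m + n).
  move=> [p pm] [q qn]; exists (p + q)%N; rewrite (itL _).
  by rewrite (mono p) ?leq_addr // (mono q) ?leq_addl // scaler0 addr0.
have Nx m : N (lact x m) -> N m by move=> [p pm]; exists p.+1; rewrite iterSr.
(* Double induction, on the order of (ad x)-nilpotency of y and on that of x at m, through x y m =
   [x, y] m + y x m. *)
have Ny q : forall y, iter q (lie x) y = 0 -> forall m, N m -> N (lact y m).
  elim: q => [|q IH] y; first by move=> /= -> m _; exists 0%N; rewrite lact0l.
  rewrite iterSr => /IH Nxy m [p]; elim: p m => [|p IHp] m pm.
    by exists 0%N; rewrite /= in pm *; rewrite pm lact0r.
  apply: Nx; rewrite lactC -[lact (lie x y) m]scale1r; apply: NL.
    by apply: Nxy; exists p.+1.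
  by apply: IHp; rewrite -iterSr.
have [_ /(_ N)] := M_simple; case=> //.
- by exists 0%N.
- by move=> y m; apply: Ny (ad_nilpotent hx g0 y) m.
- by move=> Ntriv; left=> m xm; apply: Ntriv; exists 1%N.
- by move=> Nall; right.
Qed.
End Nilpotency.

(** * Lattices spanned by families of functionals *)

Section Lattice.
Variables (k : fieldType) (vT : vectType k).
Local Notation W := 'Hom(vT, k^o).

Lemma separating_free_dim d (beta : 'I_d -> W) :
  (forall c : 'I_d -> k, \sum_i c i *: beta i = 0 -> forall i, c i = 0) ->
  (forall u, (forall j, beta j u = 0) -> u = 0) -> d = \dim {:vT}.
Proof.
move=> bI bS; have [u hu] := dual_family bI.
have ev i (c : 'I_d -> k) : beta i (\sum_j c j *: u j) = c i.
  rewrite linear_sum (bigD1 i) //= linearZ /= hu eqxx big1 ?addr0; first exact: mulr1.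
  by move=> j ji; rewrite linearZ /= hu eq_sym (negPf ji) scaler0.
suff bX : basis_of {:vT} [tuple u i | i < d] by rewrite -(size_basis bX).
rewrite basisEdim; apply/andP; split.
- apply/subvP => v _; have -> : v = \sum_j (beta j v : k) *: u j.
    by apply/eqP; rewrite -subr_eq0; apply/eqP/bS => i; rewrite linearB /= ev subrr.
  apply: memv_suml => j _; apply/memvZ/memv_span.
  by apply/mapP; exists j; rewrite ?mem_enum.
- rewrite size_tuple; have fX : free [tuple u i | i < d].
    apply/freeP => c c0 i; rewrite -(ev i c) -[RHS](linear0 (beta i)); congr (beta i _).
    by rewrite -[RHS]c0; apply: eq_bigr => j _; rewrite -tnth_nth tnth_mktuple.
  by have := dimvS (subvf <<[tuple u i | i < d]>>%VS); rewrite (eqP fX) size_tuple.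
Qed.

(* Cramer's rule over the integers: the multiplier is the square of the determinant of the base change. *)
Lemma lattice_multiple n d (alpha : 'I_n -> W) (beta : 'I_d -> W) (B : 'I_d -> 'I_n -> int)
    (c : 'I_n -> int) (gamma : W) :
  (forall c : 'I_n -> k, \sum_i c i *: alpha i = 0 -> forall i, c i = 0) ->
  (forall u, (forall j, alpha j u = 0) -> u = 0) ->
  (forall c : 'I_d -> k, \sum_i c i *: beta i = 0 -> forall i, c i = 0) ->
  (forall u, (forall j, beta j u = 0) -> u = 0) ->
  (forall j, beta j = \sum_i alpha i *~ B j i) -> gamma = \sum_i alpha i *~ c i ->
  exists m : nat, (0 < m)%N /\ exists z : 'I_d -> int, gamma *+ m = \sum_j beta j *~ z j.
Proof.
move=> aI aS bI bS bE gE.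
have dn : d = n by rewrite (separating_free_dim bI bS) (separating_free_dim aI aS).
subst d; pose A := \matrix_(i, j) B i j.
have detA : \det A != 0.
  apply/negP => /eqP dA; have : \det (map_mx (intr : int -> k) A) == 0 by rewrite det_map_mx dA.
  case/det0P => v v0 vA; case/negP: v0; apply/eqP/rowP => j; rewrite mxE.
  apply: (bI (fun j => v 0 j)).
  under eq_bigr => i _ do rewrite bE scaler_sumr.
  rewrite exchange_big big1 // => i _.
  have := congr1 (fun X : 'rV_n => X 0 i) vA; rewrite !mxE => e.
  transitivity ((\sum_l v 0 l * (B l i)%:~R) *: alpha i).
    by rewrite scaler_suml; apply: eq_bigr => l _; rewrite -scaler_int scalerA.
  suff -> : \sum_l v 0 l * (B l i)%:~R = 0 by rewrite scale0r.
  by rewrite -[RHS]e; apply: eq_bigr => l _; rewrite !mxE.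
pose D := \det A; pose cr := \row_i c i; pose z := cr *m \adj A.
exists (`|D| * `|D|)%N; split; first by rewrite muln_gt0 absz_gt0 detA.
exists (fun j => z 0 j * D).
have zA i : \sum_j z 0 j * B j i = c i * D.
  have e : z *m A = D *: cr by rewrite /z -mulmxA mul_adj_mx mul_mx_scalar.
  have := congr1 (fun X : 'rV_n => X 0 i) e.
  rewrite [in X in X = _]mxE [in X in _ = X]mxE [cr _ _]mxE mulrC => <-.
  by apply: eq_bigr => j _; rewrite [A _ _]mxE.
have -> : gamma *+ (`|D| * `|D|) = gamma *~ (D * D).
  by rewrite pmulrn PoszM; congr (_ *~ _); lia.
rewrite gE mulrz_suml; under [RHS]eq_bigr => j _ do rewrite bE mulrz_suml.
rewrite exchange_big; apply: eq_bigr => i _; rewrite -mulrzA.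
under [RHS]eq_bigr => j _ do rewrite -mulrzA.
rewrite -mulrz_sumr; congr (_ *~ _).
by rewrite mulrA -zA mulr_suml; apply: eq_bigr => j _; ring.
Qed.
End Lattice.

(** * Weights of a simple completely pointed module *)

Section Pointed.
Variables (k : fieldType) (k_char0 : [pchar k] =i pred0).
Variables (g : lieVectType k) (g_simple : simple_lie g) (H : {vspace g}) (kappa : inv_form g).
Local Notation W := 'Hom(subvs_of H, k^o).
Local Notation gwv := (weight_vector (H := H) (@lie k g)).
Hypothesis g_weight : weight_module H (adjoint g).
Hypothesis H_weight0 : forall x : g, gwv 0 x <-> x \in H.
Variables (M : lieModule g) (M_simple : simple_module M) (M_weight : weight_module H M).
Local Notation wv := (weight_vector (H := H) (@lact k g M)).
Variable mv : W -> M.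
Implicit Types (mu gamma beta eta delta : W).
Hypothesis mv_wv : forall mu, wv mu (mv mu).
Hypothesis mv_span : forall mu m, wv mu m -> exists a : k, m = a *: mv mu.

Local Notation nilp x := (forall m : M, exists p, iter p (lact x) m = 0).
Local Notation inj x := (forall m : M, lact x m = 0 -> m = 0).
Local Notation supp mu := (mv mu <> 0).

Lemma wv_mv mu m : wv mu m -> m <> 0 -> exists2 a : k, a != 0 & m = a *: mv mu.
Proof.
move=> hm m0; have [a e] := mv_span hm; exists a => //.
by apply/eqP => a0; apply: m0; rewrite e a0 scale0r.
Qed.
Lemma wv_supp mu m : wv mu m -> m <> 0 -> supp mu.
Proof. by move=> hm m0 mv0; have [a _ e] := wv_mv hm m0; rewrite e mv0 scaler0 in m0. Qed.

Lemma supp_iter gamma mu x j : gwv gamma x -> iter j (lact x) (mv mu) <> 0 -> supp (mu + gamma *+ j).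
Proof. by move=> hx; apply: wv_supp; apply: wv_iter. Qed.

Lemma supp_exists : exists mu, supp mu.
Proof.
have [[m m0] _] := M_simple; have [s [v [_ hv e]]] := weight_decomp M_weight m.
apply: contrapT => no; apply: m0; rewrite e big1 // => mu _.
have [//|/eqP v0] := eqVneq (v mu) 0.
by case: no; exists mu; apply: wv_supp v0; apply: hv.
Qed.

(** The vectors supported on weights satisfying [Q] form a nonzero submodule, since root vectors
    move a weight by a root. *)
Lemma supp_connected (Q : W -> Prop) mu0 : supp mu0 -> Q mu0 ->
  (forall mu gamma, supp mu -> Q mu -> Defs.root gamma -> supp (mu + gamma) -> Q (mu + gamma)) ->
  forall mu, supp mu -> Q mu.
Proof.
move=> s0 Q0 Qstep.
pose N m := exists s : seq (W * k), m = \sum_(p <- s) p.2 *: mv p.1 /\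
  forall p, p \in s -> supp p.1 /\ Q p.1.
have NL (a : k) (x y : M) : N x -> N y -> N (a *: x + y).
  move=> [s [-> hs]] [s' [-> hs']]; exists ([seq (p.1, a * p.2) | p <- s] ++ s'); split.
    by rewrite big_cat big_map scaler_sumr; congr (_ + _); apply: eq_bigr => p _; rewrite scalerA.
  by move=> p; rewrite mem_cat => /orP[/mapP[q /hs hq ->]|/hs'].
have N0 : N 0 by exists [::]; rewrite big_nil.
have Nmv (a : k) mu : supp mu -> Q mu -> N (a *: mv mu).
  by move=> sm Qm; exists [:: (mu, a)]; rewrite big_seq1; split=> // p; rewrite inE => /eqP ->.
have Nact x m : N m -> N (lact x m).
  move=> [s [-> hs]]; rewrite lact_sumr big_seq; elim/big_rec: _ => // p y ps Ny.
  have [sp Qp] := hs p ps; rewrite -[lact x _]scale1r; apply: (NL) => // {Ny y}.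
  rewrite lactZr; have [s' [v [_ hv ->]]] := weight_decomp g_weight x.
  rewrite lact_suml scaler_sumr; elim/big_rec: _ => // gamma y _ Ny.
  rewrite -[_ *: lact _ _]scale1r; apply: (NL) => // {Ny y}.
  have hw := wv_act (hv gamma) (mv_wv p.1).
  have [->|/eqP ne] := eqVneq (lact (v gamma) (mv p.1)) 0; first by rewrite scaler0.
  have sp' := wv_supp hw ne; have [b _ ->] := wv_mv hw ne; rewrite scalerA.
  have [g0|/eqP g0] := eqVneq gamma 0; first by rewrite g0 addr0; apply: Nmv.
  apply: Nmv => //; apply: Qstep => //; apply: (root_of (hv gamma)) => // v0.
  by apply: ne; rewrite v0 lact0l.
have [_ /(_ N N0 NL Nact)] := M_simple; case=> [Ntriv|Nall mu smu].
  by exfalso; apply: (s0); apply: Ntriv; rewrite -[mv mu0]scale1r; apply: Nmv.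
have [s [e hs]] := Nall (mv mu).
have [p [ps <- _]] := weight_occurs (fun p => wv_Z p.2 (mv_wv p.1)) (mv_wv mu) smu e.
by have [] := hs p ps.
Qed.

(** If q steps up reach the top of the string, whose eigenvalue is P, then mu(u) = P - 2q. Since
    weight spaces are at most lines, q of the P nonzero steps down lead back to a multiple of
    [mv mu], and P - 2q of them remain. *)
Lemma string_reflect_down gamma x y (u : subvs_of H) mu : chevalley_pair gamma x y -> vsval u = lie x y ->
  nilp x -> nilp y -> supp mu ->
  exists2 z : int, mu u = z%:~R & forall n : nat, z = n -> iter n (lact y) (mv mu) <> 0.
Proof.
move=> cp uE nx ny smu; have [g2 xy ux uy] := chevalley_sl2 cp uE; have [hx hy _] := cp.
have [q [qv0 qv1]] := sl2_top smu (nx (mv mu)).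
have hv : lact (vsval u) (mv mu) = (mu u : k) *: mv mu by apply: mv_wv.
have := sl2_h_e_iter ux q hv => hw.
have [P [PE Pj]] := sl2_finite k_char0 xy uy qv0 qv1 hw (ny _).
exists (P%:Z - q%:Z * 2%:Z).
  by rewrite rmorphB rmorphM /= -!pmulrn -PE addrK.
move=> n /eqP; rewrite subr_eq => /eqP Pn.
have {}Pn : P = (n + q + q)%N by lia.
have hwt := wv_iter q (hx) (mv_wv mu).
have hback := wv_iter q hy hwt.
have e0 : mu + gamma *+ q + (- gamma) *+ q = mu by rewrite mulNrn addrK.
rewrite e0 in hback.
have [|a a0 ae] := wv_mv hback; first by apply: Pj; lia.
move=> n0; apply: (Pj (n + q)%N); first by lia.
rewrite iterD ae.
have itL : linear (iter n (@lact k g M y)).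
  by elim: (n) => [|p IH] b w w' //=; rewrite IH lactDr lactZr.
by rewrite (lin_Z itL) n0 scaler0.
Qed.

Lemma string_reflect gamma x y (u : subvs_of H) mu : chevalley_pair gamma x y -> vsval u = lie x y ->
  nilp x -> nilp y -> supp mu ->
  exists z : int, [/\ mu u = z%:~R,
    forall n : nat, z = n -> iter n (lact y) (mv mu) <> 0,
    forall n : nat, z = - n%:Z -> iter n (lact x) (mv mu) <> 0 &
    supp (mu - gamma *~ z)].
Proof.
move=> cp uE nx ny smu; have [z zE zP] := string_reflect_down cp uE nx ny smu.
have uE' : vsval (- u) = lie y x by rewrite linearN /= uE -lieC.
have [z' z'E z'P] := string_reflect_down (chevalley_swap cp) uE' ny nx smu.
have zz' : z' = - z.
  by apply: (intr_inj_char0 k_char0); rewrite -z'E linearN /= zE rmorphN.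
have hx : forall n : nat, z = - n%:Z -> iter n (lact x) (mv mu) <> 0.
  by move=> n e; apply: z'P; rewrite zz' e opprK.
exists z; split=> //; have [cx cy _] := cp.
case: (intP z) => [|n|n] in zP hx *.
- by rewrite mulr0z subr0.
- have := supp_iter cy (zP n.+1 erefl); rewrite mulNrn pmulrn.
  by [].
- have := supp_iter cx (hx n.+1 erefl); rewrite pmulrn mulrNz opprK.
  by [].
Qed.

(* Otherwise the Casimir operator takes the same value at infinitely many highest vectors of one string. *)
Lemma no_ray beta x y mu : chevalley_pair beta x y -> nilp x -> inj y \/ nilp y ->
  (forall j : nat, supp (mu + beta *+ j)) -> False.
Proof.
move=> cp nx ynp ray; have [hx hy [u uE _]] := cp.
have [b2 xy ux uy] := chevalley_sl2 cp uE.
(* From the j-th weight of the ray, far enough out, j steps down reach a nonzero multiple of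
   [mv mu]. In the nilpotent case this holds because mu(u) + 2j is at least j as soon as j exceeds
   the absolute value of mu(u). *)
have [j0 hj0] : exists j0, forall j, (j0 <= j)%N -> iter j (lact y) (mv (mu + beta *+ j)) <> 0.
  case: ynp => [iy|ny].
    exists 0%N => j _; suff : forall n m, m <> 0 -> iter n (@lact k g M y) m <> 0 by apply.
    by elim=> // n IH m m0 /= /iy; apply: IH.
  have [z0 [z0E _ _ _]] := string_reflect cp uE nx ny (ray 0%N).
  exists `|z0|%N => j jz; have [z [zE zP _ _]] := string_reflect cp uE nx ny (ray j).
  have zz : z = z0 + j%:Z * 2%:Z.
    apply: (intr_inj_char0 k_char0); rewrite -zE add_lfunE lfun_mulrn b2 rmorphD rmorphM /= -z0E.
    by rewrite addr0 -!pmulrn mulr_natl.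
  have [n zn] : exists n : nat, z = n by exists `|z|%N; lia.
  have jn : (j <= n)%N by lia.
  move=> e; apply: (zP n zn); rewrite -(subnK jn) iterD e.
  have itL q : linear (iter q (@lact k g M y)).
    by elim: q => [|p IH] b w w' //=; rewrite IH lactDr lactZr.
  exact: (lin_0 (itL _)).
have smu : supp mu by have := ray 0%N; rewrite addr0.
have tv nu : exists t : k, lact y (lact x (mv nu)) = t *: mv nu.
  apply: mv_span; have := wv_act hy (wv_act hx (mv_wv nu)).
  by rewrite addrK.
have [t0 t0E] := tv mu; pose c := (mu u : k); pose C := 4%:R * t0 + c * (c + 2%:R).
have cas0 : casimir_eq x y (vsval u) C c (mv mu) by split; [exact: mv_wv | exists t0].
have key j : (j0 <= j)%N -> exists q : nat, C = (c + (j + q)%:R * 2%:R) * (c + (j + q)%:R * 2%:R + 2%:R).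
  move=> /hj0 hj; have [t tE] := tv (mu + beta *+ j).
  pose cj := c + j%:R * 2%:R.
  have hcj : lact (vsval u) (mv (mu + beta *+ j)) = cj *: mv (mu + beta *+ j).
    rewrite mv_wv add_lfunE lfun_mulrn b2 /cj; congr (_ *: _).
    by rewrite mulr_natl.
  have casj : casimir_eq x y (vsval u) (4%:R * t + cj * (cj + 2%:R)) cj (mv (mu + beta *+ j)).
    by split=> //; exists t.
  have := casimir_f_iter xy uy j casj.
  have hback := wv_iter j hy (mv_wv (mu + beta *+ j)).
  rewrite mulNrn addrK in hback.
  have [a a0 ->] := wv_mv hback hj => cas1.
  have CE := casimir_uniq smu a0 cas0 cas1.
  have [q [qv0 qv1]] := sl2_top (ray j) (nx _).
  exists q; have := casimir_top qv0 qv1 (casimir_e_iter xy ux q casj).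
  by rewrite CE => ->; rewrite /cj natrD; congr (_ * _); ring.
(* The quadratic expression (c + 2y)(c + 2y + 2) takes a value at most twice, so three highest
   vectors at distinct places are contradictory. *)
have [q1 e1] := key j0 (leqnn _); pose y1 := (j0 + q1)%N.
have [|q2 e2] := key y1.+1; first by rewrite /y1; lia.
pose y2 := (y1.+1 + q2)%N.
have [|q3 e3] := key y2.+1; first by rewrite /y2 /y1; lia.
pose y3 := (y2.+1 + q3)%N.
have pairE (a b : nat) : a <> b -> C = (c + a%:R * 2%:R) * (c + a%:R * 2%:R + 2%:R) ->
    C = (c + b%:R * 2%:R) * (c + b%:R * 2%:R + 2%:R) -> c + a%:R + b%:R + 1 = 0.
  move=> ab ea eb; have : (a%:R - b%:R) * (4%:R * (c + a%:R + b%:R + 1)) = 0.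
    rewrite -[RHS](subrr C) {1}ea eb; ring.
  move/eqP; rewrite !mulf_eq0 subr_eq0 natr_eq0_char0 //= => /orP[/eqP /(natr_inj_char0 k_char0)//|/eqP //].
have E12 := pairE y1 y2 _ e1 e2; have E13 := pairE y1 y3 _ e1 e3.
have y23 : y2 <> y3 by rewrite /y3; lia.
apply: y23; apply: (natr_inj_char0 k_char0).
apply: (addrI (c + y1%:R)); apply: (addIr 1).
by rewrite E12 ?E13 // /y3 /y2; lia.
Qed.

(** Weight spaces of g are not known to be lines, so [string_reflect] does not apply to the adjoint
    representation. Instead the string is followed q steps up to its top and then q + n steps down,
    which its length n + 2q permits. *)
Lemma root_reflect gamma x y (u : subvs_of H) beta v (b : int) : chevalley_pair gamma x y ->
  vsval u = lie x y -> gwv beta v -> v <> 0 -> beta u = b%:~R ->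
  exists2 w, w <> 0 & gwv (beta - gamma *~ b) w.
Proof.
have pos gamma' x' y' (u' : subvs_of H) (n : nat) : chevalley_pair gamma' x' y' ->
    vsval u' = lie x' y' -> gwv beta v -> v <> 0 -> beta u' = n%:R ->
    exists2 w, w <> 0 & gwv (beta - gamma' *+ n) w.
  move=> cp uE hv v0 bu; have [hx hy _] := cp; have [g2 xy ux uy] := chevalley_sl2 cp uE.
  have g0 : gamma' <> 0.
    move=> g0; move: g2; rewrite g0 zero_lfunE => /esym/eqP.
    by rewrite natr_eq0_char0.
  have g0' : - gamma' <> 0 by move=> e; apply: g0; rewrite -[gamma']opprK e oppr0.
  have nx w : exists p, iter p (@lact k g (adjoint g) x') w = 0.
    by exists (\dim {:g}); apply: (ad_nilpotent k_char0 g_weight hx).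
  have ny w : exists p, iter p (@lact k g (adjoint g) y') w = 0.
    by exists (\dim {:g}); apply: (ad_nilpotent k_char0 g_weight hy).
  have [q [qv0 qv1]] := sl2_top (M := adjoint g) v0 (nx v).
  have hv' : @lact k g (adjoint g) (vsval u') v = (n%:R : k) *: v by rewrite -bu; apply: hv.
  have hw := sl2_h_e_iter (M := adjoint g) ux q hv'.
  have [P [PE Pj]] := sl2_finite k_char0 (M := adjoint g) xy uy qv0 qv1 hw (ny _).
  have {}PE : (n + q * 2)%N = P by apply: (natr_inj_char0 k_char0); rewrite natrD natrM.
  exists (iter (q + n) (lie y') (iter q (lie x') v)); first by apply: Pj; lia.
  have := wv_iter (q + n) hy (@wv_iter _ _ _ (adjoint g) _ _ _ _ q hx hv).
  by rewrite mulNrn mulrnDr opprD addrA addrK.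
move=> cp uE hv v0 bu; case: (intP b) bu => [|n|n] bu.
- by exists v => //; rewrite mulr0z subr0.
- by have := pos _ _ _ _ n.+1 cp uE hv v0 bu.
have := pos _ _ _ (- u) n.+1 (chevalley_swap cp) _ hv v0 _.
rewrite mulNrn opprK; apply.
  by rewrite linearN /= uE -lieC.
by rewrite linearN /= bu mulrNz opprK.
Qed.

Definition injective_root gamma := gamma <> 0 /\ exists2 x, gwv gamma x & inj x.

Lemma injective_root_is_root gamma : injective_root gamma -> Defs.root gamma.
Proof.
move=> [g0 [x hx ix]]; apply: (root_of hx) => // x0.
by have [mu] := supp_exists; apply; apply: ix; rewrite x0 lact0l.
Qed.

Lemma injective_root_supp gamma mu j : injective_root gamma -> supp mu -> supp (mu + gamma *+ j).
Proof.
move=> [_ [x hx ix]] smu; apply: (supp_iter hx).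
by elim: j => // j IH /= /ix.
Qed.

Lemma not_injective_root_nilp gamma x : ~ injective_root gamma -> gwv gamma x -> gamma <> 0 -> nilp x.
Proof.
move=> ng hx g0; case: (injective_or_nilpotent k_char0 g_weight M_simple hx g0) => // ix.
by case: ng; split=> //; exists x.
Qed.

Lemma injective_root_span : exists X : seq W, (forall beta, beta \in X -> injective_root beta) /\
  forall beta, injective_root beta -> beta \in <<X>>%VS.
Proof.
pose Q m := `[< exists2 X : seq W, \dim <<X>> = m & forall beta, beta \in X -> injective_root beta >].
have Q0 : exists m, Q m.
  by exists (\dim <<[::] : seq W>>); apply/asboolP; exists [::].
have Qmax m : Q m -> (m <= \dim {:W})%N by case/asboolP => X <- _; apply/dimvS/subvf.
case: (ex_maxnP Q0 Qmax) => m /asboolP[X dX hX] mmax.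
exists X; split=> // beta hb; apply: contraT => bX.
have : (\dim <<beta :: X>> <= m)%N.
  apply: mmax; apply/asboolP; exists (beta :: X) => // b.
  by rewrite inE => /orP[/eqP ->|/hX].
have sub : (<<X>> <= <<beta :: X>>)%VS by rewrite span_cons addvSr.
rewrite -dX => le; have [_] := dimv_leqif_sup sub.
by rewrite eqn_leq le dimvS //= span_cons subv_add -memvE (negPf bX).
Qed.

Lemma span_vanish (X : seq W) (u : subvs_of H) beta : beta \in <<X>>%VS ->
  (forall b, b \in X -> b u = 0) -> beta u = 0.
Proof.
rewrite -(in_tupleE X) => /coord_span -> hX; rewrite sum_lfunE big1 // => i _.
by rewrite scale_lfunE hX ?scaler0 //; apply: mem_nth.
Qed.

(** Otherwise the root vectors whose roots lie outside the span would commute with those whose roots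
    lie in it. The centralizer of the latter would then be a nonzero ideal, hence all of g, which is
    absurd for an sl2-triple of an injective root. *)
Lemma injective_roots_separate (X : seq W) : (forall beta, beta \in X -> injective_root beta) ->
  (forall beta, injective_root beta -> beta \in <<X>>%VS) -> (exists beta, injective_root beta) ->
  forall gamma, Defs.root gamma -> gamma \in <<X>>%VS.
Proof.
move=> XG GX [beta0 gb0] gamma [gm0 [x x0 hx]]; apply: contraT => gX.
(* If the coroot of eta were nonzero on an injective root beta, reflecting the weights la + j beta
   in eta would give a ray in the direction beta', the reflection of beta. But beta' is a root
   outside the span, so its root vectors are locally nilpotent, contrary to [no_ray]. *)
have step1 eta z w (t : subvs_of H) : eta \notin <<X>>%VS -> chevalley_pair eta z w ->
    vsval t = lie z w -> forall beta, beta \in <<X>>%VS -> beta t = 0.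
  move=> eX cp tE beta bX; apply: (span_vanish bX) => {bX}beta /XG gb; apply: contrapT => bt.
  have [hz hw _] := cp; have e0 : eta <> 0 by move=> e0; rewrite e0 mem0v in eX.
  have ng : ~ injective_root eta by move=> /GX; rewrite (negPf eX).
  have ng' : ~ injective_root (- eta) by move=> /GX; rewrite rpredN (negPf eX).
  have e0' : - eta <> 0 by move=> e; apply: e0; rewrite -[eta]opprK e oppr0.
  have nz := not_injective_root_nilp ng hz e0; have nw := not_injective_root_nilp ng' hw e0'.
  have [la sla] := supp_exists.
  have [z0 [z0E _ _ s0]] := string_reflect cp tE nz nw sla.
  have [z1 [z1E _ _ _]] := string_reflect cp tE nz nw (injective_root_supp (j := 1%N) gb sla).
  pose b := z1 - z0.
  have bE : beta t = b%:~R.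
    by rewrite /b rmorphB /= -z1E -z0E add_lfunE mulr1n addrAC subrr add0r.
  have b0 : b <> 0 by move=> b0; apply: bt; rewrite bE b0.
  pose beta' := beta - eta *~ b.
  have b'X : beta' \notin <<X>>%VS.
    rewrite rpredBl; last exact: GX.
    apply/negP => h; case/negP: eX.
    have -> : eta = (b%:~R)^-1 *: (eta *~ b).
      rewrite -scaler_int scalerA mulVf ?scale1r // intr_eq0_char0 //; exact/eqP.
    exact: memvZ.
  have b'0 : beta' <> 0 by move=> b'0; rewrite b'0 mem0v in b'X.
  have [_ [v v0 hv]] := injective_root_is_root gb.
  have [v' v'0 hv'] := root_reflect cp tE hv v0 bE.
  have [f' cp'] := root_triple k_char0 g_simple kappa g_weight H_weight0 hv' v'0 b'0.
  have [_ hf' _] := cp'.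
  have n' : nilp v' by apply: (not_injective_root_nilp _ hv' b'0) => /GX; rewrite (negPf b'X).
  have b'0' : - beta' <> 0 by move=> e; apply: b'0; rewrite -[beta']opprK e oppr0.
  apply: (@no_ray beta' v' f' (la - eta *~ z0) cp' n').
    exact: (injective_or_nilpotent k_char0 g_weight M_simple hf' b'0').
  move=> j; have [zj [zjE _ _]] := string_reflect cp tE nz nw (injective_root_supp (j := j) gb sla).
  have -> : zj = z0 + b * j.
    apply: (intr_inj_char0 k_char0); rewrite -zjE add_lfunE lfun_mulrn rmorphD rmorphM /= -z0E bE.
    by rewrite -pmulrn mulr_natr.
  have -> // : la + beta *+ j - eta *~ (z0 + b * j) = la - eta *~ z0 + beta' *+ j.
  rewrite mulrzDr opprD addrACA; congr (_ + _).
  by rewrite /beta' mulrnBl mulrzA pmulrn.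
have triple eta z : gwv eta z -> z <> 0 -> eta <> 0 -> exists w (t : subvs_of H),
    [/\ chevalley_pair eta z w, vsval t = lie z w, eta t = 2%:R &
      exists2 c : k, c <> 0 & forall u : subvs_of H, kappa (vsval t) (vsval u) = (eta u : k) * c].
  move=> hz z0 e0; have [w cp] := root_triple k_char0 g_simple kappa g_weight H_weight0 hz z0 e0.
  have [_ hw [t tE t2]] := cp; exists w, t; split=> //.
  apply: (coroot_form kappa g_weight H_weight0 hz hw tE).
  by rewrite t2; apply/eqP; rewrite natr_eq0_char0.
(* If the bracket were nonzero, eta + delta would be a root outside the span. By [step1] and the
   symmetry of kappa, both eta and eta + delta vanish on the coroot of delta, and so would delta,
   whose value there is 2. *)
have step2 eta delta z w : eta \notin <<X>>%VS -> delta \in <<X>>%VS -> delta <> 0 ->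
    gwv eta z -> gwv delta w -> lie z w = 0.
  move=> eX dX d0 hz hw; apply: contrapT => zw0.
  have z0 : z <> 0 by move=> z0; rewrite z0 lie0l in zw0.
  have w0 : w <> 0 by move=> w0; rewrite w0 lie0r in zw0.
  have e0 : eta <> 0 by move=> e0; rewrite e0 mem0v in eX.
  have sX : eta + delta \notin <<X>>%VS by rewrite rpredDr.
  have s0 : eta + delta <> 0 by move=> s0; rewrite s0 mem0v in sX.
  have [z' [t1 [cp1 t1E t12 [c1 c10 k1]]]] := triple _ _ hz z0 e0.
  have [w' [t2 [cp2 t2E t22 [c2 c20 k2]]]] := triple _ _ hw w0 d0.
  have [v' [t3 [cp3 t3E t32 [c3 c30 k3]]]] := triple _ _ (gwv_lie hz hw) zw0 s0.
  have d1 := step1 _ _ _ _ eX cp1 t1E _ dX; have d3 := step1 _ _ _ _ sX cp3 t3E _ dX.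
  have z1 : (eta t2 : k) = 0.
    have := k1 t2; rewrite iform_sym k2 d1 mul0r => /esym/eqP.
    by rewrite mulf_eq0 => /orP[/eqP //|/eqP].
  have z3 : ((eta + delta)%R t2 : k) = 0.
    have := k3 t2; rewrite iform_sym k2 d3 mul0r => /esym/eqP.
    by rewrite mulf_eq0 => /orP[/eqP //|/eqP].
  move: z3; rewrite add_lfunE z1 add0r t22 => /eqP.
  by rewrite natr_eq0_char0.
pose C z := forall delta w, delta \in <<X>>%VS -> delta <> 0 -> gwv delta w -> lie z w = 0.
have CL a y z : C y -> C z -> C (a *: y + z).
  by move=> Cy Cz d w dX d0 hw; rewrite lieDl lieZl (Cy d w) // (Cz d w) // scaler0 addr0.
have C0 : C 0 by move=> d w _ _ _; rewrite lie0l.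
have CI z y : C y -> C (lie z y).
  move=> Cy; have [s [v [_ hv ->]]] := weight_decomp g_weight z.
  rewrite (lin_sum (lie_linearl y)); elim/big_rec: _ => // mu w _ Cw.
  rewrite -[lie _ _]scale1r; apply: CL => // {Cw w} d w dX d0 hw.
  rewrite adjoint_subproof (Cy d w) // lie0r sub0r.
  have [mu0|/eqP mu0] := eqVneq mu 0.
    have /H_weight0 vH : gwv 0 (v mu) by rewrite -mu0; apply: hv.
    by rewrite (hw (Subvs vH)) lieZr (Cy d w) // scaler0 oppr0.
  have [muX|muX] := boolP (mu \in <<X>>%VS).
    by rewrite lie_derivation (Cy mu (v mu)) // (Cy d w) // lie0l lie0r addr0 oppr0.
  by rewrite (step2 mu d (v mu) w) // lie0r oppr0.
have [Ctriv|Call] := simple_lie_ideal g_simple C0 CL CI.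
  case: x0; apply: Ctriv => d w dX d0 hw; exact: (step2 gamma d).
have [b0 [v v0 hv]] := injective_root_is_root gb0.
have [w [t [cp tE t2 _]]] := triple _ _ hv v0 b0.
have : lie w v = 0 by apply: (Call w beta0) => //; apply: GX.
rewrite lieC -tE => /eqP; rewrite oppr_eq0 => /eqP t0.
have {}t0 : t = 0 by apply: val_inj; rewrite /= -[val t]/(vsval t) t0.
move: t2; rewrite t0 linear0 => /esym/eqP.
by rewrite natr_eq0_char0.
Qed.

Lemma injective_root_basis : (exists beta, injective_root beta) -> exists d (beta : 'I_d -> W),
  [/\ forall j, injective_root (beta j),
      forall c : 'I_d -> k, \sum_i c i *: beta i = 0 -> forall i, c i = 0 &
      forall u, (forall j, beta j u = 0) -> u = 0].
Proof.
move=> gex; have [X [XG GX]] := injective_root_span; have [X' [fX' sX' spX']] := span_free_subseq X.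
exists (size X'), (fun i => X'`_i); split=> [j|c c0|u hu].
- by apply/XG/sX'/mem_nth.
- by have /freeP : free (in_tuple X') := fX'; apply.
apply: (roots_separate g_simple g_weight) => gamma hg.
apply: (@span_vanish X'); first by rewrite spX'; apply: injective_roots_separate.
by move=> b /(nthP 0)[i iX <-]; apply: (hu (Ordinal iX)).
Qed.

(** * Spanning by ordered monomials *)

Section Words.
Variables (N : nat) (X : N.-tuple g) (m0 : M).
Hypothesis X_full : <<X>>%VS = fullv.
Definition word_act (w : seq 'I_N) : M := foldr (fun (i : 'I_N) m => lact X`_i m) m0 w.
Definition word_span (Q : seq 'I_N -> Prop) (m : M) : Prop :=
  exists s : seq (k * seq 'I_N), m = \sum_(p <- s) p.1 *: word_act p.2 /\ forall p, p \in s -> Q p.2.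

Lemma word_spanL Q a x y : word_span Q x -> word_span Q y -> word_span Q (a *: x + y).
Proof.
move=> [s [-> hs]] [s' [-> hs']]; exists ([seq (a * p.1, p.2) | p <- s] ++ s'); split.
  by rewrite big_cat big_map scaler_sumr; congr (_ + _); apply: eq_bigr => p _; rewrite scalerA.
by move=> p; rewrite mem_cat => /orP[/mapP[q /hs hq ->]|/hs'].
Qed.
Lemma word_span0 Q : word_span Q 0.
Proof. by exists [::]; rewrite big_nil. Qed.
Lemma word_span_word (Q : seq 'I_N -> Prop) w : Q w -> word_span Q (word_act w).
Proof.
by exists [:: (1, w)]; rewrite big_seq1 scale1r; split=> // p; rewrite inE => /eqP ->.
Qed.
Lemma word_spanD Q x y : word_span Q x -> word_span Q y -> word_span Q (x + y).
Proof. by move=> hx hy; rewrite -[x]scale1r; apply: word_spanL. Qed.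

Lemma word_span_act (Q Q' : seq 'I_N -> Prop) x m : (forall i w, Q w -> Q' (i :: w)) ->
  word_span Q m -> word_span Q' (lact x m).
Proof.
move=> QQ' [s [-> hs]]; rewrite lact_sumr big_seq; elim/big_rec: _ => [|p y ps hy].
  exact: word_span0.
rewrite lactZr; apply: word_spanL => // {hy y}.
have xX : x \in <<X>>%VS by rewrite X_full memvf.
rewrite (coord_span xX) lact_suml; elim/big_rec: _ => [|i y _ hy]; first exact: word_span0.
rewrite lactZl; apply: word_spanL => //.
by apply: (@word_span_word _ (i :: p.2)); apply/QQ'/hs.
Qed.

Definition ordered (w : seq 'I_N) := sorted (fun i j : 'I_N => i <= j)%N w.

(** Exchanging two neighbouring letters costs their bracket, which is a combination of letters and
    thus gives shorter words; insertion sort works modulo those. *)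
Lemma word_insert i w : ordered w -> exists w', [/\ ordered w', perm_eq w' (i :: w) &
  word_span (fun v => size v < (size w).+1)%N (word_act (i :: w) - word_act w')].
Proof.
have leT : transitive (fun i j : 'I_N => (i <= j)%N) by move=> a b c; apply: leq_trans.
elim: w => [|j w IH] sw; first by exists [:: i]; rewrite subrr; split=> //; apply: word_span0.
have [ij|ji] := leqP i j.
  exists (i :: j :: w); rewrite subrr; split=> //; last exact: word_span0.
  by rewrite /ordered /= ij.
have [|w' [sw' pw' hw']] := IH; first by move: sw; rewrite /ordered; apply: path_sorted.
exists (j :: w'); split.
- rewrite /ordered /= path_min_sorted //; apply/allP => l.
  rewrite (perm_mem pw') inE => /orP[/eqP ->|lw]; first exact: ltnW.
  move: sw; rewrite /ordered /= => /(order_path_min leT).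
  by move=> /allP/(_ l lw).
- rewrite (perm_trans (y := j :: i :: w)) ?perm_cons //.
  by rewrite -(perm_cons j) in pw'; rewrite -[i :: j :: w]/([:: i] ++ [:: j] ++ w) perm_sym perm_catCA.
have -> : word_act (i :: j :: w) - word_act (j :: w') =
    lact (lie X`_i X`_j) (word_act w) + lact X`_j (word_act (i :: w) - word_act w').
  by rewrite /= lactC lactDr lactNr addrA.
apply: word_spanD.
  apply: (@word_span_act (fun v => size v < (size w).+1)%N) => [l v //|].
  exact: word_span_word.
by apply: (@word_span_act _ _ _ _ _ hw') => l v.
Qed.

Lemma word_sort w : exists w', [/\ ordered w', size w' = size w &
  word_span (fun v => size v < size w)%N (word_act w - word_act w')].
Proof.
elim: w => [|i w [w1 [sw1 z1 h1]]]; first by exists [::]; rewrite subrr; split=> //; apply: word_span0.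
have [w2 [sw2 pw2 h2]] := word_insert i sw1; exists w2; split=> //.
  by rewrite (perm_size pw2) /= z1.
have -> : word_act (i :: w) - word_act w2 =
    lact X`_i (word_act w - word_act w1) + (word_act (i :: w1) - word_act w2).
  by rewrite /= lactDr lactNr addrA subrK.
apply: word_spanD; last by rewrite /= -z1.
by apply: (@word_span_act _ _ _ _ _ h1) => l v.
Qed.

Lemma word_ordered w : word_span ordered (word_act w).
Proof.
have [d] := ubnP (size w); elim: d w => // d IH w wd.
have [w' [sw' zw' [s [e hs]]]] := word_sort w.
rewrite -[word_act w](subrK (word_act w')); apply: word_spanD; last exact: word_span_word.
rewrite e big_seq; elim/big_rec: _ => [|p y ps hy]; first exact: word_span0.
by apply: word_spanL => //; apply: IH; apply: leq_trans (hs p ps) _.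
Qed.
End Words.

(* Ordered monomials in locally nilpotent root vectors reach only finitely many weights. *)
Lemma supp_finite : (forall gamma, ~ injective_root gamma) -> exists S : seq W, forall mu, supp mu -> mu \in S.
Proof.
move=> ng; have [mu0 smu0] := supp_exists.
have [|X [bX hX]] := @special_basis k g fullv (fun y => exists gamma : W, gwv gamma y).
  move=> x _; have [s [v [_ hv xE]]] := weight_decomp g_weight x.
  exists [seq v mu | mu <- s]; split; first by rewrite big_map.
  by move=> _ /mapP[mu _ ->]; split; [apply: memvf | exists mu; apply: hv].
set N := \dim fullv in X bX hX *.
have Xfull : <<X>>%VS = fullv by apply: span_basis.
have /boolp.choice [ga hga] : forall i : 'I_N, exists gamma : W, gwv gamma X`_i.
  by move=> i; have [//|] := hX i; rewrite leqNgt ltn_ord.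
pose wt (w : seq 'I_N) := mu0 + \sum_(i <- w) ga i.
pose act := word_act X (mv mu0).
have act_wv w : wv (wt w) (act w).
  elim: w => [|i w IH]; first by rewrite /wt big_nil addr0.
  by rewrite /wt big_cons [ga i + _]addrC addrA; apply: wv_act.
have itL q x : linear (iter q (@lact k g M x)).
  by elim: q => [|p IH] b w w' //=; rewrite IH lactDr lactZr.
(* Induction on the set of allowed letters, from the last one downwards: an ordered word is a power
   of its smallest letter applied to a word in larger letters. The latter reaches finitely many
   weights, and at each of them the power is bounded, unless the letter has weight 0 and moves
   nothing. *)
have fin j : (j <= N)%N -> exists S : seq W, forall w, ordered w ->
    (forall i, i \in w -> j <= i)%N -> act w <> 0 -> wt w \in S.
  move=> jN; rewrite -(subKn jN); elim: (N - j)%N (leq_subr j N) => [|d IH] dN.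
    rewrite subn0; exists [:: mu0] => -[_ _ _|i w _ /(_ i)]; first by rewrite /wt big_nil addr0 inE.
    by rewrite inE eqxx => /(_ isT); rewrite leqNgt ltn_ord.
  have [S hS] := IH (ltnW dN).
  have lt : (N - d.+1 < N)%N by lia.
  pose i0 := Ordinal lt; pose gam := ga i0.
  have split_w w : ordered w -> (forall i, i \in w -> N - d.+1 <= i)%N -> exists a w',
      [/\ w = nseq a i0 ++ w', ordered w' & forall i, i \in w' -> (N - d <= i)%N].
    have leT : transitive (fun i j : 'I_N => (i <= j)%N) by move=> a b c; apply: leq_trans.
    elim: w => [|i w IHw] sw hw; first by exists 0%N, [::].
    have [|i' hi'|a [w' [wE sw' hw']]] := IHw.
    - by move: sw; rewrite /ordered; apply: path_sorted.
    - by apply: hw; rewrite inE hi' orbT.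
    have := hw i; rewrite inE eqxx => /(_ isT); rewrite leq_eqVlt => /orP[/eqP ii|ii].
      by exists a.+1, w'; split=> //=; rewrite -wE; congr (_ :: _); apply: val_inj.
    exists 0%N, (i :: w); split=> // i'; rewrite inE => /orP[/eqP ->|i'w]; first by lia.
    move: sw; rewrite /ordered /= => /(order_path_min leT).
    by move=> /allP/(_ i' i'w) /=; lia.
  have actE a w' : act (nseq a i0 ++ w') = iter a (lact X`_i0) (act w').
    by elim: a => //= a <-.
  have wtE a w' : wt (nseq a i0 ++ w') = wt w' + gam *+ a.
    rewrite /wt big_cat -[RHS]addrA; congr (_ + _); rewrite addrC; congr (_ + _).
    by elim: a => [|a IHa] /=; rewrite ?big_nil // big_cons IHa mulrS.
  have [g0|/eqP g0] := eqVneq gam 0.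
    exists S => w sw hw; have [a [w' [-> sw' hw']]] := split_w w sw hw.
    rewrite actE wtE g0 mul0rn addr0 => ne; apply: hS => // z.
    by apply: ne; rewrite z (lin_0 (itL _ _)).
  have nl := not_injective_root_nilp (ng gam) (hga i0) g0.
  have /boolp.choice [bd hbd] : forall mu, exists p, iter p (lact X`_i0) (mv mu) = 0.
    by move=> mu; apply: nl.
  exists [seq mu + gam *+ a | mu <- S, a <- iota 0 (bd mu)] => w sw hw.
  have [a [w' [-> sw' hw']]] := split_w w sw hw; rewrite actE wtE => ne.
  have ne' : act w' <> 0 by move=> z; apply: ne; rewrite z (lin_0 (itL _ _)).
  apply/allpairsPdep; exists (wt w'), a; split=> //; first exact: hS.
  rewrite mem_iota /= add0n ltnNge; apply/negP => le; apply: ne.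
  have [b _ ->] := wv_mv (act_wv w') ne'; rewrite (lin_Z (itL _ _)) -(subnK le) iterD hbd.
  by rewrite (lin_0 (itL _ _)) scaler0.
have [S hS] := fin 0%N (leq0n _); exists S => mu smu.
suff [s [e hs]] : word_span X (mv mu0) (fun w => ordered w) (mv mu).
  have [p [ps pmu]] := weight_occurs (fun p => wv_Z p.1 (act_wv p.2)) (mv_wv mu) smu e.
  by move=> pa; rewrite -pmu; apply: hS => // [|z]; [apply: hs | apply: pa; rewrite z scaler0].
have [_ /(_ (word_span X (mv mu0) (fun w => ordered w)))] := M_simple; case.
- exact: word_span0.
- by move=> a x y; apply: word_spanL.
- move=> x m hm; have : word_span X (mv mu0) (fun=> True) (lact x m).
    apply: (@word_span_act _ _ _ Xfull (fun=> True)) => //.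
    by case: hm => s [-> hs]; exists s.
  move=> [s [-> _]]; elim/big_rec: _ => [|p y _ hy]; first exact: word_span0.
  by apply: word_spanL => //; apply: (word_ordered _ Xfull).
- move=> triv; case: smu0; apply: triv.
  by apply: (@word_span_word _ _ _ _ [::]).
- by apply.
Qed.

Lemma iter_lact_linear q x : linear (iter q (@lact k g M x)).
Proof. by elim: q => [|p IH] b w w' //=; rewrite IH lactDr lactZr. Qed.

Lemma iter_neq0_le p q x (m : M) : (p <= q)%N -> iter q (lact x) m <> 0 -> iter p (lact x) m <> 0.
Proof.
by move=> pq ne e; apply: ne; rewrite -(subnK pq) iterD e (lin_0 (iter_lact_linear _ _)).
Qed.

Lemma inj_iter_neq0 x j (m : M) : inj x -> m <> 0 -> iter j (lact x) m <> 0.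
Proof. by move=> ix m0; elim: j => //= j IH /ix. Qed.

Variables (n : nat) (alpha : 'I_n -> W).
Hypothesis alpha_base : root_base alpha.

Lemma root_int gamma : Defs.root gamma -> exists c : 'I_n -> int, gamma = \sum_i alpha i *~ c i.
Proof.
have [_ _ h] := alpha_base; move=> /h[c [->|->]].
  by exists (fun i => (c i)%:Z); apply: eq_bigr => i _; rewrite pmulrn.
by exists (fun i => - (c i)%:Z); rewrite -sumrN; apply: eq_bigr => i _; rewrite mulrNz pmulrn.
Qed.

Lemma root_multiple d (beta : 'I_d -> W) gamma : (forall j, injective_root (beta j)) ->
  (forall c : 'I_d -> k, \sum_i c i *: beta i = 0 -> forall i, c i = 0) ->
  (forall u, (forall j, beta j u = 0) -> u = 0) -> Defs.root gamma ->
  exists m : nat, (0 < m)%N /\ exists z : 'I_d -> int, gamma *+ m = \sum_j beta j *~ z j.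
Proof.
move=> bG bI bS /root_int [c cE].
have /boolp.choice [B hB] : forall j, exists c : 'I_n -> int, beta j = \sum_i alpha i *~ c i.
  by move=> j; apply/root_int/injective_root_is_root.
apply: (lattice_multiple _ _ bI bS hB cE).
  by have [_ /free_enumP] := alpha_base.
exact: (roots_vanish g_simple g_weight alpha_base).
Qed.

(** * Gluing polynomials across cones *)

Section Gluing.
Variables (r : W -> k) (N : nat).
Hypothesis r_diff : forall gamma x, gwv gamma x -> gamma <> 0 -> forall mu,
  iter N (fdiff gamma) r mu *: iter N (lact x) (mv mu) = 0.

Lemma string_poly gamma x nu T : gwv gamma x -> gamma <> 0 -> iter T (lact x) (mv nu) <> 0 ->
  exists2 q : {poly k}, (size q <= N)%N & forall j, (j <= T)%N -> r (nu + gamma *+ j) = q.[j%:R].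
Proof.
move=> hx g0 Tnu; apply: newton_poly => // j jT.
have := r_diff hx g0 (nu + gamma *+ j) => /eqP; rewrite scaler_eq0 => /orP[/eqP //|/eqP e].
have jnu : iter j (lact x) (mv nu) <> 0 by apply: iter_neq0_le Tnu; lia.
have [a _ aE] := wv_mv (wv_iter j hx (mv_wv nu)) jnu.
case: (@iter_neq0_le (N + j) T x (mv nu) _ Tnu); first by lia.
by rewrite iterD aE (lin_Z (iter_lact_linear _ _)) e scaler0.
Qed.

Variables (d : nat) (beta : 'I_d -> W) (dual : 'I_d -> subvs_of H).
Hypothesis beta_inj : forall j, injective_root (beta j).
Hypothesis beta_sep : forall u, (forall j, beta j u = 0) -> u = 0.
Hypothesis dualE : forall i j, beta i (dual j) = (i == j)%:R.

Lemma beta_supp1 j mu : supp mu -> supp (mu + beta j).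
Proof. by move=> smu; have := injective_root_supp (j := 1%N) (beta_inj j) smu. Qed.

Lemma cone_supp lam y : supp lam -> supp (cone beta lam y).
Proof.
move=> slam; rewrite /cone; elim/big_rec: _ => [|j x _ sx]; first by rewrite addr0.
by rewrite addrCA addrC; apply: injective_root_supp.
Qed.

Lemma r_diff_beta j mu : supp mu -> iter N (fdiff (beta j)) r mu = 0.
Proof.
move=> smu; have [b0 [x hx ix]] := beta_inj j.
have /eqP := r_diff hx b0 mu; rewrite scaler_eq0 => /orP[/eqP //|/eqP].
by move/(inj_iter_neq0 ix smu).
Qed.

Lemma poly_on_cone lam : supp lam ->
  exists2 P, polyf P & forall y, P (cone beta lam y) = r (cone beta lam y).
Proof.
apply: (cone_poly k_char0 dualE beta_supp1 (N := N)) => j mu; exact: r_diff_beta.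
Qed.

Lemma cone_cone lam y z : cone beta (cone beta lam y) z = cone beta lam (fun j => y j + z j)%N.
Proof.
rewrite /cone -addrA -big_split; congr (_ + _); apply: eq_bigr => j _ /=.
by rewrite mulrnDr.
Qed.

Lemma cone0 lam : cone beta lam (fun=> 0%N) = lam.
Proof. by rewrite /cone big1 ?addr0. Qed.

(** Two cones with apexes in the same coset of the lattice spanned by the [beta j] share a cone, on
    which the two polynomials agree; by density they agree everywhere. *)
Lemma coset_poly P lam nu (z : 'I_d -> int) : polyf P -> supp nu ->
  (forall y, P (cone beta lam y) = r (cone beta lam y)) -> nu = lam + \sum_j beta j *~ z j ->
  P nu = r nu.
Proof.
move=> hP snu Pr nuE; have [P' hP' P'r] := poly_on_cone snu.
have Q0 : forall mu, P mu - P' mu = 0.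
  (* Shifting [nu] by the absolute values of the [z j] makes its coordinates relative to [lam]
     nonnegative, so this cone lies in both. *)
  apply: (cone_dense k_char0 beta_sep dualE (lam := cone beta nu (fun j => `|z j|%N))).
    exact: polyf_sub.
  move=> y; rewrite cone_cone P'r.
  have -> : cone beta nu (fun j => `|z j| + y j)%N = cone beta lam (fun j => absz ((z j + (absz (z j))%:Z + (y j)%:Z)%R)).
    rewrite /cone nuE -addrA -big_split; congr (_ + _); apply: eq_bigr => j _ /=.
    by rewrite !pmulrn -mulrzDr; congr (_ *~ _); lia.
  by rewrite Pr subrr.
have := Q0 nu; move/eqP; rewrite subr_eq0 => /eqP ->.
by have := P'r (fun=> 0%N); rewrite cone0.
Qed.

(** On a long gamma-string both [r] and [P] are polynomial of bounded degree, and they agree at the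
    points differing from nu by multiples of m gamma, which lie in the coset of [lam]. With enough
    such points they agree on the whole string. *)
Lemma string_extend P lam gamma m (z : 'I_d -> int) : polyf P ->
  (forall y, P (cone beta lam y) = r (cone beta lam y)) ->
  (0 < m)%N -> gamma *+ m = \sum_j beta j *~ z j -> gamma <> 0 ->
  exists T, forall y, let nu := cone beta lam y in
   (exists2 x, gwv gamma x & iter T (lact x) (mv nu) <> 0) \/
   (exists2 x, gwv (- gamma) x & iter T (lact x) (mv (nu + gamma)) <> 0) ->
   P (nu + gamma) = r (nu + gamma).
Proof.
move=> hP Pr m0 mE g0; have [D hD] := polyf_line hP; pose B := maxn N D.
have g0' : - gamma <> 0 by move=> e; apply: g0; rewrite -[gamma]opprK e oppr0.
have coset nu (i : int) y : nu = cone beta lam y + gamma *~ (m%:Z * i) -> supp nu -> P nu = r nu.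
  move=> nuE snu; apply: (@coset_poly P lam nu (fun j => (y j)%:Z + z j * i)) => //.
  rewrite nuE /cone mulrzA -pmulrn mE mulrz_suml -addrA -big_split; congr (_ + _).
  by apply: eq_bigr => j _ /=; rewrite pmulrn mulrzDr mulrzA.
(* [B] common points are needed, one in every m steps. On the string descending from nu + gamma they
   occur at the steps m i + 1, whence the additional 1. *)
exists (m * B + 1)%N => y nu [[x hx Tx]|[x hx Tx]].
  have [q1 q1N q1E] := string_poly hx g0 Tx.
  have [q2 q2D q2E] := hD nu gamma.
  have sj j : (j <= m * B + 1)%N -> supp (nu + gamma *+ j).
    by move=> jT; apply: (supp_iter hx); apply: iter_neq0_le Tx.
  have q12 : q1 = q2.
    apply: (@poly_nat_eq k k_char0 q1 q2 B (fun i => m * i)%N).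
    - by move=> i j /eqP; rewrite eqn_pmul2l // => /eqP.
    - by rewrite (leq_trans q1N) ?leq_maxl.
    - by rewrite (leq_trans q2D) ?leq_maxr.
    move=> i iB; have le : (m * i <= m * B + 1)%N by nia.
    rewrite -q1E // -q2E scaler_nat; apply/esym; apply: (@coset _ i y); last exact: sj.
    by rewrite pmulrn PoszM.
  have := q1E 1%N; rewrite q12 -q2E scale1r mulr1n => ->; rewrite ?addn1 //.
have [q1 q1N q1E] := string_poly hx g0' Tx.
have [q2 q2D q2E] := hD (nu + gamma) (- gamma).
have sj j : (j <= m * B + 1)%N -> supp (nu + gamma + (- gamma) *+ j).
  by move=> jT; apply: (supp_iter hx); apply: iter_neq0_le Tx.
have q12 : q1 = q2.
  apply: (@poly_nat_eq k k_char0 q1 q2 B (fun i => m * i + 1)%N).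
  - by move=> i j /addIn /eqP; rewrite eqn_pmul2l // => /eqP.
  - by rewrite (leq_trans q1N) ?leq_maxl.
  - by rewrite (leq_trans q2D) ?leq_maxr.
  move=> i iB; have le : (m * i + 1 <= m * B + 1)%N by nia.
  rewrite -q1E // -q2E scaler_nat; apply/esym; apply: (@coset _ (- i%:Z) y); last exact: sj.
  by rewrite addn1 mulrS addrA addrK mulNrn mulrN mulrNz -PoszM -pmulrn.
by have := q1E 0%N isT; rewrite q12 -q2E scale0r mulr0n addr0.
Qed.

(** The coroot of gamma is nonzero on some [beta j], so its value on mu + i beta_j is an integer
    tending to plus or minus infinity with i. The sign of beta_j on the coroot decides whether
    gamma-strings become long downwards or upwards; if gamma or its opposite is injective, all
    strings in that direction are infinite. *)
Lemma long_along gamma T : Defs.root gamma -> exists j : 'I_d, forall mu, supp mu -> supp (mu + gamma) ->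
  exists x0, forall i, (x0 <= i)%N -> let nu := mu + beta j *+ i in
   (exists2 x, gwv gamma x & iter T (lact x) (mv nu) <> 0) \/
   (exists2 x, gwv (- gamma) x & iter T (lact x) (mv (nu + gamma)) <> 0).
Proof.
move=> [g0 [x x0 hx]].
have [y cp] := root_triple k_char0 g_simple kappa g_weight H_weight0 hx x0 g0.
have [_ hy [u uE u2]] := cp.
have g0' : - gamma <> 0 by move=> e; apply: g0; rewrite -[gamma]opprK e oppr0.
have [j bj] : exists j, beta j u <> 0.
  apply: contrapT => no; have u0 : u = 0.
    by apply: beta_sep => j; apply: contrapT => bj; apply: no; exists j.
  move: u2; rewrite u0 linear0 => /esym/eqP.
  by rewrite natr_eq0_char0.
exists j => mu smu smug.
have sb i : supp (mu + beta j *+ i) by apply: injective_root_supp.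
have sbg i : supp (mu + beta j *+ i + gamma) by rewrite addrAC; apply: injective_root_supp.
have [gg|ng] := pselect (injective_root gamma).
  exists 0%N => i _; left; case: gg => _ [x' hx' ix']; exists x' => //.
  exact: inj_iter_neq0.
have [gg|ng'] := pselect (injective_root (- gamma)).
  exists 0%N => i _; right; case: gg => _ [x' hx' ix']; exists x' => //.
  exact: inj_iter_neq0.
have nx := not_injective_root_nilp ng hx g0; have ny := not_injective_root_nilp ng' hy g0'.
have [z0 [z0E _ _ _]] := string_reflect cp uE nx ny smu.
have [z1 [z1E _ _ _]] := string_reflect cp uE nx ny (sb 1%N).
pose b := z1 - z0.
have bE : beta j u = b%:~R.
  by rewrite /b rmorphB /= -z1E -z0E add_lfunE mulr1n addrAC subrr add0r.
have b0 : b <> 0 by move=> b0; apply: bj; rewrite bE b0.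
exists (`|z0| + T)%N => i hi nu.
have [z [zE _ zx _]] := string_reflect cp uE nx ny (sb i).
have [z' [z'E zy _ _]] := string_reflect cp uE nx ny (sbg i).
have zi : z = z0 + b * i.
  apply: (intr_inj_char0 k_char0); rewrite -zE add_lfunE lfun_mulrn rmorphD rmorphM /= -z0E bE.
  by rewrite -pmulrn mulr_natr.
have z'i : z' = z + 2%:Z.
  by apply: (intr_inj_char0 k_char0); rewrite -z'E add_lfunE u2 rmorphD /= -zE.
have [bp|bn] : (0 < b) \/ (b < 0) by lia.
  right; exists y => //; have [q zq] : exists q : nat, z' = q by exists `|z'|%N; nia.
  by apply: (@iter_neq0_le T q); [nia | apply: zy].
left; exists x => //; have [q zq] : exists q : nat, z = - q%:Z by exists `|z|%N; nia.
by apply: (@iter_neq0_le T q); [nia | apply: zx].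
Qed.

Hypothesis beta_free : forall c : 'I_d -> k, \sum_i c i *: beta i = 0 -> forall i, c i = 0.

(** The property of agreeing with one fixed polynomial on the cone of a weight is propagated from
    weight to neighbouring weight by [supp_connected]. *)
Lemma poly_glue : exists2 P, polyf P & forall mu, supp mu -> P mu = r mu.
Proof.
have [lam0 slam0] := supp_exists; have [P hP Pr0] := poly_on_cone slam0.
exists P => //.
suff G : forall mu, supp mu -> forall y, P (cone beta mu y) = r (cone beta mu y).
  by move=> mu smu; have := G mu smu (fun=> 0%N); rewrite cone0.
apply: (supp_connected slam0) => // lam gamma slam Pr hg slamg.
have [g0 _] := hg.
have [m [m0 [z mE]]] := root_multiple beta_inj beta_free beta_sep hg.
have [T hT] := string_extend hP Pr m0 mE g0.
have [j hj] := long_along T hg.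
have [P' hP' P'r] := poly_on_cone slamg.
have coneD y : cone beta (lam + gamma) y = cone beta lam y + gamma by rewrite /cone addrAC.
(* [P] and the polynomial [P'] of the new cone agree far out in the direction [beta j], where
   [string_extend] applies; restricted to a line in this direction their difference thus has too
   many zeros. *)
pose Q mu := P (mu + gamma) - P' (mu + gamma).
have hQ : polyf Q by apply: polyf_sub; apply: polyf_shift.
have Q0 : forall mu, Q mu = 0.
  apply: (cone_dense k_char0 beta_sep dualE (lam := lam) hQ) => y.
  pose mu := cone beta lam y; have smu : supp mu by apply: cone_supp.
  have smug : supp (mu + gamma) by rewrite -coneD; apply: cone_supp.
  have [x0 hx0] := hj mu smu smug; have [D hD] := polyf_line hQ.
  have [q qD qE] := hD mu (beta j).
  suff q0 : q = 0 by have := qE 0; rewrite q0 scale0r addr0 horner0.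
  apply: (@poly_nat_eq k k_char0 q 0 D (fun i => x0 + i)%N) => // [a b /addnI //| |i _].
    by rewrite size_poly0.
  rewrite horner0 -qE scaler_nat.
  pose y' l := (y l + (if l == j then x0 + i else 0))%N.
  have e : mu + beta j *+ (x0 + i) = cone beta lam y'.
    rewrite /mu /cone -addrA; congr (_ + _).
    rewrite /y'; under [RHS]eq_bigr => l _ do rewrite mulrnDr.
    rewrite big_split /=; congr (_ + _); rewrite (bigD1 j) //= eqxx big1 ?addr0 // => l /negPf ->.
    by rewrite mulr0n.
  have := hx0 (x0 + i)%N (leq_addr _ _); rewrite /= e => /hT ePr.
  by rewrite /Q ePr -coneD P'r subrr.
move=> y; rewrite -P'r; have := Q0 (cone beta lam y); rewrite /Q -coneD => /eqP.
by rewrite subr_eq0 => /eqP.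
Qed.
End Gluing.

Definition adop (x : g) (P : M -> M) : M -> M := fun m => lact x (P m) - P (lact x m).

Lemma adop_iter_linear x P j : linear P -> linear (iter j (adop x) P).
Proof.
move=> Pl; elim: j => //= j IH a u v; rewrite /adop IH !lactDr !lactZr IH.
by rewrite scalerBr opprD addrACA.
Qed.

(** This turns differences of eigenvalues into iterated commutators, which can be controlled by the
    nilpotency of ad x. *)
Lemma adop_iter_diag gamma x P (r : W -> k) j mu : gwv gamma x -> linear P ->
  (forall nu, P (mv nu) = r nu *: mv nu) ->
  iter j (adop x) P (mv mu) = iter j (fdiff gamma) r mu *: iter j (lact x) (mv mu).
Proof.
move=> hx Pl hP; elim: j mu => //= j IH mu; rewrite /adop IH lactZr /fdiff scalerBl; congr (_ - _).
have [a aE] := mv_span (wv_act hx (mv_wv mu)).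
rewrite aE (lin_Z (adop_iter_linear _ _ Pl)) IH scalerA mulrC -scalerA; congr (_ *: _).
by rewrite -(lin_Z (iter_lact_linear _ _)) -aE -iterS iterSr.
Qed.

Lemma adop_product x y z j : exists s : seq (nat * nat),
  (forall m : M, iter j (adop x) (fun m => lact y (lact z m)) m =
    \sum_(p <- s) lact (iter p.1 (lie x) y) (lact (iter p.2 (lie x) z) m)) /\
  forall p, p \in s -> (p.1 + p.2)%N = j.
Proof.
elim: j => [|j [s [e hs]]].
  by exists [:: (0, 0)%N]; split=> [m|p]; rewrite ?big_seq1 // inE => /eqP ->.
exists (flatten [seq [:: (p.1.+1, p.2); (p.1, p.2.+1)] | p <- s]); split.
  move=> m; rewrite /= /adop !e lact_sumr -sumrB big_flatten big_map; apply: eq_bigr => p _.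
  rewrite big_cons big_seq1 /= lactC -addrA; congr (_ + _).
  by rewrite -(lin_B (lact_linearr _)) -lact_lie.
by move=> q /flattenP[_ /mapP[p /hs ps ->]]; rewrite !inE => /orP[] /eqP -> /=; rewrite ?addSn ?addnS ps.
Qed.

(** By the Leibniz rule each term of the 2N-fold commutator with [x] applies ad x at least N = dim g
    times to [y] or to [z], and this is zero. *)
Lemma product_diff y z (r : W -> k) :
  (forall mu, lact y (lact z (mv mu)) = r mu *: mv mu) ->
  forall gamma x, gwv gamma x -> gamma <> 0 -> forall mu,
  iter (\dim {:g} + \dim {:g}) (fdiff gamma) r mu *:
  iter (\dim {:g} + \dim {:g}) (lact x) (mv mu) = 0.
Proof.
move=> hr gamma x hx g0 mu; set N := \dim {:g}.
have Pl : linear (fun m : M => lact y (lact z m)) by move=> a u v; rewrite !lactDr !lactZr.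
rewrite -(adop_iter_diag _ _ hx Pl hr).
have [s [-> hs]] := adop_product x y z (N + N); rewrite big_seq big1 // => p /hs pE.
have nil q w : (N <= q)%N -> iter q (lie x) w = 0.
  move=> Nq; rewrite -(subnKC Nq) iterD; exact: (ad_nilpotent k_char0 g_weight hx g0).
have [le|lt] := leqP N p.1; first by rewrite nil // lact0l.
by rewrite [iter p.2 _ _]nil ?lact0l ?lact0r //; lia.
Qed.

Theorem product_polynomial y z (r : W -> k) : (exists beta, injective_root beta) ->
  (forall mu, lact y (lact z (mv mu)) = r mu *: mv mu) ->
  exists2 P, polyf P & forall mu, supp mu -> P mu = r mu.
Proof.
move=> gex hr; have [d [beta [bG bI bS]]] := injective_root_basis gex.
have [u hu] := dual_family bI.
exact: (poly_glue (product_diff hr) bG bS hu bI).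
Qed.

(** If mu and mu + gamma are weights, so are their translates by a cone of injective roots. The case
    gamma = 0 gives density of the weights; the other values serve for identities along edges. *)
Theorem supp_dense P : (exists beta, injective_root beta) -> polyf P -> forall gamma,
  (exists2 mu, supp mu & supp (mu + gamma)) ->
  (forall mu, supp mu -> supp (mu + gamma) -> P mu = 0) -> forall mu, P mu = 0.
Proof.
move=> gex hP gamma [lam sl slg] P0; have [d [beta [bG bI bS]]] := injective_root_basis gex.
have [u hu] := dual_family bI.
apply: (cone_dense k_char0 bS hu (lam := lam) hP) => y; apply: P0; first exact: cone_supp.
have -> : cone beta lam y + gamma = cone beta (lam + gamma) y by rewrite /cone addrAC.
exact: cone_supp.
Qed.
End Pointed.

(** * The loop module *)

Section LoopModule.
Variables (k : fieldType) (g : lieVectType k) (kappa : inv_form g) (M : lieModule g).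
Local Notation V := (loop_module kappa M).

Lemma loop_act_mono x a (m : M) b :
  lact (l := V) (aff_loop kappa (lmono x a)) (lmono m b) = lmono (lact x m) (a + b).
Proof.
rewrite /= /loop_act /= scale0r addr0.
exact/lconv_mono/lact_linearr/lact_linearl.
Qed.

Lemma loop_act_degree (m : M) b :
  lact (l := V) ((0, 0, 1) : affine kappa) (lmono m b) = b%:~R *: lmono m b.
Proof.
rewrite /= /loop_act /= scale1r lderiv_mono -scaler_int lmonoZ.
rewrite (lin_0 (lconv_linearl (@lact_linearl k g M) (@lact_linearr k g M) _)) add0r.
by [].
Qed.

Lemma affine_decomp (u : affine kappa) : exists c : k,
  (forall v : V, lact u v = lact (aff_loop kappa u.1.1) v + c *: lact ((0, 0, 1) : affine kappa) v).
Proof.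
exists u.2 => v; rewrite /= /loop_act /= scale0r addr0 scale1r.
by rewrite (lin_0 (lconv_linearl (@lact_linearl k g M) (@lact_linearr k g M) _)) add0r.
Qed.

End LoopModule.

(** * The lattice basis of the loop module and the homomorphism *)

Section Assembly.
Variables (k : fieldType) (k_char0 : [pchar k] =i pred0).
Variables (g : lieVectType k) (g_simple : simple_lie g) (H : {vspace g}) (kappa : inv_form g).
Local Notation W := 'Hom(subvs_of H, k^o).
Local Notation gwv := (weight_vector (H := H) (@lie k g)).
Variables (M : lieModule g) (M_simple : simple_module M) (M_weight : weight_module H M).
Local Notation wv := (weight_vector (H := H) (@lact k g M)).
Variable mv : W -> M.
Hypothesis mv_wv : forall mu, wv mu (mv mu).
Hypothesis mv_span : forall mu m, wv mu m -> exists a : k, m = a *: mv mu.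
Variables (n : nat) (e f : 'I_n -> g) (alpha : 'I_n -> W) (e0 f0 : g) (alpha0 : W).
Hypothesis alpha_base : root_base alpha.
Hypothesis ef_pair : forall i, chevalley_pair (alpha i) (e i) (f i).
Hypothesis ef0_pair : chevalley_pair alpha0 e0 f0.
Hypothesis ef0_comm : forall i, lie (f i) e0 = 0 /\ lie (e i) f0 = 0.
Variable lam0 : W.
Hypothesis lam0_supp : mv lam0 <> 0.
Hypothesis supp_lattice : forall mu, mv mu <> 0 ->
  exists c : 'I_n -> int, mu = lam0 + \sum_i alpha i *~ c i.
(** Generation rests on the weight decomposition of g, obtained from the faithfulness of [M]; hence
    a trivial [M] is a separate alternative. *)
Hypothesis triv_or_generated : (forall (x : g) (m : M), lact x m = 0) \/
  ((exists (x : g) (m : M), lact x m <> 0) /\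
   forall P : g -> Prop, (forall a x y, P x -> P y -> P (a *: x + y)) ->
     (forall x y, P x -> P y -> P (lie x y)) -> (forall u, u \in H -> P u) ->
     (forall i, P (e i)) -> (forall i, P (f i)) -> forall x, P x).

Local Notation I := 'I_n.+1.
Local Notation L := {ffun I -> int}.
Local Notation V := (loop_module kappa M).
Local Notation supp mu := (mv mu <> 0).

Definition aff_root (i : I) : W := if unlift ord0 i is Some j then alpha j else alpha0.
Definition serre_e (i : I) : g := if unlift ord0 i is Some j then e j else e0.
Definition serre_f (i : I) : g := if unlift ord0 i is Some j then f j else f0.
Definition aff_level (i : I) : int := (i == ord0)%:Z.
Definition affine_e (i : I) : affine kappa := aff_loop kappa (lmono (serre_e i) (aff_level i)).
Definition affine_f (i : I) : affine kappa := aff_loop kappa (lmono (serre_f i) (- aff_level i)).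
Definition wt0 (a : L) : W := \sum_i aff_root i *~ a i.
Definition wt (a : L) : W := lam0 + wt0 a.
Definition wvec (a : L) : V := lmono (mv (wt a)) (a ord0).

Lemma aff_root_pair i : chevalley_pair (aff_root i) (serre_e i) (serre_f i).
Proof. by rewrite /aff_root /serre_e /serre_f; case: unliftP => [j|] _. Qed.

Lemma alpha_free : forall c : 'I_n -> k, \sum_i c i *: alpha i = 0 -> forall i, c i = 0.
Proof. by have [_ /free_enumP] := alpha_base. Qed.

Lemma alpha_int_free (c : 'I_n -> int) : \sum_i alpha i *~ c i = 0 -> forall i, c i = 0.
Proof.
move=> c0 i; apply/eqP; rewrite -(intr_eq0_char0 k_char0); apply/eqP.
apply: (alpha_free (c := fun i => (c i)%:~R)); rewrite -[RHS]c0.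
by apply: eq_bigr => j _; rewrite scaler_int.
Qed.

Lemma chevalley_neq0 gamma x y : chevalley_pair (H := H) gamma x y -> gamma <> 0 /\ x <> 0.
Proof.
move=> [_ _ [u uE u2]]; have n2 : 2%:R != 0 :> k by rewrite natr_eq0_char0.
split=> z; first by move: u2 n2; rewrite z zero_lfunE => <-; rewrite eqxx.
move: u2 n2; have -> : u = 0.
  by apply: val_inj; rewrite /= -[val u]/(vsval u) uE z lie0l.
by rewrite linear0 => <-; rewrite eqxx.
Qed.

Lemma alpha0_root : Defs.root alpha0.
Proof.
have [a0 x0] := chevalley_neq0 ef0_pair; have [h0 _ _] := ef0_pair.
by split=> //; exists e0.
Qed.

(** For two simple roots the bracket would have weight alpha_i - alpha_j, whose coefficients 1 and
    -1 have different signs, so it is not a root. For the affine node this is the extremality of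
    [e0] and [f0]. *)
Lemma ef_comm i j : i <> j -> lie (serre_e i) (serre_f j) = 0.
Proof.
rewrite /serre_e /serre_f; case: unliftP => [i' ->|->]; case: unliftP => [j' ->|->] // ij.
- have ij' : i' <> j' by move=> ij'; apply: ij; rewrite ij'.
  apply: contrapT => ne.
  have [hx _ _] := ef_pair i'; have [_ hy _] := ef_pair j'.
  have hxy := gwv_lie hx hy.
  have delta0 (c : 'I_n -> int) : alpha i' - alpha j' = \sum_l alpha l *~ c l ->
      c i' = 1 /\ c j' = -1.
    move=> cE; have := @alpha_int_free (fun l => c l - (l == i')%:Z + (l == j')%:Z).
    have -> : \sum_l alpha l *~ (c l - (l == i')%:Z + (l == j')%:Z) = 0.
      under eq_bigr => l _ do rewrite mulrzDr mulrzBr.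
      rewrite big_split sumrB -cE /= (bigD1 i') //= eqxx (@big1 _ _ _ _ _ (fun l => l != i')); last first.
        by move=> l /negPf ->; rewrite mulr0z.
      rewrite [X in _ + X](bigD1 j') //= eqxx (@big1 _ _ _ _ _ (fun l => l != j')); last first.
        by move=> l /negPf ->; rewrite mulr0z.
      by rewrite !mulr1z !addr0 addrAC subrK subrr.
    move=> /(_ erefl) h; have := h i'; have := h j'; rewrite !eqxx.
    have -> : (i' == j') = false by apply/eqP.
    have -> : (j' == i') = false by apply/eqP => /esym.
    by split; lia.
  have d0 : alpha i' - alpha j' <> 0.
    move=> d0; have [|] := @delta0 (fun=> 0); last by [].
    by rewrite d0 big1 // => l _; rewrite mulr0z.
  have [_ _ base] := alpha_base; have [c [cE|cE]] := base _ (root_of hxy ne d0).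
    have [|_] := @delta0 (fun l => (c l)%:Z); last by [].
    by rewrite cE; apply: eq_bigr => l _; rewrite pmulrn.
  have [|h _] := @delta0 (fun l => - (c l)%:Z); last by move: h; case: (c i').
  by rewrite cE -sumrN; apply: eq_bigr => l _; rewrite mulrNz pmulrn.
- by have [_] := ef0_comm i'.
- by rewrite lieC; have [-> _] := ef0_comm j'; rewrite oppr0.
Qed.

Lemma wt_add a d : wt (a + d) = wt a + wt0 d.
Proof.
rewrite /wt -addrA -big_split; congr (_ + _); apply: eq_bigr => i _ /=.
by rewrite ffunE mulrzDr.
Qed.
Lemma wt0_deg i : wt0 (tgw_deg i) = aff_root i.
Proof.
rewrite /wt0 (bigD1 i) //= big1 ?ffunE ?eqxx ?addr0 // => j /negPf ji.
by rewrite ffunE ji.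
Qed.
Lemma wt0_opp d : wt0 (- d) = - wt0 d.
Proof. by rewrite /wt0 -sumrN; apply: eq_bigr => i _; rewrite ffunE mulrNz. Qed.
Lemma wt_deg a i : wt (a + tgw_deg i) = wt a + aff_root i.
Proof. by rewrite wt_add wt0_deg. Qed.
Lemma wt_degN a i : wt (a - tgw_deg i) = wt a - aff_root i.
Proof. by rewrite wt_add wt0_opp wt0_deg. Qed.

Lemma lmono_lin l : linear (fun m : M => lmono m l).
Proof. by move=> a x y; rewrite lmonoD lmonoZ. Qed.

Lemma X_wvec i a : exists c : k, lact (affine_e i) (wvec a) = c *: wvec (a + tgw_deg i).
Proof.
have [hx _ _] := aff_root_pair i; have [c cE] := mv_span (wv_act hx (mv_wv (wt a))).
exists c; rewrite loop_act_mono cE lmonoZ /wvec wt_deg; congr (_ *: lmono _ _).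
by rewrite !ffunE addrC /aff_level eq_sym.
Qed.
Lemma Y_wvec i a : exists c : k, lact (affine_f i) (wvec a) = c *: wvec (a - tgw_deg i).
Proof.
have [_ hy _] := aff_root_pair i; have [c cE] := mv_span (wv_act hy (mv_wv (wt a))).
exists c; rewrite loop_act_mono cE lmonoZ /wvec wt_degN; congr (_ *: lmono _ _).
by rewrite !ffunE addrC /aff_level eq_sym.
Qed.

Lemma wvec_span (v : V) : exists s : seq (L * k), v = \sum_(p <- s) p.2 *: wvec p.1.
Proof.
have [c0 c0E] : exists c : 'I_n -> int, alpha0 = \sum_i alpha i *~ c i.
  have [_ _ base] := alpha_base; have [c [->|->]] := base _ alpha0_root.
    by exists (fun i => (c i)%:Z); apply: eq_bigr => i _; rewrite pmulrn.
  by exists (fun i => - (c i)%:Z); rewrite -sumrN; apply: eq_bigr => i _; rewrite mulrNz pmulrn.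
elim/laurent_ind: v => [|m l x [s ->]]; first by exists [::]; rewrite big_nil.
suff [s' ->] : exists s : seq (L * k), lmono m l = \sum_(p <- s) p.2 *: wvec p.1.
  by exists (s' ++ s); rewrite big_cat.
have [s1 [v [_ hv ->]]] := weight_decomp M_weight m.
rewrite (lin_sum (lmono_lin l)); elim: s1 => [|mu s1 [s2 e2]].
  by exists [::]; rewrite !big_nil.
rewrite big_cons e2; have [b bE] := mv_span (hv mu).
have [z|/eqP smu] := eqVneq (mv mu) 0.
  by exists s2; rewrite bE z scaler0 lmono0 add0r.
have [c cE] := supp_lattice smu.
(* Since alpha0 is the combination of the simple roots with coefficients [c0 j], the level l already
   contributes [c0 j * l] to the j-th coordinate of the weight. *)
pose a : L := [ffun i => if unlift ord0 i is Some j then c j - c0 j * l else l].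
exists ((a, b) :: s2); rewrite big_cons /=; congr (_ + _).
rewrite bE lmonoZ /wvec; congr (_ *: lmono (mv _) _); last by rewrite ffunE unlift_none.
rewrite /wt /wt0 big_ord_recl /aff_root unlift_none ffunE unlift_none c0E cE mulrz_suml; congr (_ + _).
rewrite -big_split; apply: eq_bigr => j _ /=; rewrite ffunE liftK mulrzBr mulrzA.
by rewrite addrC subrK.
Qed.

Lemma wt_inj a b : wt a = wt b -> a ord0 = b ord0 -> a = b.
Proof.
move=> /addrI ab a0; have h : \sum_i alpha i *~ (a (lift ord0 i) - b (lift ord0 i)) = 0.
  move: ab; rewrite /wt0 !big_ord_recl a0 => /addrI /eqP; rewrite -subr_eq0 -sumrB => /eqP.
  move=> e'; rewrite -[RHS]e'; apply: eq_bigr => j _.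
  by rewrite /aff_root liftK mulrzBr.
apply/ffunP => i; case: (unliftP ord0 i) => [j ->|-> //].
by apply/eqP; rewrite -subr_eq0; apply/eqP; apply: (alpha_int_free h).
Qed.

Lemma wvec_free (s : seq L) (c : L -> k) : uniq s ->
  \sum_(a <- s) c a *: wvec a = 0 -> forall a, a \in s -> c a *: wvec a = 0.
Proof.
move=> s_uniq s0 a as_; have := congr1 (fun x : laurent M => x (a ord0)) s0.
rewrite (lcoef_sum _ (fun a => c a *: wvec a)) lcoef0 => s1.
have s2 : \sum_(b <- [seq b : L <- s | b ord0 == a ord0]) c b *: mv (wt b) = 0.
  rewrite -[RHS]s1 big_filter big_mkcond; apply: eq_bigr => b _.
  rewrite lcoefZ lcoef_mono eq_sym; case: eqP => // _; by rewrite scaler0.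
have := @weight_free_family _ _ _ _ _ _ wt (fun b => c b *: mv (wt b)) (filter_uniq _ s_uniq) _ _ s2 a.
rewrite mem_filter eqxx as_ /wvec => e'; rewrite -lmonoZ e' ?lmono0 //.
- move=> b b'; rewrite !mem_filter => /andP[/eqP ba _] /andP[/eqP b'a _] bb'.
  by apply: wt_inj; rewrite // ba b'a.
- by move=> b; apply: wv_Z.
Qed.

Lemma wvec0 a : wvec a = 0 <-> mv (wt a) = 0.
Proof.
split=> [/(congr1 (fun x : laurent M => x (a ord0)))|e']; last by rewrite /wvec e' lmono0.
by rewrite lcoef_mono eqxx.
Qed.

Lemma XYC_wvec i j a : i <> j -> lact (affine_e i) (lact (affine_f j) (wvec a)) = lact (affine_f j) (lact (affine_e i) (wvec a)).
Proof.
move=> ij; rewrite !loop_act_mono lactC ef_comm // lact0l add0r.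
by congr lmono; rewrite addrCA.
Qed.

Lemma polyf_realized P : polyf P -> exists u : env_alg (affine kappa), forall mu l,
  env_act u (lmono (mv mu) l : V) = P mu *: lmono (mv mu) l.
Proof.
elim=> {P} [c|u|P Q _ [u hu] _ [v hv]|P Q _ [u hu] _ [v hv]].
- by exists (c *: (1 : env_alg (affine kappa))) => mu l; rewrite env_actZ env_act1.
- exists (env_gen (aff_loop kappa (lmono (vsval u) 0))) => mu l.
  by rewrite env_act_gen loop_act_mono add0r mv_wv lmonoZ.
- by exists (u + v) => mu l; rewrite env_actD hu hv scalerDl.
- exists (u * v) => mu l.
  by rewrite env_actM hv (lin_Z (env_act_linear u)) hu scalerA mulrC.
Qed.

Lemma level_realized : exists u : env_alg (affine kappa), forall a,
  env_act u (wvec a) = (a ord0)%:~R *: wvec a.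
Proof.
exists (env_gen ((0, 0, 1) : affine kappa)) => a.
by rewrite env_act_gen loop_act_degree.
Qed.

Section Datum.
Variables (S : (L -> k) -> Prop) (hS : translation_algebra S).
Hypothesis S_realized : forall F, S F -> exists u : env_alg (affine kappa), forall a,
  env_act u (wvec a) = F a *: wvec a.
Hypothesis S_wt : forall u : subvs_of H, S (fun a => wt a u).
Hypothesis S_level : S (fun a => (a ord0)%:~R).
Variables (T : I -> W -> k) (S_T : forall i, S (fun a => T i (wt a))).
Hypothesis T_fe : forall i mu, lact (serre_f i) (lact (serre_e i) (mv mu)) = T i mu *: mv mu.
Hypothesis T_ef : forall i mu, lact (serre_e i) (lact (serre_f i) (mv mu)) = T i (mu - aff_root i) *: mv mu.
Definition datum_t i : fun_alg hS := fun_mk hS (S_T i).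
Hypothesis T_neq0 : forall i, datum_t i <> 0.
Local Notation D := (shift_datum T_neq0).
Local Notation mu1 := (fun _ _ : I => 1 : k).
Hypothesis kernelT : forall F : fun_alg hS, (forall a, supp (wt a) -> F a = 0) ->
  tgw_iota (D := D) mu1 F = 0.

Theorem loop_tgw : exists psi : {rmorphism env_alg (affine kappa) -> tgw_alg D mu1},
  [/\ scalable psi,
      (forall a : tgw_alg D mu1, exists u, psi u = a),
      (forall u, psi u = 0 <-> annihilator V u) &
      forall i, psi (env_gen (affine_e i)) = tgw_X D mu1 i /\ psi (env_gen (affine_f i)) = tgw_Y D mu1 i].
Proof.
have /boolp.choice [U hU] : forall F : fun_alg hS, exists u : env_alg (affine kappa),
    forall a, env_act u (wvec a) = (F a : k) *: wvec a.
  by case=> F /= /asboolP SF; apply: S_realized.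
pose ract (F : fun_alg hS) (v : V) := env_act (U F) v.
have ract_lin F : linear (ract F) by apply: env_act_linear.
have YX_w i a : lact (affine_f i) (lact (affine_e i) (wvec a)) = (datum_t i a : k) *: wvec a.
  by rewrite !loop_act_mono T_fe lmonoZ addKr.
have XY_w i a : lact (affine_e i) (lact (affine_f i) (wvec a)) = (datum_t i (a - tgw_deg i) : k) *: wvec a.
  by rewrite !loop_act_mono T_ef lmonoZ /= wt_degN addrA subrr add0r.
pose phi := @tgw_act k I S hS datum_t T_neq0 (affine kappa) V affine_e affine_f ract.
have glin := @gen_act_linear k I S hS datum_t T_neq0 (affine kappa) V affine_e affine_f ract ract_lin.
have grel := @gen_act_rel k I S hS datum_t T_neq0 (affine kappa) V affine_e affine_f wvec ract X_wvec Y_wvec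
  ract_lin hU YX_w XY_w XYC_wvec wvec_span.
have phi_gen x v : phi (pres_gen _ x) v = gen_act affine_e affine_f ract x v by apply: pres_act_gen.
have phiD c c' v : phi (c + c') v = phi c v + phi c' v by apply: pres_actD.
have phiN c v : phi (- c) v = - phi c v by apply: pres_actN.
have phiM c c' v : phi (c * c') v = phi c (phi c' v) by apply: pres_actM.
have phiZ (b : k) c v : phi (b *: c) v = b *: phi c v by apply: pres_actZ.
have phi0 v : phi 0 v = 0 by apply: pres_act0.
have phi1 v : phi 1 v = v by apply: pres_act1.
have phi_lin c : linear (phi c) by apply: pres_act_linear.
pose Im (x : affine kappa) := exists c, forall v, phi c v = lact x v.
have ImL (b : k) x y : Im x -> Im y -> Im (b *: x + y).
  by move=> [c hc] [c' hc']; exists (b *: c + c') => v; rewrite phiD phiZ hc hc' lactDl lactZl.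
have ImS (F : fun_alg hS) x : (forall a, lact x (wvec a) = (F a : k) *: wvec a) -> Im x.
  move=> hx; exists (tgw_iota (D := D) mu1 F) => v; rewrite phi_gen /=; move: v.
  apply: (ext_w wvec_span) => [||a]; [exact: ract_lin | exact: lact_linearr |].
  by rewrite [RHS]hx; apply: hU.
have Imdeg : Im (0, 0, 1).
  pose F : fun_alg hS := fun_mk hS S_level.
  by apply: (ImS F) => a; rewrite loop_act_degree.
pose Iml x l := Im (aff_loop kappa (lmono x l)).
have Iml_ext x l c : (forall m b, phi c (lmono m b) = lmono (lact x m) (l + b)) -> Iml x l.
  move=> hc; exists c => v; elim/laurent_ind: v => [|m b v IH].
    by rewrite [LHS](lin_0 (phi_lin c)) [RHS](lact0r).
  by rewrite [LHS](lin_D (phi_lin c)) [RHS](lactDr) IH hc loop_act_mono.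
have ImlE x l : Iml x l -> exists c, forall m b, phi c (lmono m b) = lmono (lact x m) (l + b).
  by move=> [c hc]; exists c => m b; rewrite hc loop_act_mono.
have ImlL l (b : k) x y : Iml x l -> Iml y l -> Iml (b *: x + y) l.
  move=> /ImlE[c hc] /ImlE[c' hc']; apply: (@Iml_ext _ _ (b *: c + c')) => m b'.
  by rewrite phiD phiZ hc hc' lactDl lactZl lmonoD lmonoZ.
have Iml_lie x y l l' : Iml x l -> Iml y l' -> Iml (lie x y) (l + l').
  move=> /ImlE[c hc] /ImlE[c' hc']; apply: (@Iml_ext _ _ (c * c' - c' * c)) => m b.
  rewrite phiD phiN !phiM !hc' !hc hc' lact_lie -[X in _ = lmono (_ + X) _]scaleN1r addrC lmonoD lmonoZ.
  by rewrite scaleN1r addrC addrA; congr (_ - lmono _ _); rewrite addrCA addrA.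
have Iml0 l : Iml 0 l.
  by apply: (@Iml_ext _ _ 0) => m b; rewrite phi0 lact0l lmono0.
(* Level 0 follows from generation, levels 1 and -1 start from [e0] and [f0], and the other levels
   come from brackets. *)
have Imall x l : Iml x l.
  case: triv_or_generated => [triv|[_ gen]].
    by apply: (@Iml_ext _ _ 0) => m b; rewrite phi0 triv lmono0.
  have P0 y : Iml y 0.
    move: y; apply: (gen (fun y => Iml y 0)) => [b y z|y z hy hz|u uH|i|i].
    - exact: ImlL.
    - by have := Iml_lie _ _ _ _ hy hz; rewrite addr0.
    - pose F : fun_alg hS := fun_mk hS (S_wt (Subvs uH)).
      by apply: (ImS F) => a; rewrite loop_act_mono add0r (wvP uH (mv_wv _)) lmonoZ.
    - exists (tgw_cX D mu1 (lift ord0 i)) => v; rewrite phi_gen /= /affine_e /serre_e liftK.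
      by [].
    - exists (tgw_cY D mu1 (lift ord0 i)) => v; rewrite phi_gen /= /affine_f /serre_f liftK.
      by [].
  (* Because level 0 is fully realized, the elements of g realized at level l' form an ideal, so one
     nonzero element suffices. *)
  have ideal l' y : Iml y l' -> y <> 0 -> forall z, Iml z l'.
    move=> hy y0; have [|||triv|//] := @simple_lie_ideal k g (fun z => Iml z l') g_simple.
    - exact: Iml0.
    - by move=> b z z'; apply: ImlL.
    - by move=> z z' hz'; have := Iml_lie _ _ _ _ (P0 z) hz'; rewrite add0r.
    - by case: y0; apply: triv.
  have [_ ne0] := chevalley_neq0 ef0_pair; have [_ nf0] := chevalley_neq0 (chevalley_swap ef0_pair).
  have P1 : forall y, Iml y 1.
    apply: (ideal 1 e0) => //; exists (tgw_cX D mu1 ord0) => v.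
    by rewrite phi_gen /= /affine_e /serre_e unlift_none.
  have N1 : forall y, Iml y (-1).
    apply: (ideal (-1) f0) => //; exists (tgw_cY D mu1 ord0) => v.
    by rewrite phi_gen /= /affine_f /serre_f unlift_none.
  have step l' l1 : (forall y, Iml y l1) -> (forall y, Iml y l') -> forall y, Iml y (l1 + l').
    move=> h1 h'; have [[y [z yz]] _] := g_simple.
    by apply: (ideal _ (lie y z)) => //; apply: Iml_lie.
  case: (intP l) x => [|m|m] //.
  - elim: m => [//|m IH] x; have := step _ _ P1 IH x.
    by have -> : 1 + m.+1%:Z = m.+2%:Z by lia.
  - elim: m => [//|m IH] x; have := step _ _ N1 IH x.
    by have -> : -1 + - m.+1%:Z = - m.+2%:Z by lia.
have lie_real x : exists c, forall v, phi c v = lact x v.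
  have [b hb] := affine_decomp M x.
  suff [c hc] : Im (aff_loop kappa x.1.1).
    have [c' hc'] := Imdeg.
    by exists (c + b *: c') => v; rewrite phiD phiZ hc hc' hb.
  elim/laurent_ind: (x.1.1) => [|y l z hz].
    exists 0 => v; rewrite phi0.
    by have -> : aff_loop kappa 0 = 0 by []; rewrite lact0l.
  have -> : aff_loop kappa (lmono y l + z) = 1 *: aff_loop kappa (lmono y l) + aff_loop kappa z.
    by rewrite scale1r /aff_loop; congr (_, _, _); rewrite addr0.
  by apply: ImL => //; apply: Imall.
(* For trivial [M] all operators are diagonal, so a = b. Otherwise simplicity reaches every vector
   on the level of b, a vector moved nontrivially by some x is carried to the level of a, and
   simplicity is used again there. *)
have conn c a b : wvec b <> 0 -> phi c (wvec a) = wvec b -> exists c', phi c' (wvec b) = wvec a.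
  case: triv_or_generated => [triv|[[x [m xm]] _]] wb.
    move=> cab; have diag : forall c a, exists s : k, phi c (wvec a) = s *: wvec a.
      elim/pres_ind => [[F|i|i] a'|a'|a'|u v hu hv a'|u v hu hv a'|q u hu a'].
      - by exists (F a' : k); rewrite phi_gen -hU.
      - by exists 0; rewrite phi_gen scale0r [LHS]loop_act_mono triv lmono0.
      - by exists 0; rewrite phi_gen scale0r [LHS]loop_act_mono triv lmono0.
      - by exists 0; rewrite phi0 scale0r.
      - by exists 1; rewrite phi1 scale1r.
      - have [[s1 e1] [s2 e2]] := (hu a', hv a').
        by exists (s1 + s2); rewrite phiD e1 e2 scalerDl.
      - have [[s1 e1] [s2 e2]] := (hu a', hv a').
        by exists (s2 * s1); rewrite phiM e2 (lin_Z (phi_lin u)) e1 scalerA.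
      - by have [s1 e1] := hu a'; exists (q * s1); rewrite phiZ e1 scalerA.
    have [s sE] := diag c a; have [<-|ab] := eqVneq a b; first by exists 1.
    case: wb; have := @wvec_free [:: a; b] (fun x => if x == a then s else -1).
    rewrite /= inE ab => /(_ isT); rewrite !big_cons big_nil eqxx [b == a]eq_sym (negPf ab) addr0.
    rewrite -sE cab scaleN1r subrr => /(_ erefl b); rewrite !inE eqxx orbT [b == a]eq_sym (negPf ab).
    by move=> /(_ isT)/eqP; rewrite scaleN1r oppr_eq0 => /eqP.
  move=> _ {c}; pose N l (v : M) := exists c', phi c' (wvec b) = lmono v l.
  have Nall l v : v <> 0 -> N l v -> forall v', N l v'.
    move=> v0 Nv; have [_ /(_ (N l))] := M_simple; case.
    - by exists 0; rewrite phi0 lmono0.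
    - move=> q u u' [c hc] [c' hc']; exists (q *: c + c').
      by rewrite phiD phiZ hc hc' lmonoD lmonoZ.
    - move=> y u [c hc]; have [c' hc'] := ImlE _ _ (Imall y 0).
      by exists (c' * c); rewrite phiM hc hc' add0r.
    - by move=> /(_ v Nv).
    - by [].
  have Nb : forall v', N (b ord0) v'.
    apply: (Nall _ (mv (wt b))); first by move=> z; apply: wb; apply/wvec0.
    by exists 1; rewrite phi1.
  apply: (Nall _ (lact x m)) => //; have [c hc] := Nb m.
  have [c' hc'] := ImlE _ _ (Imall x (a ord0 - b ord0)).
  by exists (c' * c); rewrite phiM hc hc' subrK.
apply: (@tgw_quotient k I S hS datum_t T_neq0 (affine kappa) V affine_e affine_f wvec ract X_wvec Y_wvec
  ract_lin hU YX_w XY_w XYC_wvec wvec_span wvec_free) => //.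
- by move=> F hF; apply: kernelT => a sa; apply: hF => /wvec0.
- by move=> F; exists (U F).
Qed.
End Datum.

Lemma n_gt0 : (0 < n)%N.
Proof.
have [_ _ base] := alpha_base; have [a0 _] := alpha0_root.
rewrite lt0n; apply/eqP => n0; apply: a0; have [c cE] := base _ alpha0_root.
have z : \sum_i alpha i *+ c i = 0 by apply: big1 => i; have := ltn_ord i; rewrite {2}n0.
by case: cE => ->; rewrite z ?oppr0.
Qed.

Lemma wt0_mulrn d x : wt0 (d *+ x) = wt0 d *+ x.
Proof.
rewrite /wt0 -sumrMnl; apply: eq_bigr => i _; elim: x => [|x IH]; first by rewrite !mulr0n ffunE mulr0z.
by rewrite !mulrS ffunE mulrzDr IH.
Qed.

Lemma t_values : exists t : I -> W -> k, forall i mu,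
  lact (serre_f i) (lact (serre_e i) (mv mu)) = t i mu *: mv mu.
Proof.
suff h : forall i, exists t : W -> k, forall mu, lact (serre_f i) (lact (serre_e i) (mv mu)) = t mu *: mv mu.
  by have [t ht] := boolp.choice h; exists t.
move=> i; have h mu : exists t : k, lact (serre_f i) (lact (serre_e i) (mv mu)) = t *: mv mu.
  apply: mv_span; have [hx hy _] := aff_root_pair i.
  by have := wv_act hy (wv_act hx (mv_wv mu)); rewrite addrK.
by have [t ht] := boolp.choice h; exists t.
Qed.

(** With f mv(mu) = c mv(mu - alpha_i) and e mv(mu - alpha_i) = d mv(mu), both eigenvalues are c d;
    the nonvanishing of mv(mu - alpha_i) is what identifies [t] with c d. *)
Lemma ef_value i mu t : supp (mu - aff_root i) ->
  lact (serre_f i) (lact (serre_e i) (mv (mu - aff_root i))) = t *: mv (mu - aff_root i) ->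
  lact (serre_e i) (lact (serre_f i) (mv mu)) = t *: mv mu.
Proof.
have [hx hy _] := aff_root_pair i => s tE.
have [c cE] := mv_span (wv_act hy (mv_wv mu)).
have [d dE] := mv_span (wv_act hx (mv_wv (mu - aff_root i))).
rewrite subrK in dE.
move: tE; rewrite dE lactZr cE scalerA => /eqP.
rewrite -subr_eq0 -scalerBl scaler_eq0 subr_eq0 => /orP[/eqP <-|/eqP //].
by rewrite lactZr dE scalerA mulrC.
Qed.

Definition loop_tgw_realized : Prop := exists (D : tgw_datum k I)
    (psi : {rmorphism env_alg (affine kappa) -> tgw_alg D (fun _ _ => 1)}),
  [/\ scalable psi,
      (forall a : tgw_alg D (fun _ _ => 1), exists u, psi u = a),
      (forall u, psi u = 0 <-> annihilator V u) &
      forall i, psi (env_gen (affine_e i)) = tgw_X D (fun _ _ => 1) i /\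
                psi (env_gen (affine_f i)) = tgw_Y D (fun _ _ => 1) i].

(** * Modules with finitely many weights *)

Section FiniteCase.
Variable Sw : seq W.
Hypothesis supp_Sw : forall mu, supp mu -> mu \in Sw.

(** On finitely many weights every function is interpolated by a polynomial, and polynomials are
    realized by U. *)
Lemma wfun_realized (phi : W -> k) : exists u : env_alg (affine kappa), forall a,
  env_act u (wvec a) = phi (wt a) *: wvec a.
Proof.
have [P hP PE] := polyf_interp Sw phi; have [u hu] := polyf_realized hP.
exists u => a; rewrite hu; have [e'|/eqP sa] := eqVneq (mv (wt a)) 0.
  by rewrite /wvec e' lmono0 !scaler0.
by rewrite PE //; apply: supp_Sw.
Qed.

(* All translates are required to be realized, since [R] must be stable under the [sigma_i]. *)
Definition realized_fun (F : L -> k) : Prop := forall d, exists u : env_alg (affine kappa), forall a,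
  env_act u (wvec a) = F (a + d) *: wvec a.

Lemma realized_fun_alg : translation_algebra realized_fun.
Proof.
split=> [c d|F G hF hG d|F G hF hG d|d F hF d'].
- by exists (c *: (1 : env_alg (affine kappa))) => a; rewrite env_actZ env_act1.
- have [[u hu] [v hv]] := (hF d, hG d).
  by exists (u + v) => a; rewrite env_actD hu hv scalerDl.
- have [[u hu] [v hv]] := (hF d, hG d); exists (u * v) => a.
  by rewrite env_actM hv (lin_Z (env_act_linear u)) hu scalerA mulrC.
- by have [u hu] := hF (d' + d); exists u => a; rewrite hu addrA.
Qed.

Lemma realized_fun_wt (phi : W -> k) : realized_fun (fun a => phi (wt a)).
Proof.
move=> d; have [u hu] := wfun_realized (fun mu => phi (mu + wt0 d)).
by exists u => a; rewrite hu wt_add.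
Qed.

Lemma realized_fun_level : realized_fun (fun a => (a ord0)%:~R).
Proof.
move=> d; have [u hu] := level_realized.
exists (u + (d ord0)%:~R *: (1 : env_alg (affine kappa))) => a.
by rewrite env_actD hu env_actZ env_act1 -scalerDl ffunE rmorphD.
Qed.

Lemma avoid_finite gamma mu (Ds : seq W) : gamma <> 0 ->
  exists x, forall s, s \in Ds -> mu + gamma *+ x + s \notin Sw.
Proof.
move=> g0; pose B := [seq nu - s - mu | nu <- Sw, s <- Ds].
have [x hx] : exists x, gamma *+ x \notin B.
  apply: contrapT => no.
  have : (size [seq gamma *+ x | x <- iota 0 (size B).+1] <= size B)%N.
    apply: uniq_leq_size.
      by rewrite map_inj_uniq ?iota_uniq //; apply: (mulrn_inj_char0 k_char0 g0).
    by move=> _ /mapP[x _ ->]; apply: contraT => xB; case: no; exists x.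
  by rewrite size_map size_iota ltnn.
exists x => s sD; apply: contra hx => h; apply/allpairsP.
by exists (mu + gamma *+ x + s, s); split=> //=; rewrite addrK addrAC subrr add0r.
Qed.

Lemma nilp_fin gamma x : gwv gamma x -> gamma <> 0 -> forall m : M, exists p, iter p (lact x) m = 0.
Proof.
move=> hx g0 m; have [s [v [_ hv ->]]] := weight_decomp M_weight m.
have itL q := iter_lact_linear (M := M) q x.
elim: s => [|mu s [p hp]]; first by exists 0%N; rewrite big_nil.
have [q hq] : exists q, iter q (lact x) (v mu) = 0.
  have [q hq] := avoid_finite mu [:: 0] g0; exists q.
  have hw := wv_iter q hx (hv mu); have [b ->] := mv_span hw.
  have [->|/eqP sm] := eqVneq (mv (mu + gamma *+ q)) 0; first by rewrite scaler0.
  by have := hq 0; rewrite inE eqxx addr0 supp_Sw // => /(_ isT).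
exists (p + q)%N; rewrite big_cons (lin_D (itL _)) iterD hq (lin_0 (itL _)) add0r.
by rewrite addnC iterD hp (lin_0 (itL _)).
Qed.

(** Let m = mu(h_i). If m >= -b, the string descending from mu + b alpha_i has at least b nonzero
    steps and passes through mu; otherwise the string ascending from mu - a alpha_i has at least a
    nonzero steps. *)
Lemma convex_fin i mu a b : supp (mu - aff_root i *+ a) -> supp (mu + aff_root i *+ b) -> supp mu.
Proof.
move=> sA sB; have cp := aff_root_pair i; have [hx hy [u uE u2]] := cp.
have [a0 _] := chevalley_neq0 cp; have [a0' _] := chevalley_neq0 (chevalley_swap cp).
have nx := nilp_fin hx a0; have ny := nilp_fin hy a0'.
have [zA [zAE _ zAx _]] := string_reflect k_char0 mv_wv mv_span cp uE nx ny sA.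
have [zB [zBE zBy _ _]] := string_reflect k_char0 mv_wv mv_span cp uE nx ny sB.
have zAB : zB = zA + 2%:Z * (a + b)%:Z.
  apply: (intr_inj_char0 k_char0); rewrite -zBE rmorphD rmorphM /= -zAE !add_lfunE opp_lfunE.
  rewrite !lfun_mulrn u2 -!pmulrn natrD -[2%:R *+ a]mulr_natr -[2%:R *+ b]mulr_natr; ring.
have [le|lt] := boolP ((b%:Z <= zB)%R).
  have [q zq] : exists q : nat, zB = q by exists `|zB|%N; lia.
  have bq : (b <= q)%N by lia.
  have := supp_iter mv_wv mv_span hy (iter_neq0_le bq (zBy q zq)).
  by rewrite mulNrn addrK.
have [q zq] : exists q : nat, zA = - q%:Z by exists `|zA|%N; lia.
have aq : (a <= q)%N by lia.
by have := supp_iter mv_wv mv_span hx (iter_neq0_le aq (zAx q zq)); rewrite subrK.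
Qed.

(** Any simple node would do: the inconsistency is created between it and the affine node 0. *)
Definition node1 : I := lift ord0 (Ordinal n_gt0).

Lemma rho_fin : exists rho : subvs_of H, (forall a, exists z : int, wt0 a rho = z%:~R) /\ (alpha0 rho : k) <> 0.
Proof.
have [rho hrho] := rho_exists alpha_base; exists rho.
have [m hm] := root_rho alpha_base hrho alpha0_root.
split; last first.
  by case: hm => ->; apply/eqP; rewrite ?oppr_eq0 natr_eq0_char0.
have [z0 hz0] : exists z0 : int, alpha0 rho = z0%:~R.
  by case: hm => ->; [exists m.+1%:Z | exists (- m.+1%:Z)]; rewrite ?mulrNz -?pmulrn.
move=> a; exists (\sum_i (if unlift ord0 i is Some _ then 1 else z0) * a i).
rewrite /wt0 sum_lfunE rmorph_sum; apply: eq_bigr => i _ /=.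
rewrite lfun_mulrz rmorphM /= /aff_root; case: unliftP => [j|] _.
  by rewrite hrho mulr1z mul1r.
by rewrite hz0 -mulrzr.
Qed.

Theorem finite_case : loop_tgw_realized.
Proof.
have [t tE] := t_values; have [rho [rho_int rho0]] := rho_fin.
pose sp mu := mv mu != 0.
have spP mu : reflect (supp mu) (sp mu) by apply: (iffP idP) => /eqP.
(* The shift by 1/2 keeps [tau] nonzero on the lattice; its slope along [alpha0] is the inconsistency [kap] below. *)
pose tau mu := ((mu - lam0)%R rho : k) + 2%:R^-1.
have n2 : 2%:R != 0 :> k by rewrite natr_eq0_char0.
have tau0 a : tau (wt a) != 0.
  rewrite /tau /wt addrAC subrr add0r; have [z ->] := rho_int a.
  apply/eqP => e'; have : ((2%:Z * z + 1)%:~R == 0 :> k).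
    rewrite rmorphD rmorphM /= -[X in _ + X](mulfV n2) -mulrDr e' mulr0.
    by [].
  by rewrite intr_eq0_char0 //; apply/negP; lia.
(* The value is dictated by [M] along an edge between two weights and must be 0 along an edge with
   exactly one end among the weights; it is free on the remaining edges. *)
pose T i mu := if sp mu && sp (mu + aff_root i) then t i mu else
  if sp mu || sp (mu + aff_root i) then 0 else if i == node1 then tau mu else 1.
have T_out i mu : ~~ sp mu -> ~~ sp (mu + aff_root i) -> T i mu = if i == node1 then tau mu else 1.
  by rewrite /T => /negPf -> /negPf ->.
have T_fe i mu : lact (serre_f i) (lact (serre_e i) (mv mu)) = T i mu *: mv mu.
  rewrite /T; have [e'|smu] := eqVneq (mv mu) 0; first by rewrite e' !lact0r scaler0.
  rewrite {1 3}/sp smu /=; case: ifP => [_|/negbT]; first exact: tE.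
  rewrite negbK => /eqP e'; have [hx _ _] := aff_root_pair i.
  have [b ->] := mv_span (wv_act hx (mv_wv mu)).
  by rewrite e' scaler0 lact0r scale0r.
have T_ef i mu : lact (serre_e i) (lact (serre_f i) (mv mu)) = T i (mu - aff_root i) *: mv mu.
  rewrite /T subrK; have [e'|smu] := eqVneq (mv mu) 0; first by rewrite e' !lact0r scaler0.
  rewrite {2 4}/sp smu andbT orbT; case: ifP => [/spP s|/negbT]; first exact: ef_value (tE i _).
  rewrite negbK => /eqP e'; have [_ hy _] := aff_root_pair i.
  have [b ->] := mv_span (wv_act hy (mv_wv mu)).
  by rewrite e' scaler0 lact0r scale0r.
pose hS := realized_fun_alg; have S_T i : realized_fun (fun a => T i (wt a)) by apply: realized_fun_wt.
have spN mu : mu \notin Sw -> ~~ sp mu by apply: contra => /spP /supp_Sw.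
have T_neq0 i : datum_t hS S_T i <> 0.
  have [a0 _] := chevalley_neq0 (aff_root_pair i).
  have [x hx] := avoid_finite lam0 [:: 0; aff_root i] a0.
  move=> /(congr1 (fun F : fun_alg hS => F (tgw_deg i *+ x) : k)) /=.
  have -> : wt (tgw_deg i *+ x) = lam0 + aff_root i *+ x by rewrite /wt wt0_mulrn wt0_deg.
  rewrite T_out; first 1 last.
  - by have := hx 0; rewrite inE eqxx addr0 => /(_ isT) /spN.
  - by have := hx (aff_root i); rewrite !inE eqxx orbT => /(_ isT) /spN.
  case: ifP => _ /eqP; last by rewrite oner_eq0.
  have -> : lam0 + aff_root i *+ x = wt (tgw_deg i *+ x) by rewrite /wt wt0_mulrn wt0_deg.
  by rewrite (negPf (tau0 _)).
pose D := shift_datum T_neq0; exists D.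
pose mu1 := (fun _ _ : I => 1 : k).
pose fw phi : fun_alg hS := fun_mk hS (realized_fun_wt phi).
(* The functions of the weight that vanish in C form an ideal, stable under the transports [K_up]
   and [K_down] along edges. *)
pose K phi := tgw_iota (D := D) mu1 (fw phi) = 0.
pose il := @iota_linear k I D mu1.
have K_ext phi psi : (forall a, phi (wt a) = psi (wt a)) -> K phi -> K psi.
  by move=> h; rewrite /K; have -> : fw phi = fw psi by apply: fun_algP.
have K_mul phi psi : K phi -> K (fun mu => psi mu * phi mu).
  move=> h; rewrite /K; have -> : fw (fun mu => psi mu * phi mu) = fw psi * fw phi by apply: fun_algP.
  by rewrite (iotaM (D := D)) h mulr0.
have K_add phi psi : K phi -> K psi -> K (fun mu => phi mu + psi mu).
  move=> h h'; rewrite /K; have -> : fw (fun mu => phi mu + psi mu) = fw phi + fw psi by apply: fun_algP.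
  by rewrite (lin_D il) h h' addr0.
have K0 phi : (forall a, phi (wt a) = 0) -> K phi.
  move=> h; rewrite /K; have -> : fw phi = 0 by apply: fun_algP.
  exact: (lin_0 il).
have K_up phi i : K phi -> K (fun mu => phi (mu - aff_root i) * T i (mu - aff_root i)).
  move=> h; have := iota0_X (D := D) (mu := mu1) i h; rewrite /K.
  congr (_ = 0); congr (tgw_iota _ _); apply: fun_algP => a.
  by rewrite /= wt_degN.
have K_down phi i : K phi -> K (fun mu => phi (mu + aff_root i) * T i mu).
  move=> h; have := iota0_Y (D := D) (mu := mu1) i h; rewrite /K.
  congr (_ = 0); congr (tgw_iota _ _); apply: fun_algP => a.
  by rewrite /= wt_deg.
have i01 : ord0 <> node1 :> I by move/(congr1 val).
pose kap mu := T node1 (mu - alpha0) * T ord0 (mu - alpha0) - T ord0 (mu + aff_root node1 - alpha0) * T node1 mu.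
have al0 : aff_root ord0 = alpha0 by rewrite /aff_root unlift_none.
have Kkap : K kap.
  have := @iota_inconsistency k I D mu1 ord0 node1 i01 erefl erefl.
  move/eqP; rewrite -subr_eq0 -(lin_B il) => /eqP; rewrite /K.
  congr (_ = 0); congr (tgw_iota _ _); apply: fun_algP => a.
  change (T node1 (wt (a - tgw_deg ord0)) * T ord0 (wt (a - tgw_deg ord0)) -
    T ord0 (wt (a + tgw_deg node1 - tgw_deg ord0)) * T node1 (wt a) = kap (wt a)).
  by rewrite /kap !wt_degN wt_deg al0.
(* The two ends of each edge occurring in [kap] are not weights, so all four values of [T] there are
   the free ones. *)
pose far mu := [&& ~~ sp (mu - alpha0), ~~ sp (mu - alpha0 + aff_root node1), ~~ sp mu & ~~ sp (mu + aff_root node1)].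
have kap_far mu : far mu -> kap mu = - (alpha0 rho : k).
  case/and4P => h1 h2 h3 h4; have h0 : (ord0 == node1) = false by apply/eqP.
  rewrite /kap !T_out ?al0 ?subrK ?h0 ?eqxx //; last by rewrite addrAC.
  rewrite mulr1 mul1r /tau !add_lfunE !opp_lfunE; ring.
(* On [far] the function [kap] is the nonzero constant -alpha0(rho), and can be divided out because
   every function of the weight lies in [R]. *)
have Kfar : K (fun mu => (far mu)%:R).
  apply: (@K_ext (fun mu => (if far mu then (kap mu)^-1 else 0) * kap mu)); last exact: K_mul.
  move=> a; case: ifP => [h|_]; last by rewrite mul0r.
  by rewrite mulVf // kap_far // oppr_eq0; apply/eqP.
pose dl nu := fun mu : W => ((mu == nu)%:R : k).
have Kdl_far nu : far nu -> K (dl nu).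
  move=> h; apply: (@K_ext (fun mu => dl nu mu * (far mu)%:R)); last exact: K_mul.
  by move=> a; rewrite /dl; case: eqP => [->|_]; rewrite ?h ?mulr1 ?mul0r.
have Kstep_down a : ~~ sp (wt a) -> ~~ sp (wt a + aff_root node1) -> K (dl (wt a + aff_root node1)) -> K (dl (wt a)).
  move=> h1 h2 /(K_down _ node1)/(K_mul _ (fun=> (tau (wt a))^-1)); apply: K_ext => b.
  rewrite /dl (inj_eq (addIr _)); case: eqP => [->|_]; last by rewrite mul0r mulr0.
  by rewrite T_out // eqxx mul1r mulVf.
have Kstep_up a : ~~ sp (wt a) -> ~~ sp (wt a - aff_root node1) -> K (dl (wt a - aff_root node1)) -> K (dl (wt a)).
  move=> h1 h2 /(K_up _ node1)/(K_mul _ (fun=> (tau (wt a - aff_root node1))^-1)); apply: K_ext => b.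
  rewrite /dl (inj_eq (addIr _)); case: eqP => [->|_]; last by rewrite mul0r mulr0.
  by rewrite T_out ?subrK // eqxx mul1r mulVf // -wt_degN.
have [a10 _] := chevalley_neq0 (aff_root_pair node1); have [a10' _] := chevalley_neq0 (chevalley_swap (aff_root_pair node1)).
have far_shift nu (Ds := [:: - alpha0; - alpha0 + aff_root node1; 0; aff_root node1]) :
    (forall s, s \in Ds -> nu + s \notin Sw) -> far nu.
  move=> h; apply/and4P; split; apply: spN.
  - by apply: h; rewrite !inE eqxx.
  - by rewrite -addrA; apply: h; rewrite !inE eqxx orbT.
  - by rewrite -[nu]addr0; apply: h; rewrite !inE eqxx !orbT.
  - by apply: h; rewrite !inE eqxx !orbT.
(* The support is convex along [aff_root node1], so one of the two half-lines from [wt a] avoids it. *)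
have Kpoint a : ~~ sp (wt a) -> K (dl (wt a)).
  move=> ha.
  have [up|/existsNP] := pselect (forall x, ~~ sp (wt a + aff_root node1 *+ x)).
    have [x hx] := avoid_finite (wt a) [:: - alpha0; - alpha0 + aff_root node1; 0; aff_root node1] a10.
    have : K (dl (wt a + aff_root node1 *+ x)) by apply/Kdl_far/far_shift.
    elim: x {hx} => [|x IH]; first by rewrite addr0.
    move=> h; apply: IH; have e' : wt (a + tgw_deg node1 *+ x) = wt a + aff_root node1 *+ x.
      by rewrite wt_add wt0_mulrn wt0_deg.
    rewrite -e'; apply: Kstep_down; rewrite e' ?up // -addrA -mulrSr; by rewrite ?up.
  move=> [x0 /negP/negPn/spP sx0].
  have down x : ~~ sp (wt a - aff_root node1 *+ x).
    by apply/negP => /spP sx; move/spP: ha; apply; apply: convex_fin sx sx0.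
  have [x hx] := avoid_finite (wt a) [:: - alpha0; - alpha0 + aff_root node1; 0; aff_root node1] a10'.
  have : K (dl (wt a - aff_root node1 *+ x)) by apply/Kdl_far/far_shift => s; rewrite -mulNrn; apply: hx.
  elim: x {hx} => [|x IH]; first by rewrite subr0.
  move=> h; apply: IH; have e' : wt (a - tgw_deg node1 *+ x) = wt a - aff_root node1 *+ x.
    by rewrite wt_add wt0_opp wt0_mulrn wt0_deg.
  rewrite -e'; apply: Kstep_up; rewrite e' ?down // -addrA -opprD -mulrSr; by rewrite ?down.
(* The complement of the weights consists of the far region and finitely many further points, which
   [Kpoint] treats one by one. *)
have Kout : K (fun mu => (~~ sp mu)%:R).
  pose B := undup [seq nu - s | nu <- Sw, s <- [:: - alpha0; - alpha0 + aff_root node1; 0; aff_root node1]].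
  have notB nu : nu \notin B -> far nu.
    move=> nB; apply: far_shift => s sD; apply: contra nB => h.
    rewrite mem_undup; apply/allpairsP; exists (nu + s, s); split=> //=.
    by rewrite addrK.
  pose C := [seq nu <- B | ~~ sp nu & ~~ far nu].
  have KC : K (fun mu => \sum_(nu <- C) dl nu mu).
    have CN nu : nu \in C -> ~~ sp nu by rewrite mem_filter => /andP[/andP[]].
    elim: C CN => [|nu C IH] CN; first by apply: K0 => a; rewrite big_nil.
    apply: (@K_ext (fun mu => dl nu mu + \sum_(nu <- C) dl nu mu)).
      by move=> a; rewrite big_cons.
    apply: K_add; last by apply: IH => nu' h; apply: CN; rewrite inE h orbT.
    have [[a aE]|no] := pselect (exists a, wt a = nu).
      by rewrite -aE; apply: Kpoint; rewrite aE; apply: CN; rewrite inE eqxx.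
    by apply: K0 => a; rewrite /dl; case: eqP => // e'; case: no; exists a.
  have := K_add _ _ Kfar KC; apply: K_ext => a; set nu := wt a.
  have sumE : \sum_(nu' <- C) dl nu' nu = (nu \in C)%:R.
    have [nuC|nuC] := boolP (nu \in C).
      rewrite (bigD1_seq nu) ?filter_uniq ?undup_uniq //= /dl eqxx big1 ?addr0 // => x xn.
      by rewrite eq_sym (negPf xn).
    rewrite big_seq big1 // => x xC; rewrite /dl; case: eqP => // e'.
    by rewrite e' xC in nuC.
  rewrite sumE mem_filter; have [h|h] := boolP (far nu).
    have -> : ~~ sp nu by case/and4P: h.
    by rewrite andbF addr0.
  rewrite andbT add0r; case: (boolP (sp nu)) => //= s.
  by have [//|/notB] := boolP (nu \in B); rewrite (negPf h).
apply: (@loop_tgw realized_fun hS _ _ realized_fun_level T S_T T_fe T_ef T_neq0).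
- by move=> F /(_ 0) [u hu]; exists u => a; rewrite hu addr0.
- by move=> u; apply: (realized_fun_wt (fun mu => mu u)).
move=> F hF; have -> : F = F * fw (fun mu => (~~ sp mu)%:R).
  apply: fun_algP => a /=; case: (boolP (sp (wt a))) => [/spP s|_] /=; last by rewrite mulr1.
  by rewrite hF // mul0r.
by rewrite (iotaM (D := D)) Kout mulr0.
Qed.
End FiniteCase.

(** * Modules with an injective root vector *)

Section InfiniteCase.
Hypothesis product_poly : forall y z (r : W -> k),
  (forall mu, lact y (lact z (mv mu)) = r mu *: mv mu) ->
  exists2 P, polyf P & forall mu, supp mu -> P mu = r mu.
Hypothesis dense : forall P, polyf P -> forall gamma,
  (exists2 mu, supp mu & supp (mu + gamma)) ->
  (forall mu, supp mu -> supp (mu + gamma) -> P mu = 0) -> forall mu, P mu = 0.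
Hypothesis M_faithful : forall x : g, (forall m : M, lact x m = 0) -> x = 0.

Inductive loop_polyf : (L -> k) -> Prop :=
  | lpf_wt P : polyf P -> loop_polyf (fun a => P (wt a))
  | lpf_level : loop_polyf (fun a => (a ord0)%:~R)
  | lpf_add F G : loop_polyf F -> loop_polyf G -> loop_polyf (fun a => F a + G a)
  | lpf_mul F G : loop_polyf F -> loop_polyf G -> loop_polyf (fun a => F a * G a).

Lemma loop_polyf_alg : translation_algebra loop_polyf.
Proof.
split=> [c|F G|F G|d F].
- by apply: (@lpf_wt (fun=> c)); apply: polyf_const.
- exact: lpf_add.
- exact: lpf_mul.
elim=> {F} [P hP||F G _ IHF _ IHG|F G _ IHF _ IHG].
- have -> : (fun a => P (wt (a + d))) = (fun a => (fun mu => P (mu + wt0 d)) (wt a)).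
    by apply/funext => a; rewrite wt_add.
  by apply: (@lpf_wt (fun mu => P (mu + wt0 d))); apply: polyf_shift.
- have -> : (fun a : L => ((a + d)%R ord0)%:~R) = (fun a : L => (a ord0)%:~R + (d ord0)%:~R) :> (L -> k).
    by apply/funext => a; rewrite ffunE rmorphD.
  apply: lpf_add; first exact: lpf_level.
  by apply: (@lpf_wt (fun=> (d ord0)%:~R)); apply: polyf_const.
- exact: lpf_add.
- exact: lpf_mul.
Qed.

Lemma loop_polyf_realized F : loop_polyf F -> exists u : env_alg (affine kappa), forall a,
  env_act u (wvec a) = F a *: wvec a.
Proof.
elim=> {F} [P /polyf_realized[u hu]||F G _ [u hu] _ [v hv]|F G _ [u hu] _ [v hv]].
- by exists u => a; apply: hu.
- exact: level_realized.
- by exists (u + v) => a; rewrite env_actD hu hv scalerDl.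
- exists (u * v) => a.
  by rewrite env_actM hv (lin_Z (env_act_linear u)) hu scalerA mulrC.
Qed.

Lemma loop_polyf_level F (l : int) : loop_polyf F ->
  exists2 P, polyf P & forall a : L, a ord0 = l -> F a = P (wt a).
Proof.
elim=> {F} [P hP||F G _ [P hP PE] _ [Q hQ QE]|F G _ [P hP PE] _ [Q hQ QE]].
- by exists P.
- by exists (fun=> l%:~R) => [|a ->]; first exact: polyf_const.
- exists (fun mu => P mu + Q mu); first exact: polyf_add.
  by move=> a al'; rewrite PE // QE.
- exists (fun mu => P mu * Q mu); first exact: polyf_mul.
  by move=> a al'; rewrite PE // QE.
Qed.

(** The lattice point is read off from an expansion of the monomial in the [wvec a]: some term must
    have this weight and this level. *)
Lemma wt_level mu (l : int) : supp mu -> exists2 a : L, wt a = mu & a ord0 = l.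
Proof.
move=> smu; have [s sE] := wvec_span (lmono (mv mu) l : V).
have := congr1 (fun x : laurent M => x l) sE.
rewrite (lcoef_sum _ (fun p => p.2 *: wvec p.1)) lcoef_mono eqxx => e'.
have [|p [_ pmu pne]] := weight_occurs (wt := fun p : L * k => wt p.1) _ (mv_wv mu) smu e'.
  move=> p; rewrite lcoefZ lcoef_mono; apply: wv_Z.
  by case: eqP => // _; apply: wv_0.
exists p.1 => //; move: pne; rewrite lcoefZ lcoef_mono; case: eqP => [->//|_].
by rewrite scaler0.
Qed.

Theorem infinite_case : loop_tgw_realized.
Proof.
have [t tE] := t_values.
have /boolp.choice [T hT] : forall i, exists P, polyf P /\ forall mu, supp mu -> P mu = t i mu.
  by move=> i; have [P hP PE] := product_poly (tE i); exists P.
have T_fe i mu : lact (serre_f i) (lact (serre_e i) (mv mu)) = T i mu *: mv mu.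
  rewrite tE; have [->|/eqP smu] := eqVneq (mv mu) 0; first by rewrite !scaler0.
  by have [_ ->] := hT i.
(* By faithfulness [serre_f i] does not act by zero, so it joins two weights. *)
have edge i : exists2 mu, supp mu & supp (mu - aff_root i).
  have [hx hy _] := aff_root_pair i; have [_ f_neq0] := chevalley_neq0 (chevalley_swap (aff_root_pair i)).
  apply: contrapT => no; apply: f_neq0; apply: M_faithful.
  apply: (weight_ext M_weight); first exact: lact_linearr.
    by move=> b v v'; rewrite scaler0 addr0.
  move=> mu m hm; have [b ->] := mv_span hm; rewrite lactZr.
  have [c cE] := mv_span (wv_act hy (mv_wv mu)); rewrite cE.
  have [->|/eqP s1] := eqVneq (mv (mu - aff_root i)) 0; first by rewrite !scaler0.
  have [e'|/eqP s2] := eqVneq (mv mu) 0; last by case: no; exists mu.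
  by rewrite -cE e' lact0r scaler0.
have T_ef i mu : lact (serre_e i) (lact (serre_f i) (mv mu)) = T i (mu - aff_root i) *: mv mu.
  have [hx hy [u uE u2]] := aff_root_pair i.
  have efE nu : lact (serre_e i) (lact (serre_f i) (mv nu)) = (T i nu + (nu u : k)) *: mv nu.
    by rewrite lactC -uE mv_wv T_fe scalerDl addrC.
  (* When nu and nu - alpha_i are both weights this is [ef_value]; by density it is an identity of
     polynomials, which also covers the weights nu for which nu - alpha_i is not a weight. *)
  have key nu : T i (nu - aff_root i) - (T i nu + (nu u : k)) = 0.
    move: nu; apply: (@dense _ _ (- aff_root i)) => [||nu s1 s2].
    - apply: polyf_sub; first by apply: polyf_shift; have [] := hT i.
      by apply: polyf_add; [have [] := hT i | apply: polyf_ev].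
    - exact: edge.
    have := ef_value s2 (T_fe i _); rewrite efE => /eqP.
    rewrite -subr_eq0 -scalerBl scaler_eq0 => /orP[/eqP e'|/eqP //].
    by rewrite -[RHS]oppr0 -e' opprB.
  by rewrite efE; congr (_ *: _); apply/eqP; rewrite eq_sym -subr_eq0 key.
pose hS := loop_polyf_alg.
have S_T i : loop_polyf (fun a => T i (wt a)) by apply: lpf_wt; have [] := hT i.
have T_neq0 i : datum_t hS S_T i <> 0.
  (* If [T i] were zero, the coroot [e_i, f_i] would vanish on all weights, although it takes values
     differing by 2 at the two ends of an edge. *)
  move=> T0; have Tz a : T i (wt a) = 0 by have := congr1 (fun F : fun_alg hS => F a : k) T0.
  have [hx hy [u uE u2]] := aff_root_pair i; have [mu s1 s2] := edge i.
  have hz nu : supp nu -> (nu u : k) = 0.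
    move=> sn; have [a aE _] := wt_level 0 sn.
    have := lactC (serre_e i) (serre_f i) (mv nu); rewrite T_ef T_fe -aE -wt_degN !Tz !scale0r addr0 -uE mv_wv.
    by move/esym/eqP; rewrite aE scaler_eq0 => /orP[/eqP //|/eqP].
  have := hz _ s2; rewrite add_lfunE opp_lfunE hz // u2 sub0r => /eqP.
  by rewrite oppr_eq0 natr_eq0_char0.
exists (shift_datum T_neq0).
apply: (@loop_tgw loop_polyf hS loop_polyf_realized _ lpf_level T S_T T_fe T_ef T_neq0).
  by move=> u; apply: (@lpf_wt (fun mu => mu u)); apply: polyf_ev.
move=> F hF; suff -> : F = 0 by apply: (lin_0 (@iota_linear _ _ _ _)).
apply: fun_algP => a.
have /asboolP SF : fun_pred hS F by case: (F).
(* On a fixed level the function is a polynomial in the weight, and every weight of [M] occurs on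
   that level, so density applies. *)
have [P hP PE] := loop_polyf_level (a ord0) SF.
have P0 : forall mu, P mu = 0.
  apply: (@dense _ hP 0) => [|mu smu _]; first by exists lam0; rewrite ?addr0.
  have [b bE b0] := wt_level (a ord0) smu.
  by rewrite -bE -PE // hF // bE.
by rewrite PE // P0.
Qed.
End InfiniteCase.
End Assembly.

Theorem theorem5p15 (k : closedFieldType) (k_char0 : [pchar k] =i pred0)
    (g : lieVectType k) (g_simple : simple_lie g)
    (h : {vspace g}) (h_cartan : cartan_subalgebra h)
    (n : nat) (e f : 'I_n -> g) (ef_serre : serre_generators h e f)
    (e0 f0 : g) (ef0_serre : affine_serre_pair h e f e0 f0)
    (kappa : inv_form g)
    (M : lieModule g) (M_simple : simple_module M)
    (M_weight : weight_module h M) (M_pointed : completely_pointed h M) :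
  exists (D : tgw_datum k 'I_n.+1) (mu : 'I_n.+1 -> 'I_n.+1 -> k)
    (psi : {rmorphism env_alg (affine kappa) -> tgw_alg D mu}),
    [/\ (forall i j, i <> j -> mu i j <> 0) /\ scalable psi,
        (forall a : tgw_alg D mu, exists u, psi u = a),
        (forall u, psi u = 0 <-> annihilator (loop_module kappa M) u),
        (forall i : 'I_n,
          psi (env_gen (aff_loop kappa (lmono (e i) 0))) =
            tgw_X D mu (lift ord0 i) /\
          psi (env_gen (aff_loop kappa (lmono (f i) 0))) =
            tgw_Y D mu (lift ord0 i)) &
        psi (env_gen (aff_loop kappa (lmono e0 1))) = tgw_X D mu ord0 /\
        psi (env_gen (aff_loop kappa (lmono f0 (-1)))) = tgw_Y D mu ord0].
Proof.
have [alpha alpha_base ef_pair] := ef_serre.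
have [theta ef0_pair ef0_comm] := ef0_serre.
have [mv [mv_wv mv_span]] := pointed_family M_pointed.
suff [D [psi [psiZ psi_onto psi_ker psi_gen]]] : loop_tgw_realized kappa M e f e0 f0.
  exists D, (fun _ _ => 1), psi; split=> //.
  - by split=> // i j _; apply/eqP; apply: oner_neq0.
  - by move=> i; have := psi_gen (lift ord0 i); rewrite /affine_e /affine_f /serre_e /serre_f liftK oppr0.
  - by have := psi_gen ord0; rewrite /affine_e /affine_f /serre_e /serre_f unlift_none.
have [lam0 lam0_supp] := supp_exists M_simple M_weight mv_span.
have [triv|nontriv] := pselect (forall (x : g) (m : M), lact x m = 0).
  (* A trivial [M] is not faithful, so the weight decomposition of g cannot be obtained from it; but
     its only weight is 0, which places it in the finite case. *)
  have supp0 mu : mv mu <> 0 -> mu = 0.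
    move=> smu; apply/lfunP => u; rewrite zero_lfunE.
    have /esym/eqP := mv_wv mu u; rewrite triv scaler_eq0 => /orP[/eqP //|/eqP //].
  have lattice mu : mv mu <> 0 -> exists c : 'I_n -> int, mu = lam0 + \sum_i alpha i *~ c i.
    move=> smu; exists (fun=> 0); rewrite (supp0 _ smu) (supp0 _ lam0_supp).
    by rewrite big1 ?addr0 // => i _; rewrite mulr0z.
  have supp_Sw mu : mv mu <> 0 -> mu \in [:: 0] by move/supp0 ->; rewrite inE.
  by apply: (finite_case k_char0 g_simple kappa M_simple M_weight mv_wv mv_span
    alpha_base ef_pair ef0_pair ef0_comm lattice _ supp_Sw); left.
have {}nontriv : exists (x : g) (m : M), lact x m <> 0.
  apply: contrapT => no; apply: nontriv => x m; apply: contrapT => xm.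
  by apply: no; exists x, m.
have M_faithful := simple_faithful g_simple nontriv.
have g_weight := adjoint_weight_module M_weight M_faithful.
have H_weight0 := weight0_cartan M_weight M_faithful h_cartan.
have lattice mu : mv mu <> 0 -> exists c : 'I_n -> int, mu = lam0 + \sum_i alpha i *~ c i.
  move: mu; apply: (supp_connected g_weight M_simple mv_wv mv_span lam0_supp).
    by exists (fun=> 0); rewrite big1 ?addr0 // => i _; rewrite mulr0z.
  move=> mu gamma _ [c ->] /(root_int alpha_base)[d ->] _.
  exists (fun i => c i + d i); rewrite -addrA -big_split; congr (_ + _).
  by apply: eq_bigr => i _; rewrite mulrzDr.
have gen := chevalley_generated k_char0 g_simple kappa g_weight H_weight0 alpha_base ef_pair.
have [has_inj|no_inj] := pselect (exists beta, injective_root (H := h) M beta).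
  apply: (infinite_case k_char0 g_simple kappa M_simple M_weight mv_wv mv_span
    alpha_base ef_pair ef0_pair ef0_comm lam0_supp) => //.
  - by right.
  - move=> y z r; exact: (product_polynomial k_char0 g_simple kappa g_weight
      H_weight0 M_simple M_weight mv_wv mv_span alpha_base has_inj).
  - by move=> P hP; apply: (supp_dense k_char0 g_simple kappa g_weight
      H_weight0 M_simple M_weight mv_wv mv_span has_inj hP).
have [Sw supp_Sw] : exists S : seq 'Hom(subvs_of h, k^o), forall mu, mv mu <> 0 -> mu \in S.
  apply: (supp_finite k_char0 g_weight M_simple M_weight mv_wv mv_span) => gamma hg.
  by apply: no_inj; exists gamma.
apply: (finite_case k_char0 g_simple kappa M_simple M_weight mv_wv mv_span
  alpha_base ef_pair ef0_pair ef0_comm lattice _ supp_Sw).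
by right.
Qed.
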